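(* Let $L>0$, $\Omega=[0,L]\subset\mathbb{R}$, let $\hbar>0$, $m>0$, $\lambda\in\mathbb{R}$ and $g>0$ be given constants, and consider, with control parameter $\beta\in\mathbb{R}$, $\beta\ne0$, the boundary value problem $$-\frac{\hbar^{2}}{4m}\varphi''+(\beta-\hbar\lambda)\varphi+g\varphi^{3}=0\ \text{ in }(0,L),\qquad \varphi(0)=\varphi(L)=0. \qquad ( * )$$ For $k=1,2,\dots$ let $\beta_k=-\big(\frac{\hbar^{2}\xi_k}{4m}-\hbar\lambda\big)$, where $\xi_k$ is the $k$-th Dirichlet eigenvalue of $-\frac{d^2}{dx^2}$ on $[0,L]$. Then the following hold. (1) Let $\beta_i$ and $\beta_j$ ($i\neq j$) be two different bifurcation points, and for $k=i,j$ let $\varphi_k(x,\beta)$ be the nontrivial solution of $( * )$ bifurcating from $(0,\beta_k)$. Then there does not exist $\theta\in\mathbb{R}$ such that $$\varphi_i(x,\theta)=\varphi_j(x,\theta)\quad\text{(as functions of }x).$$ Namely, the two bifurcated branches, $\Gamma_i$ bifurcating from $(0,\beta_i)$ and $\Gamma_j$ bifurcating from $(0,\beta_j)$, do not intersect. (2) If $\beta_{j+1}<\beta<\beta_j$ for some $j\in\{1,2,\dots\}$, then there exist at least $2j$ new quantum states $\varphi(\beta)$, i.e. at least $2j$ nontrivial solutions of $( * )$ for this value of $\beta$.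
   Context: The unknown $\varphi$ is a complex-valued function of $x$, sought in $X_1=H^2(\Omega)\cap H_0^1(\Omega)$. Physically, $\hbar$ is the Planck constant, $m$ the mass of the bosons, $\lambda=E/\hbar$ with $E$ the total energy, $g$ the inter-particle interaction constant, and $\beta$ the external potential. The eigenvalues $0<\xi_1\le\xi_2\le\cdots$ are those of $-e''=\xi e$ on $(0,L)$ with $e(0)=e(L)=0$; the corresponding eigenfunctions are normalized by $\int_0^L e_k^2\,dx=1$. A solution is nontrivial if it is not identically zero. A bifurcation point of $( * )$ is a value $\beta_c$ such that nontrivial solutions $\varphi(\cdot,\beta)$ of $( * )$ exist for $\beta$ arbitrarily close to $\beta_c$ (on one side of it) with $\varphi(\cdot,\beta)\to0$ as $\beta\to\beta_c$; the points $\beta_k$ are bifurcation points of this kind. ''The nontrivial solution $\varphi_k(x,\beta)$ bifurcating from $(0,\beta_k)$'' means a family of nontrivial solutions of $( * )$, depending continuously on $\beta$ (with values in $X_1$) on an interval having $\beta_k$ as an endpoint, with $\varphi_k(\cdot,\beta)\to0$ as $\beta\to\beta_k$; its branch is $\Gamma_k=\{(\varphi_k(\cdot,\beta),\beta)\}$. New quantum states are the nontrivial solutions of $( * )$ (equivalently, the wave functions $\psi=e^{-i\lambda t}\varphi$). *)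

(* Defs.v *)
From HB Require Import structures.
From mathcomp Require Import all_boot all_order all_algebra.
From mathcomp Require Import all_classical all_reals all_analysis.
From mathcomp.real_closed Require Import complex.
Import Order.TTheory GRing.Theory Num.Theory.
Import numFieldNormedType.Exports.

Set Implicit Arguments.
Unset Strict Implicit.
Unset Printing Implicit Defensive.

Local Open Scope ring_scope.
Local Open Scope classical_set_scope.
Local Open Scope complex_scope.

Section Sobolev.
Context {R : realType}.
Implicit Types (L : R) (u v eta : R -> R) (f : R -> R[i]).

Local Notation mu := (@lebesgue_measure R).

Definition L2 L u : Prop := u \_ `]0, L[ \in Lfun mu 2%:E.

Definition test_function L eta : Prop :=
  [/\ forall x, derivable eta x 1, continuous eta^`() &
      exists a b, [/\ 0 < a, b < L & forall x, eta x != 0 -> a <= x <= b]].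

Definition is_weak_derivative L u v : Prop :=
  L2 L v /\
  forall eta, test_function L eta ->
    \int[mu]_(x in `]0, L[) (u x * (eta^`()%classic x)) =
    - \int[mu]_(x in `]0, L[) (v x * eta x).

(* Determined up to a null subset of (0, L); the zero function when u has no
   weak derivative in L^2(0, L). *)
Definition wderiv L u : R -> R := xget (cst 0) [set v | is_weak_derivative L u v].

Definition H2 L u : Prop :=
  [/\ L2 L u, is_weak_derivative L u (wderiv L u) &
      is_weak_derivative L (wderiv L u) (wderiv L (wderiv L u))].

Definition H2_sqnorm L u : R :=
  \int[mu]_(x in `]0, L[)
    (u x ^+ 2 + wderiv L u x ^+ 2 + wderiv L (wderiv L u) x ^+ 2).

Definition re_part f : R -> R := fun x => complex.Re (f x).
Definition im_part f : R -> R := fun x => complex.Im (f x).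

Definition wderiv2C L f : R -> R[i] := fun x =>
  wderiv L (wderiv L (re_part f)) x +i* wderiv L (wderiv L (im_part f)) x.

(* The complex space H^2(0, L) /\ H^1_0(0, L).  A class of functions modulo
   equality a.e. is represented by its continuous representative on [0, L],
   extended by 0 to the real line, so that two elements are the same iff they
   are equal as functions; the condition f x = 0 at x = 0 and x = L is the
   Dirichlet condition. *)
Definition X1 L f : Prop :=
  [/\ H2 L (re_part f), H2 L (im_part f),
      continuous (re_part f), continuous (im_part f) &
      forall x, ~~ (0 < x < L) -> f x = 0].

Definition X1_norm L f : R :=
  Num.sqrt (H2_sqnorm L (re_part f) + H2_sqnorm L (im_part f)).

End Sobolev.

Section Eigenvalues.
Context {R : realType}.
Implicit Types (L s : R) (u v : R -> R).

Definition dirichlet_eigenfunction L s u : Prop :=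
  [/\ {within `[0, L], continuous u},
      forall x, 0 < x < L ->
        [/\ derivable u x 1, derivable u^`() x 1 & - (u^`()^`()%classic x) = s * u x],
      u 0 = 0, u L = 0 &
      exists2 x, 0 <= x <= L & u x != 0].

Definition inner_product L u v : R :=
  \int[lebesgue_measure]_(x in `[0, L]) (u x * v x).

(* xi 1 <= xi 2 <= ... lists all the eigenvalues, each repeated according to
   its multiplicity: the eigenfunctions e 1, e 2, ... form a maximal
   orthonormal family of eigenfunctions.  xi 0 and e 0 are irrelevant. *)
Definition dirichlet_eigenvalues L (xi : nat -> R) : Prop :=
  [/\ 0 < xi 1%N,
      forall k l, (0 < k <= l)%N -> xi k <= xi l &
      exists e : nat -> R -> R,
      [/\ forall k, (0 < k)%N -> dirichlet_eigenfunction L (xi k) (e k),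
          forall k l, (0 < k)%N -> (0 < l)%N ->
            inner_product L (e k) (e l) = (k == l)%:R &
          forall s u, dirichlet_eigenfunction L s u ->
            exists2 k, (0 < k)%N & inner_product L (e k) u != 0]].

End Eigenvalues.

Section Problem.
Context {R : realType}.
Variables (L hbar m lambda g : R).
Implicit Types (beta theta : R) (f : R -> R[i]).

Definition critical_beta (xi : nat -> R) (k : nat) : R :=
  - (hbar ^+ 2 * xi k / (4 * m) - hbar * lambda).

Definition is_solution beta f : Prop :=
  X1 L f /\
  {ae (@lebesgue_measure R), forall x, 0 < x < L ->
    - (hbar ^+ 2 / (4 * m))%:C * wderiv2C L f x
    + (beta - hbar * lambda)%:C * f x + g%:C * f x ^+ 3 = 0}.

Definition nontrivial_solution beta f : Prop :=
  is_solution beta f /\ exists2 x, 0 <= x <= L & f x != 0.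

Definition bifurcation_point beta_c : Prop :=
  let near_solution beta eps :=
    beta != 0 /\ exists2 f, nontrivial_solution beta f & X1_norm L f < eps in
  (forall eps, 0 < eps ->
     exists2 beta, beta_c - eps < beta < beta_c & near_solution beta eps) \/
  (forall eps, 0 < eps ->
     exists2 beta, beta_c < beta < beta_c + eps & near_solution beta eps).

(* As beta_c is in the closure of the interval I but not in I, it is an
   endpoint of I.  The interval may contain 0, where the boundary value problem
   is not considered: there the family is only required to be continuous. *)
Definition bifurcating_family beta_c (I : set R) (phi : R -> R -> R[i]) : Prop :=
  [/\ [/\ is_interval I, ~ I beta_c & closure I beta_c],
      forall beta, I beta -> X1 L (phi beta),
      forall beta, I beta -> beta != 0 -> nontrivial_solution beta (phi beta),
      forall theta, I theta ->
        X1_norm L (phi beta - phi theta) @[beta --> within I (nbhs theta)]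
          --> (0 : R) &
      X1_norm L (phi beta) @[beta --> within I (nbhs beta_c)] --> (0 : R)].

End Problem.

Definition branch {R : realType} (I : set R) (phi : R -> R -> R[i]) :
    set ((R -> R[i]) * R) :=
  [set (phi beta, beta) | beta in I].

(* Main.v *)
(** The claim on branches rests on a discrete invariant.  A nontrivial solution is
    [f = p r] with [p = f'(0)] and [r'' = a r + c r^3], [r(0) = 0], [r'(0) = 1],
    where [c] is a multiple of [p^2].  For every integer [d > 0] the condition
    [r(L / d) = 0] is locally constant in [(a, c)]: if [T = L / d] is a zero of [r],
    then [r] is antiperiodic or periodic of step [T], and for a nearby [s] with
    [q = s(T) <> 0] the difference [w(x) = s(x + T) - r'(T) s(x)] satisfies
    [w / q ~ r'], so that the telescoping sum of the [r'(T)^(j+1) w(j T)], which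
    is [0] because [s(L) = 0], would be [q] times a number close to [+- d].
    Near [(0, beta_k)] the profile [r] is close to [sin (w x) / w] with
    [w L = n_k pi], so [d = n_k] separates the branches.

    For the number of solutions, [f = i u] turns the equation into
    [u'' = - a u - b u^3] with [a, b > 0], which has for every large [k] a solution
    with [k] arches: [u = A sin theta] with
    [theta' = sqrt (a + s (1 + sin^2 theta))], [s = b A^2 / 2], and [s] is chosen by
    the intermediate value theorem so that [theta(L) = k pi]. *)
Require Import Defs.
From mathcomp Require Import all_boot all_order all_algebra.
From mathcomp Require Import all_classical all_reals all_analysis.
From mathcomp.real_closed Require Import complex.
From mathcomp Require Import measurable_realfun ring lra.
Import Order.TTheory GRing.Theory Num.Theory.
Import numFieldNormedType.Exports.

Set Implicit Arguments.
Unset Strict Implicit.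
Unset Printing Implicit Defensive.

Local Open Scope ring_scope.
Local Open Scope classical_set_scope.

(** * Real calculus: derivative rules, monotonicity, primitives *)

Section Calculus.
Context {R : realType}.
Implicit Types (f g : R -> R) (a b x : R).

(** Solutions are complex-valued, so counting zeros inside [(0, L)] gives no invariant: a small
    complex perturbation can remove a real zero. A zero at [L / d] persists because it is tied to
    the zero at [L], which the boundary condition maintains along a branch. Dividing by [p = f'(0)]
    keeps information at the bifurcation point: there [f] tends to [0], whereas [f / p] solves a
    linear equation with bounded potential and initial data [0], [1], so it stays bounded and does
    not collapse. Limits are replaced by explicit Gronwall estimates, uniform over all profiles with
    a common bound [B]. Closeness is measured in a norm built on weak derivatives. Solutions are
    therefore identified with twice differentiable functions, and the Dirichlet conditions let the
    [L^2] norm of the second derivative control the slope at [0], hence the parameter [c]. For real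
    values the cubic term with [g > 0] is defocusing; the factor [i] reverses its sign. The
    frequency then grows with the amplitude, so the number of arches is bounded only from below, and
    any prescribed number of solutions is available. *)

Lemma is_derive_eqr f x d l : is_derive x 1 f d -> d = l -> is_derive x 1 f l.
Proof. by move=> ? <-. Qed.

Lemma is_derive_continuous f x d : is_derive x 1 f d -> {for x, continuous f}.
Proof.
by move=> [fx _]; apply/differentiable_continuous/derivable1_diffP.
Qed.

Lemma is_derive_mul f g x df dg : is_derive x 1 f df -> is_derive x 1 g dg ->
  is_derive x 1 (fun y => f y * g y) (df * g x + f x * dg).
Proof.
move=> hf hg.
have h : is_derive x 1 (fun y => f y * g y) (f x *: dg + g x *: df).
  exact: is_deriveM.
by apply: (is_derive_eqr h); rewrite /GRing.scale/=; ring.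
Qed.

Lemma is_derive_add f g x df dg : is_derive x 1 f df -> is_derive x 1 g dg ->
  is_derive x 1 (fun y => f y + g y) (df + dg).
Proof. by move=> hf hg; exact: (@is_deriveD _ _ _ f g x 1 df dg hf hg). Qed.

Lemma is_derive_sub f g x df dg : is_derive x 1 f df -> is_derive x 1 g dg ->
  is_derive x 1 (fun y => f y - g y) (df - dg).
Proof. by move=> hf hg; exact: (@is_deriveB _ _ _ f g x 1 df dg hf hg). Qed.

Lemma is_derive_scale (k : R) f x df : is_derive x 1 f df ->
  is_derive x 1 (fun y => k * f y) (k * df).
Proof. by move=> hf; exact: (@is_deriveZ _ _ _ f k x 1 df hf). Qed.

Lemma is_derive_compr f g x df dg : is_derive (g x) 1 f df ->
  is_derive x 1 g dg -> is_derive x 1 (fun y => f (g y)) (df * dg).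
Proof. by move=> hf hg; exact: (@is_derive1_comp _ f g x df dg hf hg). Qed.

Lemma is_derive_shift f x t d : is_derive (x + t) 1 f d ->
  is_derive x 1 (fun y => f (y + t)) d.
Proof.
move=> hf; have h : is_derive x 1 (fun y : R => y + t) 1.
  have := is_derive_add (is_derive_id x 1) (is_derive_cst t x 1).
  by rewrite addr0.
have := @is_derive_compr f (fun y => y + t) x d 1 hf h.
by rewrite mulr1.
Qed.

Lemma is_derive_ge0_le f f' a b : a <= b ->
  (forall x, a <= x <= b -> is_derive x 1 f (f' x)) ->
  (forall x, a <= x <= b -> 0 <= f' x) -> f a <= f b.
Proof.
move=> ab df f0.
have [|| c cab e] := @MVT_segment R f f' a b ab.
- by move=> x; rewrite in_itv/= => /andP[xa xb]; apply: df; rewrite !ltW.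
- apply: derivable_within_continuous => x; rewrite in_itv/= => /df[].
  by [].
rewrite -subr_ge0 e mulr_ge0 ?subr_ge0//; apply: f0.
by move: cab; rewrite in_itv.
Qed.

Lemma is_derive0_eq f a b : a <= b ->
  (forall x, a <= x <= b -> is_derive x 1 f 0) -> f b = f a.
Proof.
move=> ab df; apply/eqP; rewrite eq_le; apply/andP; split.
- rewrite -lerN2; apply: (@is_derive_ge0_le (fun x => - f x) (fun=> 0)) => //.
  by move=> x /df h; have := is_deriveN h; rewrite oppr0.
- exact: (@is_derive_ge0_le f (fun=> 0)).
Qed.

Lemma is_derive_Rolle f f' a b : a < b ->
  (forall x, a <= x <= b -> is_derive x 1 f (f' x)) -> f a = f b ->
  exists2 c, a < c < b & f' c = 0.
Proof.
move=> ab df fab; have [||//|c cab [_ dc]] := @Rolle R f a b ab.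
- move=> x; rewrite in_itv/= => /andP[xa xb].
  by have [|//] := df x _; rewrite !ltW.
- by apply: derivable_within_continuous => x; rewrite in_itv/= => /df[].
move: cab; rewrite in_itv/= => cab; exists c => //.
have /df[_ <-] : a <= c <= b by case/andP: cab => ? ?; rewrite !ltW.
by rewrite dc.
Qed.

Lemma continuous_integrable_itv f a b : continuous f ->
  (@lebesgue_measure R).-integrable `[a, b] (EFin \o f).
Proof.
move=> cf; apply: continuous_compact_integrable; first exact: segment_compact.
exact: continuous_subspaceT.
Qed.

Lemma is_derive_itv_integral f a x : continuous f -> a < x ->
  is_derive x 1 (fun y => \int[lebesgue_measure]_(t in `[a, y]) f t) (f x).
Proof.
move=> cf ax; have xx : x < x + 1 by rewrite ltrDl.
have [d e] := @continuous_FTC1_closed R f a x (x + 1) xx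
  (continuous_integrable_itv a (x + 1) cf) ax (cf x).
by apply: DeriveDef; [exact: d | rewrite -derive1E; exact: e].
Qed.

(** The integral from [a] is differentiable only to the right of [a], so the base point moves with
    [x]; subtracting the value at [0] makes the result independent of it ([GE]). *)
Lemma is_derive_primitive f : continuous f ->
  exists F : R -> R, F 0 = 0 /\ forall x, is_derive x 1 F (f x).
Proof.
move=> cf; pose G a y : R := \int[lebesgue_measure]_(t in `[a, y]) f t.
have GE a b x : a < x -> b < x -> a < 0 -> b < 0 -> G a x - G a 0 = G b x - G b 0.
  move=> ax bx a0 b0.
  have key u v : u <= v -> (forall y, u <= y <= v -> (a < y) && (b < y)) ->
     G a v - G b v = G a u - G b u.
    move=> uv h; apply: (@is_derive0_eq (fun y => G a y - G b y)) => // y /h /andP[ay by_].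
    have := is_derive_sub (is_derive_itv_integral cf ay) (is_derive_itv_integral cf by_).
    by rewrite subrr.
  have : G a x - G b x = G a 0 - G b 0.
    have [x0|/ltW x0] := leP 0 x.
      by apply: key => // y /andP[y0 _]; rewrite !(lt_le_trans _ y0).
    by symmetry; apply: key => // y /andP[y0 _]; rewrite !(lt_le_trans _ y0).
  by move=> h; lra.
pose F x := G (Num.min x 0 - 1) x - G (Num.min x 0 - 1) 0.
exists F; split; first by rewrite /F subrr.
move=> x; pose a := Num.min x 0 - 2.
have ax : a < x by rewrite /a; have [|] := leP x 0; lra.
have a0 : a < 0 by rewrite /a; have [|] := leP x 0; lra.
apply: (@near_eq_is_derive _ _ _ (fun y => G a y - G a 0)).
  have : \forall y \near x, a < y by exact: lt_nbhsr.
  apply: filterS => y ay; rewrite /F; apply: GE => //.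
  - by have [|] := leP y 0; lra.
  - by have [|] := leP y 0; lra.
have := is_derive_sub (is_derive_itv_integral cf ax) (is_derive_cst (G a 0) x 1).
by rewrite subr0.
Qed.

End Calculus.

(** * Square-integrable functions on [(0, L)] *)

Section LebesgueSpaces.
Context {R : realType}.
Implicit Types (L : R) (u v f g : R -> R).
Local Notation mu := (@lebesgue_measure R).

Lemma ae_imp (P Q : R -> Prop) : {ae mu, forall x, P x} ->
  (forall x, P x -> Q x) -> {ae mu, forall x, Q x}.
Proof.
have F : Filter (almost_everywhere mu) := ae_filter_ringOfSetsType _.
by move=> aP PQ; exact: (@filterS _ _ F _ _ PQ aP).
Qed.

Lemma ae_imp2 (P Q S : R -> Prop) : {ae mu, forall x, P x} ->
  {ae mu, forall x, Q x} -> (forall x, P x -> Q x -> S x) ->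
  {ae mu, forall x, S x}.
Proof.
have F : Filter (almost_everywhere mu) := ae_filter_ringOfSetsType _.
by move=> aP aQ PQS; exact: (@filterS2 _ _ F _ _ _ PQS aP aQ).
Qed.

Lemma ae_eq_oo L (T : Type) (f g : R -> T) :
  {ae mu, forall x, 0 < x < L -> f x = g x} ->
  {ae mu, forall x, `]0, L[%classic x -> f x = g x}.
Proof. by move=> h; apply: (ae_imp h) => x; rewrite /= in_itv/=. Qed.

Lemma L2_measurable L u : L2 L u -> measurable_fun `]0, L[ u.
Proof.
rewrite /L2 inE => /andP[]; rewrite inE/= => mf _.
by apply/(measurable_restrictT u) => //; exact: measurable_itv.
Qed.

Lemma L2_sqr_integrable L u : L2 L u ->
  mu.-integrable `]0, L[ (EFin \o (fun x => u x ^+ 2)).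
Proof.
move=> /Lfun2_integrable_sqr h; apply/integrable_mkcond => //.
apply: eq_integrable h => // x _ /=.
by rewrite /patch; case: ifP => //= _; rewrite expr0n.
Qed.

Lemma L2P L u : measurable_fun `]0, L[ u ->
  mu.-integrable `]0, L[ (EFin \o (fun x => u x ^+ 2)) -> L2 L u.
Proof.
move=> mu_ /integrable_mkcond => /(_ (measurable_itv _)) iu.
rewrite /L2 inE; apply/andP; split; rewrite inE/=.
  by apply/(measurable_restrictT u) => //; exact: measurable_itv.
rewrite /finite_norm unlock /Lnorm/=.
have /integrableP[_] := iu.
set X := (X in (X < +oo)%E -> _) => h.
set Y := (X in (X `^ _ < +oo)%E); have -> : Y = X.
  apply: eq_integral => x _ /=; rewrite restrict_EFin /patch/=.
  case: ifP => _; rewrite ?normr0 ?powR_mulrn// ?expr0n/= ?normr0//.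
  by rewrite normrX.
exact: poweR_lty.
Qed.

Lemma continuous_bounded_itv L g : continuous g ->
  exists2 M, 0 <= M & forall x, 0 <= x <= L -> `|g x| <= M.
Proof.
move=> cg; have [L0|L0] := leP 0 L; last first.
  by exists 0 => // x /andP[x0 /(le_trans x0)]; rewrite leNgt L0.
have cng : {within `[0, L], continuous (fun x => `|g x|)}.
  apply: continuous_subspaceT => x.
  exact: (continuous_comp (cg x) (@norm_continuous _ _ (g x))).
have [c _ hc] := EVT_max L0 cng.
by exists `|g c| => // x x0; apply: hc; rewrite in_itv.
Qed.

Lemma integrable_mul_continuous L u g : continuous g ->
  mu.-integrable `]0, L[ (EFin \o u) ->
  mu.-integrable `]0, L[ (EFin \o (fun x => u x * g x)).
Proof.
move=> cg iu; apply: (integrableMl _ iu) => //.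
  by apply: measurable_funTS; exact: continuous_measurable_fun.
have [M M0 gM] := continuous_bounded_itv L cg.
exists M; split; first by rewrite num_real.
move=> y My x /=; rewrite in_itv/= => /andP[x0 xL].
by rewrite (le_trans _ (ltW My))// gM// !ltW.
Qed.

Lemma integrable_cst_itv L (c : R) : mu.-integrable `]0, L[ (EFin \o cst c).
Proof.
have fin : (lebesgue_measure (`]0%R, L[%classic : set R) < +oo)%E.
  by rewrite lebesgue_measure_itv/=; case: ifP => _; rewrite -?EFinB ltry.
apply: measurable_bounded_integrable => //.
exists `|c|; split; first by rewrite num_real.
by move=> y cy x _; exact: ltW.
Qed.

Lemma continuous_integrable_oo L g : continuous g ->
  mu.-integrable `]0, L[ (EFin \o g).
Proof.
move=> cg; have := integrable_mul_continuous cg (integrable_cst_itv L 1).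
by apply: eq_integrable => // x _ /=; rewrite mul1r.
Qed.

Lemma L2_continuous L g : continuous g -> L2 L g.
Proof.
move=> cg; apply: L2P.
  by apply: measurable_funTS; exact: continuous_measurable_fun.
apply: continuous_integrable_oo => x.
by apply: (@continuousM _ _ g g x); exact: cg.
Qed.

Lemma integrable_add L f g : mu.-integrable `]0, L[ (EFin \o f) ->
  mu.-integrable `]0, L[ (EFin \o g) ->
  mu.-integrable `]0, L[ (EFin \o (fun x => f x + g x)).
Proof. by move=> hf hg; apply: (integrableD _ hf hg) => //; exact: measurable_itv. Qed.

Lemma integrable_scale L (k : R) f : mu.-integrable `]0, L[ (EFin \o f) ->
  mu.-integrable `]0, L[ (EFin \o (fun x => k * f x)).
Proof. by move=> hf; apply: (integrableZl _ k hf) => //; exact: measurable_itv. Qed.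

Lemma L2_integrable L u : L2 L u -> mu.-integrable `]0, L[ (EFin \o u).
Proof.
move=> hu; have i2 := integrable_add (integrable_cst_itv L 1) (L2_sqr_integrable hu).
apply: (le_integrable _ _ _ i2) => //.
  by apply/measurable_EFinP; exact: L2_measurable hu.
move=> x _ /=; rewrite lee_fin [leRHS]ger0_norm ?addr_ge0 ?sqr_ge0//.
by rewrite -real_normK ?num_real//; have := normr_ge0 (u x); nra.
Qed.

Lemma Rintegral_ae_eq L f g :
  measurable_fun `]0, L[ f -> measurable_fun `]0, L[ g ->
  {ae mu, forall x, 0 < x < L -> f x = g x} ->
  \int[mu]_(x in `]0, L[) f x = \int[mu]_(x in `]0, L[) g x.
Proof.
move=> mf mg e; rewrite /Rintegral; congr fine; apply: ae_eq_integral => //.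
- exact/measurable_EFinP.
- exact/measurable_EFinP.
- by apply: ae_eq_oo; apply: (ae_imp e) => x h /h /= ->.
Qed.

Lemma Rintegral_eq_oo L f g : (forall x, 0 < x < L -> f x = g x) ->
  \int[mu]_(x in `]0, L[) f x = \int[mu]_(x in `]0, L[) g x.
Proof.
move=> e; apply: eq_Rintegral => x; rewrite inE/= in_itv/=; exact: e.
Qed.

Lemma L2_eq L u v : L2 L u -> (forall x, 0 < x < L -> u x = v x) -> L2 L v.
Proof.
move=> hu e; rewrite /L2 (_ : v \_ _ = u \_ `]0, L[)//; apply/funext => x.
by rewrite /patch; case: ifPn => //; rewrite inE/= in_itv/= => /e.
Qed.

Lemma L2_lin L (k : R) u v : L2 L u -> L2 L v -> L2 L (fun x => u x + k * v x).
Proof.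
move=> hu hv; have mu_ := L2_measurable hu; have mv := L2_measurable hv.
have m : measurable_fun `]0, L[ (fun x => u x + k * v x).
  by apply: measurable_funD => //; apply: measurable_funM.
apply: L2P => //.
have i := integrable_add (integrable_scale 2 (L2_sqr_integrable hu))
  (integrable_scale (2 * k ^+ 2) (L2_sqr_integrable hv)).
apply: (le_integrable _ _ _ i) => //.
  by apply/measurable_EFinP; exact: measurable_funX.
move=> x _ /=; rewrite lee_fin [leRHS]ger0_norm; last first.
  by rewrite -mulrA -exprMn; have := sqr_ge0 (u x); have := sqr_ge0 (k * v x); lra.
rewrite ger0_norm ?sqr_ge0//.
by have := sqr_ge0 (u x - k * v x); nra.
Qed.

End LebesgueSpaces.

(** * Test functions and weak derivatives *)

Section WeakDerivatives.
Context {R : realType}.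
Implicit Types (L a b : R) (u v f g eta : R -> R).
Local Notation mu := (@lebesgue_measure R).

Lemma is_derive_derive1 f g : (forall x : R, is_derive x 1 f (g x)) -> f^`() = g.
Proof. by move=> h; apply/funext => x; have [_ <-] := h x; rewrite derive1E. Qed.

Lemma test_functionI L eta g a b : (forall x : R, is_derive x 1 eta (g x)) ->
  continuous g -> 0 < a -> b < L -> (forall x, ~~ (a <= x <= b) -> eta x = 0) ->
  test_function L eta.
Proof.
move=> de cg a0 bL supp; split.
- by move=> x; have [] := de x.
- by rewrite (is_derive_derive1 de).
- exists a, b; split => // x; apply: contraNT => /supp ->.
  by rewrite eqxx.
Qed.

(** The primitive of the positive part; C^1 regularity is all that [test_function] asks for. *)
Lemma smooth_ramp : exists F F' : R -> R,
  [/\ forall x : R, is_derive x 1 F (F' x), continuous F',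
      forall x : R, x <= 0 -> F x = 0 & forall x : R, 0 < x -> 0 < F x].
Proof.
pose p (x : R) := Num.max x 0.
have cp : continuous p.
  by move=> x; apply: (@continuous_max _ _ id (cst 0) x); [exact: cvg_id | exact: cvg_cst].
have [F [F0 dF]] := is_derive_primitive cp.
have F00 (x : R) : x <= 0 -> F x = 0.
  move=> x0; rewrite -F0; symmetry; apply: is_derive0_eq => // y /andP[_ y0].
  by apply: (is_derive_eqr (dF y)); rewrite /p; have [|] := leP y 0; lra.
have F_ge0 (x : R) : 0 <= x -> 0 <= F x.
  move=> x0; rewrite -{1}F0; apply: (@is_derive_ge0_le _ _ p) => // y _.
  by rewrite /p le_max lexx orbT.
exists F, p; split => // x x0.
(* On [[x / 2, x]] the slope is at least [x / 2], so [F] gains at least [x ^ 2 / 4] there. *)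
have x2 : x / 2 <= x by lra.
have h : F (x / 2) - x / 2 * (x / 2) <= F x - x / 2 * x.
  apply: (@is_derive_ge0_le _ (fun y => F y - x / 2 * y) (fun y => p y - x / 2 * 1)) => // y.
  move=> /andP[hy _]; rewrite /p; have [|] := leP y 0; lra.
have : 0 <= F (x / 2) by apply: F_ge0; lra.
nra.
Qed.

Lemma smooth_bump a b : exists q q' : R -> R,
  [/\ forall x : R, is_derive x 1 q (q' x), continuous q',
      forall x, ~~ (a < x < b) -> q x = 0 & forall x, a < x < b -> 0 < q x].
Proof.
have [F [F' [dF cF F0 Fp]]] := smooth_ramp.
have cF0 : continuous F by move=> x; exact: is_derive_continuous (dF x).
have d1 (x : R) : is_derive x 1 (fun y => F (y - a)) (F' (x - a)) by exact: is_derive_shift.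
have d2 (x : R) : is_derive x 1 (fun y => F (b - y)) (- F' (b - x)).
  have h : is_derive x 1 (fun y : R => b - y) (0 - 1).
    by apply: is_derive_sub.
  have := @is_derive_compr _ F (fun y => b - y) x _ _ (dF (b - x)) h.
  by move=> /is_derive_eqr; apply; ring.
exists (fun x => F (x - a) * F (b - x)),
  (fun x => F' (x - a) * F (b - x) + F (x - a) * - F' (b - x)); split.
- by move=> x; exact: is_derive_mul.
- move=> x.
  have ca : {for x, continuous (fun y : R => y - a)} by apply: cvgB; [exact: cvg_id | exact: cvg_cst].
  have cb : {for x, continuous (fun y : R => b - y)} by apply: cvgB; [exact: cvg_cst | exact: cvg_id].
  apply: cvgD; apply: cvgM.
  + by apply: continuous_comp ca _; exact: cF.
  + by apply: continuous_comp cb _; exact: cF0.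
  + by apply: continuous_comp ca _; exact: cF0.
  + by apply: cvgN; apply: continuous_comp cb _; exact: cF.
- move=> x; rewrite negb_and -!leNgt => /orP[xa|bx].
    by rewrite F0 ?mul0r// subr_le0.
  by rewrite [F (b - x)]F0 ?mulr0// subr_le0.
- by move=> x /andP[ax xb]; rewrite mulr_gt0// Fp// subr_gt0.
Qed.

Lemma Rintegral0_EFin L f : mu.-integrable `]0, L[ (EFin \o f) ->
  \int[mu]_(x in `]0, L[) f x = 0 -> (\int[mu]_(x in `]0%R, L[) (f x)%:E = 0)%E.
Proof.
move=> fi f0; rewrite -[LHS]fineK; first by rewrite -/(Rintegral _ _ _) f0.
exact: integrable_fin_num.
Qed.

(** With [q] a bump on []a, b[], the functions [1 - exp (- n q)] are test functions that converge to
    the indicator of []a, b[]; dominated convergence with bound [|v|] passes to the limit. *)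
Lemma orthogonal_test_itv L v a b : mu.-integrable `]0, L[ (EFin \o v) ->
  (forall eta, test_function L eta -> \int[mu]_(x in `]0, L[) (v x * eta x) = 0) ->
  0 < a -> b < L -> \int[mu]_(x in `]a, b[) v x = 0.
Proof.
move=> iv hv a0 bL; have [q [q' [dq cq' q0 qp]]] := smooth_bump a b.
have cq : continuous q by move=> x; exact: is_derive_continuous (dq x).
pose e x := expR (- q x).
have de (x : R) : is_derive x 1 e (e x * - q' x).
  by apply: (is_derive_compr (is_derive_expR _)); exact: is_deriveN.
have e_ge0 x : 0 <= e x by exact: expR_ge0.
have e1 x : ~~ (a < x < b) -> e x = 1 by rewrite /e => /q0 ->; rewrite oppr0 expR0.
have e_lt1 x : a < x < b -> e x < 1 by move=> /qp h; rewrite /e expR_lt1; lra.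
have e_le1 x : e x <= 1.
  by have [/e_lt1/ltW//|/e1 ->] := boolP (a < x < b).
pose eta n x := 1 - e x ^+ n.
have ce : continuous e by move=> x; exact: is_derive_continuous (de x).
have deX n (x : R) : is_derive x 1 (fun y => e y ^+ n) (n%:R * e x ^+ n.-1 * (e x * - q' x)).
  by have := @is_deriveX _ _ e n x 1 _ (de x); rewrite exprfctE.
have deta n (x : R) : is_derive x 1 (eta n) (0 - n%:R * e x ^+ n.-1 * (e x * - q' x)).
  exact: is_derive_sub.
have ceta n : continuous (eta n) by move=> x; exact: is_derive_continuous (deta n x).
have teta n : test_function L (eta n).
  apply: (test_functionI (deta n) _ a0 bL).
    move=> x; apply: cvgB; first exact: cvg_cst.
    apply: cvgM; first by apply: cvgM; [exact: cvg_cst | exact: is_derive_continuous (deX n.-1 x)].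
    by apply: cvgM; [exact: ce | apply: cvgN; exact: cq'].
  move=> x h; rewrite /eta e1 ?expr1n ?subrr//.
  by apply: contra h => /andP[? ?]; rewrite !ltW.
pose chi (x : R) := \1_(`]a, b[%classic : set R) x : R.
have chiE x : chi x = (a < x < b)%R%:R by rewrite /chi indicE mem_setE in_itv.
have mD : measurable (`]0, L[%classic : set (measurableTypeR R)) by exact: measurable_itv.
have [|||||_ _] := @dominated_convergence _ _ _ mu _ mD
  (fun n x => (v x * eta n x)%:E) (fun x => (v x * chi x)%:E)
  (fun x => `|(v x)%:E|%E).
- move=> n; apply/measurable_EFinP.
  have := integrable_mul_continuous (ceta n) iv.
  by move/(measurable_int _)/measurable_EFinP.
- apply/measurable_EFinP; apply: measurable_funM.
    by have /(measurable_int _)/measurable_EFinP := iv.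
  by apply: measurable_funTS; exact: measurable_indic.
- apply: (@ae_imp _ (fun=> True)); first exact: aeW.
  move=> x _ _; apply: cvg_EFin; first exact: nearW.
  apply: cvgM; first exact: cvg_cst.
  rewrite chiE; have [h|h] := boolP (a < x < b); last first.
    rewrite [X in X @ _ --> _](_ : _ = cst 0); first exact: cvg_cst.
    by apply/funext => n; rewrite /eta e1// expr1n subrr.
  have : (1 - e x ^+ n) @[n --> \oo] --> (1 - 0 : R).
    apply: cvgB; first exact: cvg_cst.
    by apply: cvg_expr; rewrite ger0_norm// e_lt1.
  by rewrite subr0.
- exact: integrable_abse.
- apply: (@ae_imp _ (fun=> True)); first exact: aeW.
  move=> x _ n _; rewrite lee_fin normrM ler_piMr// /eta ger0_norm.
    by rewrite gerBl exprn_ge0.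
  by rewrite subr_ge0 exprn_ile1.
move=> h; have : (\int[mu]_(x in `]0%R, L[) (v x * chi x)%:E = 0)%E.
  have := cvg_lim (@ereal_hausdorff R) h; move=> <-.
  rewrite (_ : (fun n => _) = cst 0%E) ?lim_cst//.
  apply/funext => n /=; apply: (@Rintegral0_EFin _ (fun x => v x * eta n x)).
    exact: integrable_mul_continuous.
  exact: hv.
rewrite (_ : (fun x => _) = (fun x => (v \_ `]a, b[ x)%:E)); last first.
  apply/funext => x; rewrite chiE /patch mem_setE in_itv/=.
  by case: ifP; rewrite ?mulr1 ?mulr0.
move=> /(congr1 fine) /= h0.
have -> : `]a, b[%classic = `]0, L[ `&` `]a, b[ :> set R.
  apply/seteqP; split => x /=; rewrite !in_itv/=; last by case.
  by move=> /andP[ax xb]; split; rewrite ?ax// (lt_trans a0 ax) (lt_trans xb bL).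
by rewrite Rintegral_mkcondr.
Qed.

(** The integral of [v] over every interval interior to [(0, L)] vanishes, so its indefinite
    integral is constant there; Lebesgue differentiation recovers [v] almost everywhere. *)
Lemma orthogonal_test_ae0 L v : mu.-integrable `]0, L[ (EFin \o v) ->
  (forall eta, test_function L eta -> \int[mu]_(x in `]0, L[) (v x * eta x) = 0) ->
  {ae mu, forall x, 0 < x < L -> v x = 0}.
Proof.
move=> iv hv; pose V := v \_ `]0, L[.
have VE (x : R) : 0 < x < L -> V x = v x by move=> h; rewrite /V /patch mem_setE in_itv/= h.
have iV : mu.-integrable setT (EFin \o V).
  have := (@integrable_mkcond _ _ _ mu `]0, L[ (EFin \o v) (measurable_itv _)).1 iv.
  by rewrite restrict_EFin.
have iVS (i : interval R) : mu.-integrable [set` i] (EFin \o V).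
  by apply: integrableS iV => //; exact: measurable_itv.
pose F x := \int[mu]_(t in `]-oo, x]) V t.
have FE (x y : R) : 0 < x -> x <= y -> y < L -> F y = F x.
  move=> x0 xy yL; apply/eqP; rewrite -subr_eq0 /F Rintegral_itvB//.
  rewrite -Rintegral_itv_bndo_bndc; last exact: iVS.
  rewrite -[X in _ == X](@orthogonal_test_itv L v x y iv hv x0 yL); apply/eqP/eq_Rintegral.
  move=> t; rewrite inE/= in_itv/= => /andP[xt ty]; rewrite VE//.
  by rewrite (lt_trans x0 xt) (lt_trans ty yL).
have := @FTC1Ny R V (fun y => iVS _) (integrable_locally (measurable_itv _) iv).
move=> h; apply: (ae_imp h) => x [dF Fx] /andP[x0 xL].
rewrite -VE ?x0// -Fx derive1E.
suff [_ ->] : is_derive x 1 F 0 by [].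
apply: (@near_eq_is_derive _ _ _ (cst (F x))).
have h0 : \forall y \near x, 0 < y by exact: lt_nbhsr.
have hL : \forall y \near x, y < L by exact: lt_nbhsl.
apply: filterS2 h0 hL => y y0 yL /=.
by have [xy|/ltW yx] := leP x y; [rewrite (FE x y) | rewrite (FE y x)].
Qed.

Lemma test_function_continuous L eta : test_function L eta -> continuous eta.
Proof. by move=> [de _ _] x; apply/differentiable_continuous/derivable1_diffP. Qed.

Lemma weak_derivative_unique L u v w :
  is_weak_derivative L u v -> is_weak_derivative L u w ->
  {ae mu, forall x, 0 < x < L -> v x = w x}.
Proof.
move=> [Lv hv] [Lw hw].
have iv := L2_integrable Lv; have iw := L2_integrable Lw.
have ivw := integrable_add iv (integrable_scale (-1) iw).
have h : forall eta, test_function L eta ->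
    \int[mu]_(x in `]0, L[) ((v x + -1 * w x) * eta x) = 0.
  move=> eta teta; have ceta := test_function_continuous teta.
  rewrite (@Rintegral_eq_oo _ L _ (fun x => v x * eta x - w x * eta x)); last first.
    by move=> x _; ring.
  rewrite RintegralB//; try exact: integrable_mul_continuous.
  by rewrite -[X in X - _]opprK -[X in _ - X]opprK -hv// -hw// subrr.
apply: (ae_imp (orthogonal_test_ae0 ivw h)) => x hx x0L.
by have := hx x0L; lra.
Qed.

Lemma weak_derivative_ae_eq L u v u' v' : L2 L u -> L2 L u' -> L2 L v' ->
  {ae mu, forall x, 0 < x < L -> u x = u' x} ->
  {ae mu, forall x, 0 < x < L -> v x = v' x} ->
  is_weak_derivative L u v -> is_weak_derivative L u' v'.
Proof.
move=> Lu Lu' Lv' uu' vv' [Lv h]; split => // eta teta.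
have [_ ceta' _] := teta; have ceta := test_function_continuous teta.
have m (f g : R -> R) : L2 L f -> continuous g -> measurable_fun `]0, L[ (fun x => f x * g x).
  move=> /L2_integrable Lf cg; have := integrable_mul_continuous cg Lf.
  by move/(measurable_int _)/measurable_EFinP.
rewrite -(@Rintegral_ae_eq _ L (fun x => u x * eta^`()%classic x) (fun x => u' x * eta^`()%classic x)); [|exact: m|exact: m|]; last first.
  by apply: (ae_imp uu') => x e /e ->.
rewrite -(@Rintegral_ae_eq _ L (fun x => v x * eta x) (fun x => v' x * eta x)); [|exact: m|exact: m|]; last first.
  by apply: (ae_imp vv') => x e /e ->.
exact: h.
Qed.

Lemma weak_derivative_lin L (k : R) u v u' v' : L2 L u -> L2 L u' ->
  is_weak_derivative L u v -> is_weak_derivative L u' v' ->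
  is_weak_derivative L (fun x => u x + k * u' x) (fun x => v x + k * v' x).
Proof.
move=> Lu Lu' [Lv hv] [Lv' hv']; split; first exact: L2_lin.
move=> eta teta; have [_ ceta' _] := teta; have ceta := test_function_continuous teta.
have key (f f' g : R -> R) : continuous g -> L2 L f -> L2 L f' ->
    \int[mu]_(x in `]0, L[) ((f x + k * f' x) * g x) =
    \int[mu]_(x in `]0, L[) (f x * g x) + k * \int[mu]_(x in `]0, L[) (f' x * g x).
  move=> cg /L2_integrable Lf /L2_integrable Lf'.
  rewrite (@Rintegral_eq_oo _ L _ (fun x => f x * g x + k * (f' x * g x))); last first.
    by move=> x _; ring.
  rewrite RintegralD//; first last.
  - exact/integrable_scale/integrable_mul_continuous.
  - exact: integrable_mul_continuous.
  by rewrite RintegralZl//; exact: integrable_mul_continuous.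
by rewrite !key// hv// hv'//; ring.
Qed.

Lemma Rintegral_oo_cc (a b : R) f : continuous f ->
  \int[mu]_(x in `]a, b[) f x = \int[mu]_(x in `[a, b]) f x.
Proof.
move=> cf; have i := continuous_integrable_itv a b cf.
have S (c d : bool) : mu.-integrable [set` Interval (BSide c a) (BSide d b)] (EFin \o f).
  by apply: integrableS i => //; apply: subset_itv; case: c; case: d; rewrite bnd_simp.
by rewrite Rintegral_itv_bndo_bndc ?Rintegral_itv_obnd_cbnd//; exact: S.
Qed.

(** Integration by parts; the boundary terms vanish with the test function. *)
Lemma weak_derivative_smooth L f g : 0 < L -> (forall x : R, is_derive x 1 f (g x)) ->
  continuous g -> is_weak_derivative L f g.
Proof.
move=> L0 df cg; split; first exact: L2_continuous.
move=> eta teta; have [deta ceta' [a [b [a0 bL supp]]]] := teta.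
have ceta := test_function_continuous teta.
have cf : continuous f by move=> x; exact: is_derive_continuous (df x).
have eta0 x : ~~ (a <= x <= b) -> eta x = 0.
  by move=> h; apply/eqP; apply: contraNT h => /supp.
have c1 : continuous (fun x => f x * eta^`()%classic x).
  by move=> x; apply: cvgM; [exact: cf | exact: ceta'].
have c2 : continuous (fun x => g x * eta x).
  by move=> x; apply: cvgM; [exact: cg | exact: ceta].
have LR (h : R -> R) : continuous h -> (forall x, derivable h x 1) -> derivable_oo_LRcontinuous h 0 L.
  move=> ch dh; split.
  - by move=> x _; exact: dh.
  - by apply: cvg_at_right_filter; exact: ch.
  - by apply: cvg_at_left_filter; exact: ch.
rewrite !Rintegral_oo_cc// (@Rintegration_by_parts _ f eta g eta^`() 0 L L0).
- rewrite [eta L]eta0 ?[eta 0]eta0 ?mulr0 ?subrr ?sub0r//.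
  + by rewrite negb_and -ltNge a0.
  + by rewrite negb_and -!ltNge bL orbT.
- exact: continuous_subspaceT.
- by apply: (LR _ cf) => x; have [] := df x.
- by move=> x _; rewrite (is_derive_derive1 df).
- exact: continuous_subspaceT.
- exact: LR ceta deta.
- by [].
Qed.

(** [wderiv] is a choice among weak derivatives, so it can be identified with a given one only
    almost everywhere. *)
Lemma wderivP L u v : is_weak_derivative L u v ->
  is_weak_derivative L u (wderiv L u) /\
  {ae mu, forall x, 0 < x < L -> wderiv L u x = v x}.
Proof.
move=> h; have hw : is_weak_derivative L u (wderiv L u).
  by rewrite /wderiv; case: xgetP => [w -> //|/(_ v)/(_ h)].
by split => //; exact: weak_derivative_unique h.
Qed.

Lemma weak_derivative_L2 L u v : is_weak_derivative L u v -> L2 L v.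
Proof. by case. Qed.

Lemma H2I L u v w : L2 L u -> is_weak_derivative L u v -> is_weak_derivative L v w ->
  [/\ H2 L u, {ae mu, forall x, 0 < x < L -> wderiv L u x = v x} &
      {ae mu, forall x, 0 < x < L -> wderiv L (wderiv L u) x = w x}].
Proof.
move=> Lu uv vw; have [h1 e1] := wderivP uv.
have h2 : is_weak_derivative L (wderiv L u) w.
  apply: (weak_derivative_ae_eq _ _ _ _ _ vw).
  - exact: weak_derivative_L2 uv.
  - exact: weak_derivative_L2 h1.
  - exact: weak_derivative_L2 vw.
  - by apply: (ae_imp e1) => x h /h.
  - by apply: (@ae_imp _ (fun=> True)); first exact: aeW.
have [h3 e3] := wderivP h2.
by split.
Qed.

End WeakDerivatives.

(** * Du Bois-Reymond regularity and pointwise bounds *)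

Section DirichletRegularity.
Context {R : realType}.
Implicit Types (L : R) (u v w f g eta : R -> R).
Local Notation mu := (@lebesgue_measure R).

Lemma Rintegral_FTC L f g : 0 < L -> (forall x : R, is_derive x 1 f (g x)) -> continuous g ->
  \int[mu]_(x in `]0, L[) g x = f L - f 0.
Proof.
move=> L_gt0 df cg; have cf : continuous f by move=> x; exact: is_derive_continuous (df x).
rewrite Rintegral_oo_cc// /Rintegral (@continuous_FTC2 _ g f 0 L L_gt0)//.
- exact: continuous_subspaceT.
- split.
  + by move=> x _; have [] := df x.
  + by apply: cvg_at_right_filter; exact: cf.
  + by apply: cvg_at_left_filter; exact: cf.
- by move=> x _; rewrite (is_derive_derive1 df).
Qed.

Lemma is_derive_pos_lt f f' (a b : R) : a < b ->
  (forall x : R, is_derive x 1 f (f' x)) -> (forall x, a < x < b -> 0 < f' x) -> f a < f b.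
Proof.
move=> ab df f0; have [|c cab e] := @MVT R f f' a b ab (fun x _ => df x).
  by apply: continuous_subspaceT => x; exact: is_derive_continuous (df x).
rewrite -subr_gt0 e mulr_gt0 ?subr_gt0//; apply: f0.
by move: cab; rewrite in_itv.
Qed.

(** The lemma of du Bois-Reymond. Let [Z] and [Q] be primitives of a test function [z] and of a
    fixed bump [q]. With [c = Z L / Q L] the function [Z - c Q] vanishes near both ends, so it is a
    test function, and testing [u] against its derivative [z - c q] shows that [u - m] is orthogonal
    to [z], where [m] is the average of [u] with weight [q / Q L]. *)
Lemma weak_derivative0_const L u v : 0 < L -> L2 L u -> is_weak_derivative L u v ->
  {ae mu, forall x, 0 < x < L -> v x = 0} ->
  exists m, {ae mu, forall x, 0 < x < L -> u x = m}.
Proof.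
move=> L_gt0 Lu [Lv hv] v0.
have iu := L2_integrable Lu.
have [q [q' [dq cq' q0 qp]]] := smooth_bump (L / 4) (3 * L / 4).
have cq : continuous q by move=> x; exact: is_derive_continuous (dq x).
have [Q [Q0 dQ]] := is_derive_primitive cq.
have Ql x : x <= L / 4 -> Q x = 0.
  move=> xL; have Q4 (y z : R) : y <= z -> z <= L / 4 -> Q z = Q y.
    move=> yz zL; apply: is_derive0_eq => // t /andP[_ tz].
    by apply: (is_derive_eqr (dQ t)); rewrite q0// negb_and -!leNgt (le_trans tz zL).
  rewrite -[RHS]Q0; have [x0|/ltW x0] := leP x 0; last by apply: Q4.
  by rewrite (Q4 x 0)// divr_ge0// ltW.
have Qr (x : R) : 3 * L / 4 <= x -> Q x = Q (3 * L / 4).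
  move=> xL; apply: is_derive0_eq => // t /andP[tz _].
  by apply: (is_derive_eqr (dQ t)); rewrite q0// negb_and -!leNgt tz orbT.
have QL : 0 < Q L.
  rewrite Qr; last by lra.
  rewrite -(Ql (L / 4))//; apply: (is_derive_pos_lt _ dQ) => //; lra.
pose m := (Q L)^-1 * \int[mu]_(x in `]0, L[) (u x * q x).
have ium : mu.-integrable `]0, L[ (EFin \o (fun x => u x + -1 * m)).
  exact: integrable_add iu (integrable_cst_itv L (-1 * m)).
exists m; suff h : {ae mu, forall x, 0 < x < L -> u x + -1 * m = 0}.
  by apply: (ae_imp h) => x h' /h'; lra.
apply: orthogonal_test_ae0 => // z tz.
have cz := test_function_continuous tz.
have [dz _ [a [b [a0 bL supp]]]] := tz.
have z0 x : ~~ (a <= x <= b) -> z x = 0.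
  by move=> h; apply/eqP; apply: contraNT h => /supp.
have [Z [Z0 dZ]] := is_derive_primitive cz.
have ZQ : (forall x, x < a -> Z x = 0) /\ (forall x, b < x -> x <= L -> Z x = Z L).
  split=> x xa.
  - have Z4 (y t : R) : y <= t -> t < a -> Z t = Z y.
      move=> yt ta; apply: is_derive0_eq => // s /andP[_ st].
      by apply: (is_derive_eqr (dZ s)); rewrite z0// negb_and -!ltNge (le_lt_trans st ta).
    rewrite -Z0; have [x0|/ltW x0] := leP x 0; last by apply: Z4.
    by symmetry; apply: Z4.
  - move=> xL; symmetry; apply: is_derive0_eq => // s /andP[xs _].
    by apply: (is_derive_eqr (dZ s)); rewrite z0// negb_and -!ltNge (lt_le_trans xa xs) orbT.
pose c := Z L / Q L.
pose eta x := Z x - c * Q x.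
have deta (x : R) : is_derive x 1 eta (z x - c * q x) by exact: is_derive_sub.
have cdeta : continuous (fun x => z x - c * q x).
  move=> x; apply: cvgB; first exact: cz.
  by apply: cvgM; [exact: cvg_cst | exact: cq].
have ZR (x : R) : b < x -> Z x = Z L.
  move=> bx; have [xL|/ltW xL] := leP x L; first exact: ZQ.2.
  apply: is_derive0_eq => // s /andP[Ls _].
  by apply: (is_derive_eqr (dZ s)); rewrite z0// negb_and -!ltNge (lt_le_trans bL Ls) orbT.
have teta : test_function L eta.
  apply: (@test_functionI _ L eta _ (Num.min a (L / 4)) (Num.max b (3 * L / 4)) deta cdeta).
  - by rewrite lt_min a0; lra.
  - by rewrite gt_max bL; lra.
  move=> x; rewrite negb_and -!ltNge lt_min gt_max => /orP[/andP[xa xL]|/andP[bx xL]].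
    by rewrite /eta ZQ.1// Ql ?ltW//; ring.
  rewrite /eta ZR// Qr; last exact: ltW.
  have -> : Q (3 * L / 4) = Q L by rewrite [RHS]Qr//; lra.
  by rewrite /c divfK ?subrr// gt_eqF.
have := hv _ teta; rewrite (is_derive_derive1 deta).
rewrite [X in _ = - X](@Rintegral_ae_eq _ L _ (fun=> 0)); last first.
- by apply: (ae_imp v0) => x h /h ->; rewrite mul0r.
- exact: measurable_cst.
- have ceta : continuous eta by move=> x; exact: is_derive_continuous (deta x).
  have := integrable_mul_continuous ceta (L2_integrable Lv).
  by move/(measurable_int _)/measurable_EFinP.
rewrite (@Rintegral_eq_oo _ L _ (fun x => u x * z x - c * (u x * q x))); last first.
  by move=> x _; ring.
have i1 := integrable_mul_continuous cz iu.
have i2 := integrable_mul_continuous cq iu.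
rewrite RintegralB//; last exact: integrable_scale.
have -> : \int[mu]_(x in `]0, L[) (0 : R) = 0.
  by rewrite [LHS]Rintegral_cst ?mul0r//; exact: measurable_itv.
rewrite RintegralZl// oppr0 => h1.
rewrite (@Rintegral_eq_oo _ L _ (fun x => u x * z x - m * z x)); last by move=> x _; ring.
rewrite RintegralB//; last exact/integrable_scale/continuous_integrable_oo.
rewrite RintegralZl//; last exact: continuous_integrable_oo.
rewrite (Rintegral_FTC L_gt0 dZ cz) Z0 subr0 -[RHS]h1 /m /c; ring.
Qed.

Lemma ae_eq_continuous_itv L f g : 0 < L -> continuous f -> continuous g ->
  {ae mu, forall x, 0 < x < L -> f x = g x} ->
  forall x, 0 <= x <= L -> f x = g x.
Proof.
move=> L0 cf cg [A [mA A0 hA]] x /andP[x0 xL].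
apply/eqP/negP => /negP fg.
have : \forall y \near x, f y - g y != 0.
  have cfg : {for x, continuous (fun y => f y - g y)} by apply: cvgB; [exact: cf|exact: cg].
  apply: (cfg [set r | r != 0]); apply: open_nbhs_nbhs; split; last by rewrite /= subr_eq0.
  exact: open_neq.
move=> /nbhs_ballP[e /= e0 he].
pose a := Num.max 0 (x - e); pose b := Num.min L (x + e).
have ab : a < b by rewrite /a /b lt_min !gt_max; lra.
have sub : `]a, b[ `<=` A.
  move=> y /=; rewrite in_itv/= /a /b gt_max lt_min => /andP[/andP[y0 ye] /andP[yL yxe]].
  apply: hA => /= h; have : f y - g y != 0.
    by apply: he; rewrite /ball/= ltr_distlC; lra.
  by rewrite h ?y0 ?yL// subrr eqxx.
have : (lebesgue_measure (`]a, b[%classic : set R) <= mu A)%E.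
  by apply: le_measure; rewrite ?inE.
by rewrite A0 lebesgue_measure_itv/= lte_fin ab -EFinB lee_fin subr_le0 leNgt ab.
Qed.

(* Du Bois-Reymond applied twice to the difference between [u] and a classical
   second primitive of [g]. *)
Lemma weak_derivative2_classical L u v w g : 0 < L -> continuous u ->
  is_weak_derivative L u v -> is_weak_derivative L v w -> continuous g ->
  {ae mu, forall x, 0 < x < L -> w x = g x} ->
  exists U U' : R -> R, [/\ forall x : R, is_derive x 1 U (U' x),
    forall x : R, is_derive x 1 U' (g x) & forall x, 0 <= x <= L -> u x = U x].
Proof.
move=> L0 cu uv vw cg wg.
have [V' [_ dV']] := is_derive_primitive cg.
have cV' : continuous V' by move=> x; exact: is_derive_continuous (dV' x).
have [V [_ dV]] := is_derive_primitive cV'.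
have cV : continuous V by move=> x; exact: is_derive_continuous (dV x).
have Lu := L2_continuous L cu; have LV := L2_continuous L cV.
have LV' := L2_continuous L cV'; have [Lv _] := uv.
have h1 := weak_derivative_lin (-1) Lv LV' vw (weak_derivative_smooth L0 dV' cg).
have [|c hc] := weak_derivative0_const L0 (L2_lin (-1) Lv LV') h1.
  by apply: (ae_imp wg) => x h /h ->; ring.
have dc (x : R) : is_derive x 1 (fun y => V y + c * y) (V' x + c * 1) by exact: is_derive_add.
have cc : continuous (fun x => V' x + c * 1) by move=> x; apply: cvgD; [exact: cV'|exact: cvg_cst].
have cVc : continuous (fun y => V y + c * y) by move=> x; exact: is_derive_continuous (dc x).
have h2 := weak_derivative_lin (-1) Lu (L2_continuous L cVc) uv (weak_derivative_smooth L0 dc cc).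
have [|m hm] := weak_derivative0_const L0 (L2_lin (-1) Lu (L2_continuous L cVc)) h2.
  by apply: (ae_imp hc) => x h /h; lra.
(* [V] is a second primitive of [g]; the first use of du Bois-Reymond finds the slope [c], the
   second the constant [m]. *)
exists (fun x => V x + c * x + m), (fun x => V' x + c * 1 + 0); split.
- by move=> x; exact: is_derive_add.
- move=> x; have h := is_derive_add (is_derive_add (dV' x) (is_derive_cst (c * 1) x 1))
    (is_derive_cst 0 x 1).
  by apply: (is_derive_eqr h); rewrite !addr0.
- apply: ae_eq_continuous_itv => //.
    by move=> x; apply: cvgD; [exact: cVc|exact: cvg_cst].
  by apply: (ae_imp hm) => x h /h; lra.
Qed.

(** By Rolle [f'] vanishes at some [c]; the pointwise [2 M |g| <= g ^ 2 + M ^ 2], integrated between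
    [c] and [x], takes the place of Cauchy-Schwarz. *)
Lemma dirichlet_derive_bound L f f' g M : 0 < L -> 0 < M ->
  (forall x : R, is_derive x 1 f (f' x)) -> (forall x : R, is_derive x 1 f' (g x)) ->
  continuous g -> f 0 = 0 -> f L = 0 ->
  \int[mu]_(x in `]0, L[) (g x ^+ 2) <= M ^+ 2 ->
  forall x, 0 <= x <= L -> `|f' x| <= M * (1 + L).
Proof.
move=> L0 M0 df df' cg f0 fL hM x /andP[x0 xL].
have cg2 : continuous (fun x => g x ^+ 2) by move=> y; apply: (@continuousM _ _ g g y); exact: cg.
have [K [K0 dK]] := is_derive_primitive cg2.
have KM : K L <= M ^+ 2 by move: hM; rewrite (Rintegral_FTC L0 dK cg2) K0 subr0.
have Kmono (a b : R) : a <= b -> K a <= K b.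
  by move=> ab; apply: (is_derive_ge0_le ab (fun y _ => dK y)) => y _; exact: sqr_ge0.
have key (s a b : R) : `|s| = 1 -> 0 <= a -> a <= b -> b <= L ->
    2 * M * s * (f' b - f' a) <= 2 * M ^+ 2 * (1 + L).
  move=> s1 a0 ab bL.
  have h := @is_derive_ge0_le _ (fun y => K y + M ^+ 2 * y - (2 * M * s) * f' y)
    (fun y => g y ^+ 2 + M ^+ 2 * 1 - 2 * M * s * g y) a b ab.
  have {}h : K a + M ^+ 2 * a - 2 * M * s * f' a <= K b + M ^+ 2 * b - 2 * M * s * f' b.
    apply: h => y _.
    have s2 : s ^+ 2 = 1 by rewrite -real_normK ?num_real// s1 expr1n.
    have := sqr_ge0 (g y - M * s); rewrite sqrrB exprMn s2; nra.
  have := Kmono _ _ a0; have := Kmono _ _ bL; rewrite K0 => KbL Ka.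
  have : M ^+ 2 * (b - a) <= M ^+ 2 * L by rewrite ler_wpM2l ?sqr_ge0//; lra.
  nra.
have [c /andP[c0 cL] fc] := is_derive_Rolle L0 (fun y _ => df y) (etrans f0 (esym fL)).
have div (y : R) : 2 * M * y <= 2 * M ^+ 2 * (1 + L) -> y <= M * (1 + L).
  by move=> h; rewrite -(ler_pM2l (_ : 0 < 2 * M)) ?mulr_gt0//; nra.
rewrite ler_norml; apply/andP; split; rewrite 1?lerNl; apply: div.
- have [xc|/ltW cx] := leP x c.
    have := key 1 x c (normr1 _) x0 xc (ltW cL); rewrite fc; lra.
  have := key (-1) c x _ (ltW c0) cx xL; rewrite normrN1 fc => /(_ erefl); lra.
- have [xc|/ltW cx] := leP x c.
    have := key (-1) x c _ x0 xc (ltW cL); rewrite normrN1 fc => /(_ erefl); lra.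
  have := key 1 c x (normr1 _) (ltW c0) cx xL; rewrite fc; lra.
Qed.

Lemma dirichlet_sup_bound L f f' M : 0 < L ->
  (forall x : R, is_derive x 1 f (f' x)) -> f 0 = 0 ->
  (forall x, 0 <= x <= L -> `|f' x| <= M) ->
  forall x, 0 <= x <= L -> `|f x| <= M * L.
Proof.
move=> L0 df f0 hM x /andP[x0 xL].
have MVT' s : `|s| = 1 -> s * f x <= M * x.
  move=> s1; have := @is_derive_ge0_le _ (fun y => M * y - s * f y)
    (fun y => M * 1 - s * f' y) 0 x x0.
  rewrite f0 !mulr0 subr0 subr_ge0; apply => y.
  move=> /andP[y0 yx]; rewrite mulr1 subr_ge0 (le_trans (ler_norm _))// normrM s1 mul1r.
  by apply: hM; rewrite y0 (le_trans yx).
have M0 : 0 <= M by rewrite (le_trans _ (hM 0 _)) ?normr_ge0 ?lexx ?ltW.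
have := MVT' 1 (normr1 _); have := MVT' (-1); rewrite normrN1 => /(_ erefl) h1 h2.
by rewrite ler_norml; nra.
Qed.

End DirichletRegularity.

(** * The squared [H^2] norm *)

Section SobolevNorm.
Context {R : realType}.
Implicit Types (L M : R) (u v w g : R -> R).
Local Notation mu := (@lebesgue_measure R).

Lemma H2_L2 L u : H2 L u ->
  [/\ L2 L u, L2 L (wderiv L u) & L2 L (wderiv L (wderiv L u))].
Proof. by move=> [? [? _] [? _]]. Qed.

Lemma H2_sqnorm_integrable L u : H2 L u -> mu.-integrable `]0, L[ (EFin \o
  (fun x => u x ^+ 2 + wderiv L u x ^+ 2 + wderiv L (wderiv L u) x ^+ 2)).
Proof.
move=> /H2_L2[h0 h1 h2]; exact: (integrable_add (integrable_add
  (L2_sqr_integrable h0) (L2_sqr_integrable h1)) (L2_sqr_integrable h2)).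
Qed.

Lemma H2_sqnorm_ge0 L u : 0 <= H2_sqnorm L u.
Proof. by apply: Rintegral_ge0 => x _; rewrite !addr_ge0 ?sqr_ge0. Qed.

Lemma H2_sqnorm_ge_wderiv2 L u g : H2 L u -> continuous g ->
  {ae mu, forall x, 0 < x < L -> wderiv L (wderiv L u) x = g x} ->
  \int[mu]_(x in `]0, L[) (g x ^+ 2) <= H2_sqnorm L u.
Proof.
move=> hu cg e; have [h0 h1 h2] := H2_L2 hu.
rewrite -(@Rintegral_ae_eq _ L (fun x => wderiv L (wderiv L u) x ^+ 2)).
- apply: le_Rintegral => //; first exact: L2_sqr_integrable.
  + exact: H2_sqnorm_integrable.
  + by move=> x _; rewrite lerDr addr_ge0 ?sqr_ge0.
- by apply: measurable_funX; exact: L2_measurable h2.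
- by apply: measurable_funX; exact: L2_measurable (L2_continuous L cg).
- by apply: (ae_imp e) => x h /h ->.
Qed.

Lemma Rintegral_le2 L (f g h : R -> R) : mu.-integrable `]0, L[ (EFin \o f) ->
  mu.-integrable `]0, L[ (EFin \o g) -> mu.-integrable `]0, L[ (EFin \o h) ->
  (forall x, f x <= 2 * g x + 2 * h x) ->
  \int[mu]_(x in `]0, L[) f x <=
  2 * (\int[mu]_(x in `]0, L[) g x) + 2 * \int[mu]_(x in `]0, L[) h x.
Proof.
move=> fi gi hi fgh.
have gi2 := integrable_scale 2 gi; have hi2 := integrable_scale 2 hi.
rewrite -!RintegralZl// -RintegralD//; apply: le_Rintegral => //.
exact: integrable_add.
Qed.

(** The norm estimate integrates [(p - q) ^ 2 <= 2 p ^ 2 + 2 q ^ 2]; up to the factor [2] it does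
    the work of the triangle inequality. *)
Lemma H2_sub L u v : H2 L u -> H2 L v ->
  [/\ H2 L (fun x => u x - v x),
      {ae mu, forall x, 0 < x < L -> wderiv L (wderiv L (fun x => u x - v x)) x =
         wderiv L (wderiv L u) x - wderiv L (wderiv L v) x} &
      H2_sqnorm L (fun x => u x - v x) <= 2 * H2_sqnorm L u + 2 * H2_sqnorm L v].
Proof.
move=> hu hv; have [Lu Lu1 Lu2] := H2_L2 hu; have [Lv Lv1 Lv2] := H2_L2 hv.
have [_ du ddu] := hu; have [_ dv ddv] := hv.
have -> : (fun x => u x - v x) = (fun x => u x + -1 * v x).
  by apply/funext => x; ring.
set w := fun x => u x + -1 * v x.
have Lw : L2 L w by exact: L2_lin.
have [hw e1 e2] := H2I Lw (weak_derivative_lin (-1) Lu Lv du dv)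
  (weak_derivative_lin (-1) Lu1 Lv1 ddu ddv).
split; [exact: hw | by apply: (ae_imp e2) => x h /h ->; rewrite mulN1r |].
have [_ Lw1 Lw2] := H2_L2 hw.
pose N x := (u x + -1 * v x) ^+ 2 + (wderiv L u x + -1 * wderiv L v x) ^+ 2 +
  (wderiv L (wderiv L u) x + -1 * wderiv L (wderiv L v) x) ^+ 2.
have iN : mu.-integrable `]0, L[ (EFin \o N).
  exact: (integrable_add (integrable_add (L2_sqr_integrable (L2_lin (-1) Lu Lv))
    (L2_sqr_integrable (L2_lin (-1) Lu1 Lv1))) (L2_sqr_integrable (L2_lin (-1) Lu2 Lv2))).
have -> : H2_sqnorm L w = \int[mu]_(x in `]0, L[) N x.
  apply: Rintegral_ae_eq.
  - by apply/measurable_EFinP; exact: measurable_int (H2_sqnorm_integrable hw).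
  - by apply/measurable_EFinP; exact: measurable_int iN.
  - by apply: (ae_imp2 e1 e2) => x h1 h2 x0; rewrite h1// h2.
apply: (Rintegral_le2 iN (H2_sqnorm_integrable hu) (H2_sqnorm_integrable hv)) => x.
have h (p q p1 q1 p2 q2 : R) :
    (p + -1 * q) ^+ 2 + (p1 + -1 * q1) ^+ 2 + (p2 + -1 * q2) ^+ 2 <=
    2 * (p ^+ 2 + p1 ^+ 2 + p2 ^+ 2) + 2 * (q ^+ 2 + q1 ^+ 2 + q2 ^+ 2).
  have := sqr_ge0 (p + q); have := sqr_ge0 (p1 + q1); have := sqr_ge0 (p2 + q2); nra.
exact: h.
Qed.

Lemma H2_classical_bound L u U U' g M : 0 < L -> 0 < M -> H2 L u ->
  {ae mu, forall x, 0 < x < L -> wderiv L (wderiv L u) x = g x} -> continuous g ->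
  (forall x : R, is_derive x 1 U (U' x)) -> (forall x : R, is_derive x 1 U' (g x)) ->
  U 0 = 0 -> U L = 0 -> H2_sqnorm L u <= M ^+ 2 ->
  forall x, 0 <= x <= L -> `|U' x| <= M * (1 + L) /\ `|U x| <= M * (1 + L) * L.
Proof.
move=> L0 M0 hu e cg dU dU' U0 UL hM.
have b := dirichlet_derive_bound L0 M0 dU dU' cg U0 UL
  (le_trans (H2_sqnorm_ge_wderiv2 hu cg e) hM).
by move=> x x0; split; [exact: b | exact: (dirichlet_sup_bound L0 dU U0 b)].
Qed.

End SobolevNorm.

(** * Complex functions of a real variable and the energy estimate *)

Section ComplexDerivative.
Context {R : realType}.
Local Open Scope complex_scope.
Implicit Types (x : R) (f g : R -> R[i]) (a b c d : R[i]).
Local Notation normc := ComplexField.Normc.normc.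

Lemma ReD (c d : R[i]) : complex.Re (c + d) = complex.Re c + complex.Re d.
Proof. by case: c; case: d. Qed.

Lemma ImD (c d : R[i]) : complex.Im (c + d) = complex.Im c + complex.Im d.
Proof. by case: c; case: d. Qed.

Lemma ReM (c d : R[i]) :
  complex.Re (c * d) = complex.Re c * complex.Re d - complex.Im c * complex.Im d.
Proof. by case: c; case: d. Qed.

Lemma ImM (c d : R[i]) :
  complex.Im (c * d) = complex.Re c * complex.Im d + complex.Im c * complex.Re d.
Proof. by case: c; case: d. Qed.

Definition is_derivec x f d : Prop :=
  is_derive x 1 (re_part f) (complex.Re d) /\ is_derive x 1 (im_part f) (complex.Im d).

Lemma is_derivec_eq x f c d : is_derivec x f c -> c = d -> is_derivec x f d.
Proof. by move=> ? <-. Qed.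

Lemma is_derivec_cst x c : is_derivec x (fun=> c) 0.
Proof. by split; exact: is_derive_cst. Qed.

Lemma is_derivec_add x f g c d : is_derivec x f c -> is_derivec x g d ->
  is_derivec x (fun y => f y + g y) (c + d).
Proof.
move=> [f1 f2] [g1 g2]; split.
- rewrite ReD (_ : re_part _ = fun y => re_part f y + re_part g y); first exact: is_derive_add.
  by apply/funext => y; exact: ReD.
- rewrite ImD (_ : im_part _ = fun y => im_part f y + im_part g y); first exact: is_derive_add.
  by apply/funext => y; exact: ImD.
Qed.

Lemma is_derivec_mul x f g c d : is_derivec x f c -> is_derivec x g d ->
  is_derivec x (fun y => f y * g y) (c * g x + f x * d).
Proof.
move=> [f1 f2] [g1 g2]; split.
- rewrite (_ : re_part _ = fun y => re_part f y * re_part g y - im_part f y * im_part g y).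
    apply: (is_derive_eqr (is_derive_sub (is_derive_mul f1 g1) (is_derive_mul f2 g2))).
    by rewrite /re_part /im_part !ReD !ReM; ring.
  by apply/funext => y; exact: ReM.
- rewrite (_ : im_part _ = fun y => re_part f y * im_part g y + im_part f y * re_part g y).
    apply: (is_derive_eqr (is_derive_add (is_derive_mul f1 g2) (is_derive_mul f2 g1))).
    by rewrite /re_part /im_part !ImD !ImM; ring.
  by apply/funext => y; exact: ImM.
Qed.

Lemma is_derivec_scale x c f d : is_derivec x f d ->
  is_derivec x (fun y => c * f y) (c * d).
Proof.
move=> hf; apply: (is_derivec_eq (is_derivec_mul (is_derivec_cst x c) hf)).
by rewrite mul0r add0r.
Qed.

Lemma is_derivec_sub x f g c d : is_derivec x f c -> is_derivec x g d ->
  is_derivec x (fun y => f y - g y) (c - d).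
Proof.
move=> hf /(is_derivec_scale (-1)) hg; have := is_derivec_add hf hg.
rewrite mulN1r; congr (is_derivec _ _ _); apply/funext => y; by rewrite mulN1r.
Qed.

Lemma is_derivec_shift x (t : R) f d : is_derivec (x + t) f d ->
  is_derivec x (fun y => f (y + t)) d.
Proof. by move=> [f1 f2]; split; exact: is_derive_shift. Qed.

Lemma is_derivec_real x (f : R -> R) (d : R) : is_derive x 1 f d ->
  is_derivec x (fun y => (f y)%:C) d%:C.
Proof. by move=> hf; split => //; exact: is_derive_cst. Qed.

Lemma is_derivec0_eq f (a b : R) : a <= b ->
  (forall x, a <= x <= b -> is_derivec x f 0) -> f b = f a.
Proof.
move=> ab df; apply/eqP; rewrite eq_complex; apply/andP; split; apply/eqP.
- by apply: (@is_derive0_eq _ (re_part f)) => // x /df[].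
- by apply: (@is_derive0_eq _ (im_part f)) => // x /df[].
Qed.

Lemma sqr_normc_ReIm (z : R[i]) : normc z ^+ 2 = complex.Re z ^+ 2 + complex.Im z ^+ 2.
Proof. by case: z => x y; rewrite sqr_sqrtr// addr_ge0 ?sqr_ge0. Qed.

Lemma normc_nonneg (z : R[i]) : 0 <= normc z.
Proof. by case: z => x y; exact: sqrtr_ge0. Qed.

Lemma normc_le_ReIm (z : R[i]) (A : R) :
  `|complex.Re z| <= A -> `|complex.Im z| <= A -> normc z <= 2 * A.
Proof.
move=> h1 h2; have A0 : 0 <= A by rewrite (le_trans _ h1).
rewrite -(ler_pXn2r (n := 2)) ?nnegrE ?normc_nonneg ?mulr_ge0// sqr_normc_ReIm.
move: h1 h2; rewrite !ler_norml; nra.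
Qed.

(** Cauchy-Schwarz in the plane: by Lagrange's identity the difference of the squares is the square
    of the determinant of [p] and [q]. *)
Lemma dotc_le (p q : R[i]) :
  complex.Re p * complex.Re q + complex.Im p * complex.Im q <= normc p * normc q.
Proof.
set l := (X in X <= _); have [l0|l0] := leP l 0.
  by rewrite (le_trans l0)// mulr_ge0 ?normc_nonneg.
rewrite -(ler_pXn2r (n := 2)) ?nnegrE ?mulr_ge0 ?normc_nonneg ?(ltW l0)//.
rewrite exprMn !sqr_normc_ReIm /l.
rewrite -subr_ge0; set r := (X in 0 <= X).
suff -> : r = (complex.Re p * complex.Im q - complex.Im p * complex.Re q) ^+ 2.
  exact: sqr_ge0.
by rewrite /r; ring.
Qed.

(* Energy method: [|z|^2 + |z'|^2] grows at most exponentially. *)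
Lemma linear_ode_bound (T K eta : R) (z z' V h : R -> R[i]) : 0 <= T -> 0 <= K -> 0 <= eta ->
  (forall x, 0 <= x <= T -> is_derivec x z (z' x)) ->
  (forall x, 0 <= x <= T -> is_derivec x z' (V x * z x + h x)) ->
  (forall x, 0 <= x <= T -> normc (V x) <= K) ->
  (forall x, 0 <= x <= T -> normc (h x) <= eta) ->
  forall x, 0 <= x <= T -> normc (z x) ^+ 2 + normc (z' x) ^+ 2 <=
    expR ((2 + K) * T) * (normc (z 0) ^+ 2 + normc (z' 0) ^+ 2 + T * eta ^+ 2).
Proof.
move=> T0 K0 eta0 dz dz' hV hh x /andP[x0 xT].
pose E y := (re_part z y * re_part z y + im_part z y * im_part z y) +
  (re_part z' y * re_part z' y + im_part z' y * im_part z' y).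
have EE y : E y = normc (z y) ^+ 2 + normc (z' y) ^+ 2.
  by rewrite !sqr_normc_ReIm /E !expr2.
(* [E'] is twice the sum of three inner products, of [z'] with [z], with [V z] and with [h]; they
   contribute at most [E], [K E] and [|z'| ^ 2 + eta ^ 2]. *)
pose k := 2 + K; have k0 : 0 < k by rewrite /k; lra.
pose w y := expR (- (k * y)).
have dw (y : R) : is_derive y 1 w (w y * - (k * 1)).
  by apply: (is_derive_compr (is_derive_expR _)); exact: is_deriveN.
have w0 : w 0 = 1 by rewrite /w mulr0 oppr0 expR0.
have wpos y : 0 < w y by exact: expR_gt0.
have wle1 y : 0 <= y -> w y <= 1.
  by move=> y0; rewrite /w expR_le1 oppr_le0 mulr_ge0// ltW.
(* Gronwall with the integrating factor [w = exp (- k x)]: since [E' <= k E + eta ^ 2] and [w <= 1],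
   the function [eta ^ 2 x - w E] is nondecreasing. *)
suff : eta ^+ 2 * 0 - w 0 * E 0 <= eta ^+ 2 * x - w x * E x.
  rewrite mulr0 w0 mul1r add0r => hE.
  rewrite -!EE -(ler_pM2l (wpos x)).
  have h1 : w x * E x <= E 0 + T * eta ^+ 2.
    have : eta ^+ 2 * x <= eta ^+ 2 * T by rewrite ler_wpM2l ?sqr_ge0.
    lra.
  apply: (le_trans h1); set S := E 0 + T * eta ^+ 2.
  rewrite mulrA -{1}[S]mul1r ler_wpM2r//.
    by rewrite /S addr_ge0 ?mulr_ge0 ?sqr_ge0// EE addr_ge0 ?sqr_ge0.
  have kxT : k * x <= k * T by rewrite ler_wpM2l// ltW.
  by rewrite /w -expRD -[X in X <= _]expR0 ler_expR -/k; lra.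
have dE y : 0 <= y <= T -> exists2 e, is_derive y 1 E e & e <= k * E y + eta ^+ 2.
  move=> yT; have [z1 z2] := dz y yT; have [z3 z4] := dz' y yT.
  eexists.
    exact: (is_derive_add
      (is_derive_add (is_derive_mul z1 z1) (is_derive_mul z2 z2))
      (is_derive_add (is_derive_mul z3 z3) (is_derive_mul z4 z4))).
  have h1 := dotc_le (z y) (z' y); have h2 := dotc_le (z' y) (V y * z y).
  have h3 := dotc_le (z' y) (h y); have b1 := hV y yT; have b2 := hh y yT.
  rewrite ComplexField.Normc.normcM in h2; rewrite EE /re_part /im_part.
  have n1 := normc_nonneg (z y); have n2 := normc_nonneg (z' y).
  have n3 := normc_nonneg (V y); have n4 := normc_nonneg (h y).
  rewrite ReD ImD.
  move: h1 h2 h3 b1 b2 n1 n2 n3 n4.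
  set A := normc (z y); set B := normc (z' y); set C := normc (V y); set D := normc (h y).
  set r1 := complex.Re (V y * z y); set r2 := complex.Im (V y * z y).
  move=> h1 h2 h3 b1 b2 n1 n2 n3 n4.
  have c1 : B * (C * A) <= K * (A * B).
    by rewrite (_ : B * (C * A) = C * (A * B)) ?ler_wpM2r ?mulr_ge0//; ring.
  have c2 : K * (A * B) *+ 2 <= K * (A ^+ 2 + B ^+ 2).
    by rewrite -mulrnAr ler_wpM2l// -subr_ge0; have := sqr_ge0 (A - B); rewrite sqrrB; lra.
  have c3 : B * D <= B * eta by rewrite ler_wpM2l.
  have c4 := sqr_ge0 (A - B); have c5 := sqr_ge0 (B - eta).
  rewrite sqrrB in c4; rewrite sqrrB in c5; have := sqr_ge0 A; rewrite /k; lra.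
(* The derivatives of [E] are gathered into one function, with the default value [0] outside
   [[0, T]]. *)
have [e he] : exists e : R -> R, forall y, 0 <= y <= T ->
    is_derive y 1 E (e y) /\ e y <= k * E y + eta ^+ 2.
  have /choice[e he] : forall y, exists e, 0 <= y <= T ->
      is_derive y 1 E e /\ e <= k * E y + eta ^+ 2.
    move=> y; have [/dE[e e1 e2]|nyT] := boolP (0 <= y <= T); first by exists e.
    by exists 0.
  by exists e.
have xe y : 0 <= y <= x -> 0 <= y <= T by move=> /andP[-> /le_trans]; exact.
refine (@is_derive_ge0_le _ (fun y => eta ^+ 2 * y - w y * E y)
  (fun y => eta ^+ 2 * 1 - (w y * - (k * 1) * E y + w y * e y)) 0 x x0 _ _).
  move=> y /xe/he[dEy _]; exact (is_derive_sub
    (is_derive_scale (eta ^+ 2) (is_derive_id y 1)) (is_derive_mul (dw y) dEy)).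
move=> y yx; have [y0 _] := andP yx; have [_ ey] := he y (xe y yx).
have : w y * e y <= w y * (k * E y + eta ^+ 2) by rewrite (ler_wpM2l (ltW (wpos y))).
have : w y * eta ^+ 2 <= 1 * eta ^+ 2 by rewrite ler_wpM2r ?sqr_ge0// wle1.
lra.
Qed.

End ComplexDerivative.

(** * The complex cubic oscillator and the stability of a zero at [L / d] *)

Section Duffing.
Context {R : realType}.
Local Open Scope complex_scope.
Implicit Types (x L T B eta : R) (a c e : R[i]) (r s : R -> R[i]).
Local Notation normc := ComplexField.Normc.normc.
Local Notation normcM := ComplexField.Normc.normcM.

Lemma normcD (p q : R[i]) : normc (p + q) <= normc p + normc q.
Proof. exact: le_normcD. Qed.

Lemma normcB (p q : R[i]) : normc (p - q) <= normc p + normc q.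
Proof. by rewrite (le_trans (normcD _ _))// normcN. Qed.

Lemma normcX (p : R[i]) n : normc (p ^+ n) = normc p ^+ n.
Proof.
elim: n => [|n IH]; first by rewrite !expr0 ComplexField.Normc.normc1.
by rewrite !exprS normcM IH.
Qed.

Lemma normc_sum (n : nat) (F : 'I_n -> R[i]) :
  normc (\sum_(i < n) F i) <= \sum_(i < n) normc (F i).
Proof.
elim: n F => [|n IH] F; first by rewrite !big_ord0 ComplexField.Normc.normc0.
by rewrite !big_ord_recr/= (le_trans (normcD _ _))// lerD2r.
Qed.

Lemma normc_eq0 (p : R[i]) : normc p = 0 -> p = 0.
Proof. exact: ComplexField.Normc.eq0_normc. Qed.

Lemma normc_le_of_sqr (p q : R[i]) A : 0 <= A ->
  normc p ^+ 2 + normc q ^+ 2 <= A ^+ 2 -> normc p <= A /\ normc q <= A.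
Proof.
move=> A0 h; split; rewrite -(ler_pXn2r (n := 2)) ?nnegrE ?normc_nonneg//.
- by have := sqr_ge0 (normc q); lra.
- by have := sqr_ge0 (normc p); lra.
Qed.

Lemma ler_normcM (p q : R[i]) A B : normc p <= A -> normc q <= B ->
  normc (p * q) <= A * B.
Proof. by move=> hp hq; rewrite normcM ler_pM ?normc_nonneg. Qed.

Definition duffing L a c r r' : Prop := forall x, 0 <= x <= L ->
  is_derivec x r (r' x) /\ is_derivec x r' (a * r x + c * r x ^+ 3).

(** The first integral is polynomial, without moduli, so it holds for complex parameters and later
    gives [r' ^ 2 = 1] exactly at a zero of [r]. *)
Lemma duffing_energy L a c r r' : duffing L a c r r' -> r 0 = 0 -> r' 0 = 1 ->
  forall x, 0 <= x <= L -> r' x ^+ 2 = 1 + a * r x ^+ 2 + c / 2 * r x ^+ 4.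
Proof.
move=> dr r0 r'0 x /andP[x0 xL].
pose F y := r' y * r' y - (a * (r y * r y) + c / 2 * ((r y * r y) * (r y * r y))).
have : F x = F 0.
  apply: is_derivec0_eq => // y /andP[y0 yx].
  have [|d1 d2] := dr y; first by rewrite y0 (le_trans yx).
  have d11 := is_derivec_mul d1 d1.
  apply: (is_derivec_eq (is_derivec_sub (is_derivec_mul d2 d2) (is_derivec_add
    (is_derivec_scale a d11) (is_derivec_scale (c / 2) (is_derivec_mul d11 d11))))).
  by field.
rewrite /F r0 r'0 => h.
by rewrite -[LHS](subrK (a * (r x * r x) + c / 2 * ((r x * r x) * (r x * r x)))) expr2 h; ring.
Qed.

(** Factoring [s ^ 3 - r ^ 3] makes [s - r] a solution of a linear equation with potential
    [a1 + c1 (s ^ 2 + s r + r ^ 2)] and forcing [(a1 - a) r + (c1 - c) r ^ 3]. For [eta = 0] this is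
    uniqueness of the initial value problem. *)
Lemma duffing_stability T B eta a c r r' a1 c1 s s' :
  0 <= T -> 0 <= B -> 0 <= eta -> normc a1 <= B -> normc c1 <= B ->
  normc (a1 - a) <= eta -> normc (c1 - c) <= eta ->
  (forall x, 0 <= x <= T -> normc (r x) <= B) ->
  (forall x, 0 <= x <= T -> normc (s x) <= B) ->
  duffing T a c r r' -> duffing T a1 c1 s s' -> s 0 = r 0 -> s' 0 = r' 0 ->
  forall x, 0 <= x <= T -> normc (s x - r x) ^+ 2 + normc (s' x - r' x) ^+ 2 <=
    expR ((2 + (B + 3 * B ^+ 3)) * T) * (T * (eta * (B + B ^+ 3)) ^+ 2).
Proof.
move=> T0 B0 eta0 ha hc haa hcc hr hs dr ds e0 e'0 x x0.
have K0 : 0 <= B + 3 * B ^+ 3 by rewrite addr_ge0 ?mulr_ge0 ?exprn_ge0.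
have H0 : 0 <= eta * (B + B ^+ 3) by rewrite mulr_ge0 ?addr_ge0 ?exprn_ge0.
have := @linear_ode_bound _ T (B + 3 * B ^+ 3) (eta * (B + B ^+ 3))
  (fun y => s y - r y) (fun y => s' y - r' y)
  (fun y => a1 + c1 * (s y ^+ 2 + s y * r y + r y ^+ 2))
  (fun y => (a1 - a) * r y + (c1 - c) * r y ^+ 3) T0 K0 H0.
rewrite e0 e'0 !subrr ComplexField.Normc.normc0 expr0n/= !add0r; apply => // y yT.
- by have [d1 _] := dr y yT; have [d2 _] := ds y yT; exact: is_derivec_sub.
- have [_ d1] := dr y yT; have [_ d2] := ds y yT.
  by apply: (is_derivec_eq (is_derivec_sub d2 d1)); ring.
- rewrite (le_trans (normcD _ _))// lerD//.
  have -> : 3 * B ^+ 3 = B * (B * B + B * B + B * B) by ring.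
  apply: ler_normcM => //; rewrite (le_trans (normcD _ _))// lerD//.
    rewrite (le_trans (normcD _ _))// lerD// ?expr2; apply: ler_normcM; by [exact: hs|exact: hr].
  by rewrite expr2; apply: ler_normcM; exact: hr.
- rewrite (le_trans (normcD _ _))// mulrDr lerD//; apply: ler_normcM => //.
    exact: hr.
  by rewrite normcX lerXn2r ?nnegrE ?normc_nonneg// hr.
Qed.

Lemma duffing_scale_sign L a c r r' e : e ^+ 2 = 1 -> duffing L a c r r' ->
  duffing L a c (fun x => e * r x) (fun x => e * r' x).
Proof.
move=> e2 dr x xL; have [d1 d2] := dr x xL; split; first exact: is_derivec_scale.
apply: (is_derivec_eq (is_derivec_scale e d2)).
have e3 : e ^+ 3 = e by rewrite exprS e2 mulr1.
by rewrite exprMn e3; ring.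
Qed.

Lemma duffing_shift L T a c r r' : 0 <= T -> duffing L a c r r' ->
  duffing (L - T) a c (fun x => r (x + T)) (fun x => r' (x + T)).
Proof.
move=> T0 dr x /andP[x0 xL].
have [|d1 d2] := dr (x + T); first by lra.
by split; exact: is_derivec_shift.
Qed.

Lemma normc_sign e : e ^+ 2 = 1 -> normc e = 1.
Proof.
move=> e2; have := normcX e 2; rewrite e2 ComplexField.Normc.normc1 => /esym/eqP.
by rewrite sqrp_eq1 ?normc_nonneg// => /eqP.
Qed.

(** The energy at [T] gives [r'(T) ^ 2 = 1]. As the equation is odd, [r'(T) r] is again a solution,
    with the same data at [0] as the translate of [r] by [T]; uniqueness identifies them. *)
Lemma duffing_antiperiodic L B T a c r r' : 0 <= B -> 0 <= T <= L ->
  normc a <= B -> normc c <= B -> (forall x, 0 <= x <= L -> normc (r x) <= B) ->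
  duffing L a c r r' -> r 0 = 0 -> r' 0 = 1 -> r T = 0 ->
  r' T ^+ 2 = 1 /\ forall x, 0 <= x <= L - T ->
    r (x + T) = r' T * r x /\ r' (x + T) = r' T * r' x.
Proof.
move=> B0 TL ha hc hr dr r0 r'0 rT.
have e2 : r' T ^+ 2 = 1.
  by rewrite (duffing_energy dr r0 r'0 TL) rT !expr0n/= !mulr0 !addr0.
split => // x x0; have [T0 TL'] := andP TL.
have drL : duffing (L - T) a c r r' by move=> y yL; apply: dr; lra.
have := @duffing_stability (L - T) B 0 a c _ _ a c _ _ _ B0 (lexx _) ha hc _ _ _ _
  (duffing_scale_sign e2 drL) (duffing_shift T0 dr).
rewrite !subrr ComplexField.Normc.normc0 !add0r r0 r'0 mulr0 mulr1 mul0r expr0n/= mulr0 mulr0.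
move=> h; have {h} := h _ _ _ _ _ rT erefl x x0.
move=> h.
have {}h : normc (r (x + T) - r' T * r x) ^+ 2 + normc (r' (x + T) - r' T * r' x) ^+ 2 <= 0 ^+ 2.
  rewrite expr0n; apply: h; rewrite ?subr_ge0// => y y0; last by apply: hr; lra.
  by rewrite normcM (normc_sign e2) mul1r; apply: hr; lra.
have [h1 h2] := normc_le_of_sqr (lexx 0) h.
by split; apply/eqP; rewrite -subr_eq0; apply/eqP/normc_eq0/eqP; rewrite eq_le normc_nonneg andbT.
Qed.

(** A single [B] bounds the parameters, the solution and its derivative, so that constants depending
    on [B], [L] and [d] serve all profiles at once. *)
Definition duffing_profile L B a c r r' : Prop :=
  [/\ normc a <= B, normc c <= B,
      forall x, 0 <= x <= L -> normc (r x) <= B /\ normc (r' x) <= B,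
      duffing L a c r r' & r 0 = 0 /\ r' 0 = 1].

Lemma duffing_profile_periodic L B a c r r' (d : nat) : 0 < L -> (0 < d)%N -> 0 <= B ->
  duffing_profile L B a c r r' -> r (L / d%:R) = 0 ->
  forall j : nat, (j <= d)%N -> r' (L / d%:R *+ j) = r' (L / d%:R) ^+ j.
Proof.
move=> L0 d0 B0 [ha hc hb dr [r0 r'0]] rT; set T := L / d%:R.
have dT : T *+ d = L by rewrite /T -mulr_natr divfK// pnatr_eq0 -lt0n.
have T0 : 0 <= T by rewrite /T divr_ge0// ltW.
have Tle j : (j <= d)%N -> 0 <= T *+ j <= L.
  by move=> jd; rewrite mulrn_wge0//= -dT ler_wpMn2l.
have TL : 0 <= T <= L by have := Tle 1 d0; rewrite mulr1n.
have [e2 per] := duffing_antiperiodic B0 TL ha hc (fun x xL => (hb x xL).1) dr r0 r'0 rT.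
elim=> [|j IH] jd; first by rewrite mulr0n expr0.
have := Tle _ jd; rewrite mulrS addrC => /andP[_ h].
have [|_ ->] := per (T *+ j); last by rewrite IH ?exprS// ltnW.
by have /andP[-> _] := Tle j (ltnW jd); lra.
Qed.

(** The first potential is the divided difference of [a1 y + c1 y ^ 3] between [u] and [v], the
    second the derivative of [a y + c y ^ 3] at [s]; they differ by a multiple of [eta] once [u],
    [v] and the parameters are that close. *)
Lemma duffing_second_variation (u v s W a c a1 c1 : R[i]) C eta B :
  0 <= eta -> 0 <= B -> 0 <= C ->
  normc (a1 - a) <= eta -> normc (c1 - c) <= eta -> normc c1 <= B ->
  normc u <= B -> normc v <= B -> normc s <= B ->
  normc (u - s) <= C * eta -> normc (v - s) <= C * eta ->
  normc (a1 + c1 * (u ^+ 2 + u * v + v ^+ 2) - (a + 3 * c * s ^+ 2)) <=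
  (1 + 3 * B ^+ 2 + 6 * B ^+ 2 * C) * eta.
Proof.
move=> eta0 B0 C0 haa hcc hc hu hv hs hus hvs.
have -> : a1 + c1 * (u ^+ 2 + u * v + v ^+ 2) - (a + 3 * c * s ^+ 2) =
    (a1 - a) + (c1 - c) * (s * s + s * s + s * s) +
    c1 * ((u - s) * (u + s) + ((u - s) * v + s * (v - s)) + (v - s) * (v + s)) by ring.
have D3 (p q t : R[i]) A1 A2 A3 : normc p <= A1 -> normc q <= A2 -> normc t <= A3 ->
    normc (p + q + t) <= A1 + A2 + A3.
  move=> h1 h2 h3; rewrite (le_trans (normcD _ _))// lerD//.
  by rewrite (le_trans (normcD _ _))// lerD.
have D2 (p q : R[i]) A1 A2 : normc p <= A1 -> normc q <= A2 -> normc (p + q) <= A1 + A2.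
  by move=> h1 h2; rewrite (le_trans (normcD _ _))// lerD.
have -> : (1 + 3 * B ^+ 2 + 6 * B ^+ 2 * C) * eta = eta + eta * (B * B + B * B + B * B) +
  B * ((C * eta) * (B + B) + ((C * eta) * B + B * (C * eta)) + (C * eta) * (B + B)) by ring.
apply: (D3) => //.
  by apply: ler_normcM => //; apply: (D3); exact: ler_normcM.
apply: ler_normcM => //; apply: (D3).
- by apply: ler_normcM => //; exact: (D2).
- by apply: (D2); exact: ler_normcM.
- by apply: ler_normcM => //; exact: (D2).
Qed.

(** The threshold [delta] depends only on [L], [B] and [d], not on the profiles. This uniformity
    allows comparing profiles of solutions of arbitrarily small size. *)
Lemma duffing_zero_stable L B (d : nat) : 0 < L -> (0 < d)%N -> 1 <= B ->
  exists2 delta, 0 < delta &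
  forall a c r r' a1 c1 s s', duffing_profile L B a c r r' ->
    duffing_profile L B a1 c1 s s' -> s L = 0 ->
    normc (a1 - a) <= delta -> normc (c1 - c) <= delta ->
    r (L / d%:R) = 0 -> s (L / d%:R) = 0.
Proof.
move=> L0 d0 B1.
pose K := B + 3 * B ^+ 3.
have B0 : 0 <= B by lra.
have K0 : 0 <= K by rewrite /K addr_ge0 ?mulr_ge0 ?exprn_ge0.
pose S := expR ((2 + K) * L) * (L * (B + B ^+ 3) ^+ 2).
have S0 : 0 <= S by rewrite /S mulr_ge0 ?expR_ge0// mulr_ge0 ?(ltW L0) ?sqr_ge0.
(* [duffing_stability] bounds the squared distance by [S eta ^ 2], and [S <= C1 ^ 2] turns this into
   the distance bound [C1 eta]. *)
pose C1 := 1 + S.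
have C10 : 0 <= C1 by rewrite /C1; lra.
pose H1 := (1 + 3 * B ^+ 2 + 6 * B ^+ 2 * C1) * B.
have H10 : 0 <= H1 by rewrite /H1 mulr_ge0// !addr_ge0// !mulr_ge0// ?sqr_ge0.
pose C3 := expR ((2 + K) * L) * ((C1 * (B + B ^+ 3)) ^+ 2 + L * H1 ^+ 2).
have C30 : 0 <= C3 by rewrite /C3 mulr_ge0 ?expR_ge0// addr_ge0 ?sqr_ge0// mulr_ge0 ?(ltW L0) ?sqr_ge0.
(* Small enough for [C1 eta <= 1], which keeps [s'(T) + e] away from [0], and for [C3 eta ^ 2 < 1],
   which makes the error [y] below less than [1]. *)
pose eta := (1 + C1 + C3)^-1.
have den : 0 < 1 + C1 + C3 by lra.
have eta0 : 0 < eta by rewrite invr_gt0.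
have etaE : eta + C1 * eta + C3 * eta = 1.
  by rewrite -[X in X + _ + _]mul1r -!mulrDl mulfV// gt_eqF.
have eta1 : eta <= 1 by have := mulr_ge0 C10 (ltW eta0); have := mulr_ge0 C30 (ltW eta0); lra.
have C1eta : C1 * eta <= 1 by have := mulr_ge0 C30 (ltW eta0); lra.
have C3eta : C3 * eta ^+ 2 < 1.
  rewrite expr2 mulrA.
  have : C3 * eta * eta <= C3 * eta * 1 by rewrite ler_wpM2l// mulr_ge0// ltW.
  by have := mulr_ge0 C10 (ltW eta0); lra.
exists eta => // a c r r' a1 c1 s s' pr ps sL haa hcc rT.
have [ha hc hb dr [r0 r'0]] := pr; have [ha1 hc1 hb1 ds [s0 s'0]] := ps.
set T := L / d%:R in rT *.
have per := duffing_profile_periodic L0 d0 B0 pr rT; rewrite -/T in per.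
have dT : T *+ d = L by rewrite /T -mulr_natr divfK// pnatr_eq0 -lt0n.
have T0 : 0 <= T by rewrite /T divr_ge0// ltW.
have Tle j : (j <= d)%N -> 0 <= T *+ j <= L.
  by move=> jd; rewrite mulrn_wge0//= -dT ler_wpMn2l.
have TL : 0 <= T <= L by have := Tle 1 d0; rewrite mulr1n.
have [e2 anti] := duffing_antiperiodic B0 TL ha hc (fun x xL => (hb x xL).1) dr r0 r'0 rT.
pose e := r' T; rewrite -/e in e2 anti per.
have close x : 0 <= x <= L -> normc (s x - r x) <= C1 * eta /\ normc (s' x - r' x) <= C1 * eta.
  move=> xL; apply: normc_le_of_sqr; first by rewrite mulr_ge0// ltW.
  have := duffing_stability (ltW L0) B0 (ltW eta0) ha1 hc1 haa hcc
    (fun x xL => (hb x xL).1) (fun x xL => (hb1 x xL).1) dr ds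
    (etrans s0 (esym r0)) (etrans s'0 (esym r'0)) xL.
  move=> h; apply: (le_trans h).
  have -> : expR ((2 + (B + 3 * B ^+ 3)) * L) * (L * (eta * (B + B ^+ 3)) ^+ 2) = S * eta ^+ 2.
    by rewrite /S /K; ring.
  rewrite exprMn ler_wpM2r ?sqr_ge0// /C1; have := sqr_ge0 S; nra.
set q := s T; apply/eqP/negP => /negP q0.
have qle : normc q <= C1 * eta by have [h _] := close T TL; rewrite rT subr0 in h.
have e1 := normc_sign e2.
(* The initial slope of [w / q]. The energy identity at [T] reads [s'(T) ^ 2 - e ^ 2 = q ^ 2 (a1 +
   c1 q ^ 2 / 2)]; dividing by [q] and by [s'(T) + e], which is close to [2 e], shows that [k] is of
   order [q], hence of order [eta]. *)
pose k := (s' T - e) / q.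
have kE : k * (s' T + e) = q * (a1 + c1 / 2 * q ^+ 2).
  apply: (mulIf q0); rewrite /k mulrAC divfK//.
  have := duffing_energy ds s0 s'0 TL; rewrite -/q => en.
  have -> : (s' T - e) * (s' T + e) = s' T ^+ 2 - e ^+ 2 by ring.
  by rewrite en e2; ring.
have half : normc (2^-1 : R[i]) <= 1.
  rewrite ComplexField.Normc.normcV invf_le1.
    by rewrite -(ler_pXn2r (n := 2)) ?nnegrE ?normc_nonneg// sqr_normc_ReIm/=; lra.
  rewrite lt_neqAle normc_nonneg andbT eq_sym; apply/eqP => /normc_eq0/eqP.
  by rewrite pnatr_eq0.
have qB : normc q <= B by have [] := hb1 T TL.
have kle : normc k <= C1 * (B + B ^+ 3) * eta.
  have ge1 : 1 <= normc (s' T + e).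
    have [_ h] := close T TL.
    have : normc (2 * e) <= normc (s' T + e) + normc (s' T - e).
      have -> : 2 * e = (s' T + e) - (s' T - e) by ring.
      exact: normcB.
    rewrite normcM e1 mulr1 -/e in h *.
    have -> : normc (2 : R[i]) = 2.
      by apply/eqP; rewrite -(eqrXn2 (n := 2)) ?normc_nonneg// sqr_normc_ReIm/=; apply/eqP; ring.
    lra.
  apply: (@le_trans _ _ (normc (k * (s' T + e)))).
    by rewrite (normcM k) ler_peMr ?normc_nonneg.
  have -> : C1 * (B + B ^+ 3) * eta = C1 * eta * (B + B * 1 * B ^+ 2) by ring.
  rewrite kE; apply: ler_normcM => //; rewrite (le_trans (normcD _ _))// lerD//.
  by apply: ler_normcM; [exact: ler_normcM | rewrite normcX lerXn2r ?nnegrE ?normc_nonneg].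
pose w x := s (x + T) - e * s x.
(* [w / q] starts from [1] with slope [k], and [r'] from [1] with slope [0]. The former solves the
   linear equation with potential [W], the latter the linearized equation along [r], with potential
   [a + 3 c r ^ 2]; so [y] is driven only by [k] and by the difference of the potentials. *)
pose y x := q^-1 * w x - r' x.
pose y' x := q^-1 * (s' (x + T) - e * s' x) - (a * r x + c * r x ^+ 3).
pose W x := a1 + c1 * (s (x + T) ^+ 2 + s (x + T) * (e * s x) + (e * s x) ^+ 2).
have sub x : 0 <= x <= L - T -> 0 <= x <= L /\ 0 <= x + T <= L.
  by case/andP: TL => T0' TL' /andP[x0 xLT]; split; lra.
have LT0 : 0 <= L - T by case/andP: TL => _; rewrite subr_ge0.
have ybound x : 0 <= x <= L - T -> normc (y x) < 1.
  move=> xLT.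
  have := @linear_ode_bound _ (L - T) K (H1 * eta) y y' W
    (fun x => (W x - (a + 3 * c * r x ^+ 2)) * r' x) LT0 K0 (mulr_ge0 H10 (ltW eta0)).
  have dy z : 0 <= z <= L - T -> is_derivec z y (y' z).
    move=> /sub[z1 z2]; have [_ d1] := dr z z1; have [d2 _] := ds z z1.
    have [/is_derivec_shift d3 _] := ds _ z2.
    exact: (is_derivec_sub (is_derivec_scale q^-1 (is_derivec_sub d3 (is_derivec_scale e d2))) d1).
  have dy' z : 0 <= z <= L - T -> is_derivec z y' (W z * y z + (W z - (a + 3 * c * r z ^+ 2)) * r' z).
    move=> /sub[z1 z2]; have [d1 _] := dr z z1; have [_ d2] := ds z z1.
    have [_ /is_derivec_shift d3] := ds _ z2.
    have d11 := is_derivec_mul d1 (is_derivec_mul d1 d1).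
    have := is_derivec_sub (is_derivec_scale q^-1 (is_derivec_sub d3 (is_derivec_scale e d2)))
      (is_derivec_add (is_derivec_scale a d1) (is_derivec_scale c d11)).
    move=> h; apply: (is_derivec_eq h); rewrite /y /W /w.
    (* Since [e ^ 2 = 1], [e s] solves the same equation as [s], and [w] is a difference of two
       solutions. *)
    have e3 : (e * s z) ^+ 3 = e * s z ^+ 3 by rewrite exprMn exprS e2 mulr1.
    have : (e * s z) ^+ 3 = (e * s z) ^+ 2 * (e * s z) by rewrite exprSr.
    rewrite e3; move=> e4.
    have -> : q^-1 * (a1 * s (z + T) + c1 * s (z + T) ^+ 3 - e * (a1 * s z + c1 * s z ^+ 3)) =
      q^-1 * (a1 * s (z + T) + c1 * s (z + T) ^+ 3 - (e * (a1 * s z) + c1 * (e * s z ^+ 3))) by ring.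
    by rewrite e4; ring.
  have Ks z : 0 <= z <= L - T -> normc (e * s z) <= B.
    by move=> /sub[z1 _]; rewrite normcM e1 mul1r; have [] := hb1 z z1.
  have KW z : 0 <= z <= L - T -> normc (W z) <= K.
    move=> zz; have [z1 z2] := sub z zz; have [h1 _] := hb1 _ z2; have h2 := Ks z zz.
    rewrite /W /K (le_trans (normcD _ _))// lerD//.
    have -> : 3 * B ^+ 3 = B * (B * B + B * B + B * B) by ring.
    apply: ler_normcM => //; rewrite (le_trans (normcD _ _))// lerD//.
      by rewrite (le_trans (normcD _ _))// lerD// ?expr2; exact: ler_normcM.
    by rewrite expr2; exact: ler_normcM.
  have Kh z : 0 <= z <= L - T -> normc ((W z - (a + 3 * c * r z ^+ 2)) * r' z) <= H1 * eta.
    move=> zz; have [z1 z2] := sub z zz; have [h1 _] := hb1 _ z2; have h2 := Ks z zz.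
    have [b1 b2] := hb z z1; have [c2 _] := close z z1; have [c3 _] := close _ z2.
    have -> : H1 * eta = (1 + 3 * B ^+ 2 + 6 * B ^+ 2 * C1) * eta * B by rewrite /H1; ring.
    apply: ler_normcM => //.
    have -> : r z ^+ 2 = (e * r z) ^+ 2 by rewrite exprMn e2 mul1r.
    apply: duffing_second_variation => //; first exact: ltW.
    - by rewrite normcM e1 mul1r.
    - by have [<- _] := anti z zz.
    - by rewrite -mulrBr normcM e1 mul1r.
  move=> /(_ dy dy' KW Kh x xLT).
  have -> : y 0 = 0 by rewrite /y /w add0r s0 mulr0 subr0 r'0 mulVf// subrr.
  have -> : y' 0 = k by rewrite /y' add0r s'0 r0 mulr1 mulr0 expr0n/= mulr0 addr0 subr0 mulrC.
  rewrite ComplexField.Normc.normc0 expr0n/= add0r => h.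
  rewrite -(ltr_pXn2r (n := 2)) ?nnegrE ?normc_nonneg// expr1n.
  apply: (le_lt_trans _ C3eta).
  apply: (@le_trans _ _ (normc (y x) ^+ 2 + normc (y' x) ^+ 2)); first by rewrite lerDl sqr_ge0.
  apply: (le_trans h).
  have -> : C3 * eta ^+ 2 = expR ((2 + K) * L) * ((C1 * (B + B ^+ 3) * eta) ^+ 2 + L * (H1 * eta) ^+ 2).
    by rewrite /C3; ring.
  have TL0 : L - T <= L by rewrite gerBl.
  apply: ler_pM.
  - exact: expR_ge0.
  - by rewrite addr_ge0 ?sqr_ge0// mulr_ge0 ?sqr_ge0.
  - by rewrite ler_expR ler_wpM2l// addr_ge0.
  - rewrite lerD ?[leRHS]ler_wpM2r ?sqr_ge0//.
      by rewrite lerXn2r ?nnegrE ?normc_nonneg// (le_trans _ kle) ?normc_nonneg.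
    by rewrite ler_wpM2r ?sqr_ge0.
have wE (j : 'I_d) : q^-1 * w (T *+ j) = y (T *+ j) + e ^+ j.
  by rewrite /y per ?subrK// ltnW.
have : \sum_(j < d) e ^+ j.+1 * (q^-1 * w (T *+ j)) = 0.
  (* As [e ^+ j.+1 * e = e ^+ j], each term is a difference of consecutive values of
     [e ^ j s (j T) / q]. *)
  have -> : \sum_(j < d) e ^+ j.+1 * (q^-1 * w (T *+ j)) =
      \sum_(0 <= j < d) (q^-1 * e ^+ j.+1 * s (T *+ j.+1) - q^-1 * e ^+ j * s (T *+ j)).
    rewrite big_mkord; apply: eq_bigr => j _; rewrite /w [in RHS]mulrS [T + _]addrC.
    rewrite (_ : e ^+ j = e ^+ j.+1 * e); first by ring.
    by rewrite exprS mulrC mulrA -expr2 e2 mul1r.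
  rewrite (@telescope_sumr _ 0 d (fun j => q^-1 * e ^+ j * s (T *+ j)))//.
  by rewrite dT sL mulr0n s0 !mulr0 subrr.
have ee j : e ^+ j.+1 * e ^+ j = e.
  by rewrite exprS -mulrA -expr2 exprAC e2 expr1n mulr1.
under eq_bigr => j _ do rewrite wE mulrDr ee.
rewrite big_split/= sumr_const card_ord => /eqP; rewrite addr_eq0 => /eqP hsum.
(* The main terms add up to [d e], of modulus [d], which [d] errors of modulus less than [1] cannot
   cancel. *)
have : normc (\sum_(j < d) e ^+ j.+1 * y (T *+ j)) < d%:R.
  apply: (le_lt_trans (normc_sum _)).
  have -> : (d%:R : R) = \sum_(j < d) 1 by rewrite sumr_const card_ord.
  apply: ltr_sum; first by apply/hasP; exists (Ordinal d0); rewrite ?mem_index_enum.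
  move=> j _; rewrite normcM normcX e1 expr1n mul1r; apply: ybound.
  have := Tle j.+1 (ltn_ord j); rewrite mulrS => /andP[_ h].
  by have /andP[-> _] := Tle j (ltnW (ltn_ord j)); lra.
by rewrite hsum normcN normcMn e1 ltxx.
Qed.

End Duffing.

(** * From weak solutions to classical ones and their profiles *)

Section Solutions.
Context {R : realType}.
Local Open Scope complex_scope.
Implicit Types (x L M a b : R) (f h : R -> R[i]).
Local Notation mu := (@lebesgue_measure R).
Local Notation normc := ComplexField.Normc.normc.

Lemma ReB (p q : R[i]) : complex.Re (p - q) = complex.Re p - complex.Re q.
Proof. by case: p; case: q. Qed.

Lemma ImB (p q : R[i]) : complex.Im (p - q) = complex.Im p - complex.Im q.
Proof. by case: p; case: q. Qed.

Lemma X1_zero L : 0 < L -> X1 L (fun=> 0 : R[i]).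
Proof.
move=> L0; have c0 : continuous (fun _ : R => 0 : R) by move=> x; exact: cvg_cst.
have wd0 : is_weak_derivative L (fun _ : R => 0 : R) (fun=> 0).
  by apply: weak_derivative_smooth => // x; exact: is_derive_cst.
have [h0 _ _] := H2I (L2_continuous L c0) wd0 wd0.
by split.
Qed.

Lemma X1_norm_ge0 L f : 0 <= X1_norm L f.
Proof. exact: sqrtr_ge0. Qed.

Lemma X1_norm_sqr L f :
  X1_norm L f ^+ 2 = H2_sqnorm L (re_part f) + H2_sqnorm L (im_part f).
Proof. by rewrite sqr_sqrtr// addr_ge0 ?H2_sqnorm_ge0. Qed.

Lemma ler_sqnorm_combine (A B C p q s t u v : R) :
  A = p + q -> B = s + t -> C = u + v ->
  p <= 2 * s + 2 * u -> q <= 2 * t + 2 * v -> A <= 2 * B + 2 * C.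
Proof. by move=> -> -> ->; lra. Qed.

Lemma le_of_addl (A B C : R) : 0 <= B -> A + B <= C -> A <= C.
Proof. by lra. Qed.

Lemma le_of_addr (A B C : R) : 0 <= A -> A + B <= C -> B <= C.
Proof. by lra. Qed.

Lemma X1_sub L f h : X1 L f -> X1 L h ->
  [/\ X1 L (fun x => f x - h x),
      {ae mu, forall x, 0 < x < L -> wderiv2C L (fun x => f x - h x) x =
         wderiv2C L f x - wderiv2C L h x} &
      X1_norm L (fun x => f x - h x) ^+ 2 <=
        2 * X1_norm L f ^+ 2 + 2 * X1_norm L h ^+ 2].
Proof.
move=> [f1 f2 f3 f4 f5] [h1 h2 h3 h4 h5].
have re : re_part (fun x => f x - h x) = fun x => re_part f x - re_part h x.
  by apply/funext => x; exact: ReB.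
have im : im_part (fun x => f x - h x) = fun x => im_part f x - im_part h x.
  by apply/funext => x; exact: ImB.
have [r1 r2 r3] := H2_sub f1 h1; have [i1 i2 i3] := H2_sub f2 h2.
split.
- split; rewrite ?re ?im.
  + exact: r1.
  + exact: i1.
  + by move=> x; apply: cvgB; [exact: f3 | exact: h3].
  + by move=> x; apply: cvgB; [exact: f4 | exact: h4].
  + by move=> x x0; rewrite f5// h5// subrr.
- apply: (ae_imp2 r2 i2) => x e1 e2 x0; rewrite /wderiv2C re im e1// e2//.
- refine (ler_sqnorm_combine (X1_norm_sqr L _) (X1_norm_sqr L f) (X1_norm_sqr L h) _ _).
    by rewrite re.
  by rewrite im.
Qed.

(** The second derivative is expressed through [f], which vanishes outside [(0, L)], and not through
    [U]; [U] then lives on the whole line with two-sided derivatives at [0] and [L], and agrees with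
    [f] on [[0, L]]. *)
Definition classical_solution L a b f (U U' : R -> R[i]) : Prop :=
  [/\ forall x, is_derivec x U (U' x),
      forall x, is_derivec x U' (a%:C * f x + b%:C * f x ^+ 3) &
      forall x, 0 <= x <= L -> f x = U x].

Lemma X1_cubic_continuous L a b f : X1 L f ->
  continuous (re_part (fun x => a%:C * f x + b%:C * f x ^+ 3)) /\
  continuous (im_part (fun x => a%:C * f x + b%:C * f x ^+ 3)).
Proof.
move=> [_ _ cr ci _].
have C2 (p q : R -> R) : continuous p -> continuous q -> continuous (fun x => p x * q x).
  by move=> cp cq x; apply: cvgM; [exact: cp | exact: cq].
have C1 k (p : R -> R) : continuous p -> continuous (fun x => k * p x).
  by move=> cp x; apply: cvgM; [exact: cvg_cst | exact: cp].
have CD (p q : R -> R) : continuous p -> continuous q -> continuous (fun x => p x + q x).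
  by move=> cp cq x; apply: cvgD; [exact: cp | exact: cq].
split.
- rewrite (_ : re_part _ = fun x => a * re_part f x + b * (re_part f x * (re_part f x * re_part f x) +
     -3 * (re_part f x * (im_part f x * im_part f x)))).
    by apply: (CD); apply: (C1) => //; apply: (CD); [|apply: (C1)]; do 2 apply: (C2) => //.
  by apply/funext => x; rewrite /re_part /im_part; case: (f x) => u v; rewrite !exprS expr0 /=; ring.
- rewrite (_ : im_part _ = fun x => a * im_part f x + b * (3 * (re_part f x * (re_part f x * im_part f x)) +
     -1 * (im_part f x * (im_part f x * im_part f x)))).
    by apply: (CD); apply: (C1) => //; apply: (CD); apply: (C1); do 2 apply: (C2) => //.
  by apply/funext => x; rewrite /re_part /im_part; case: (f x) => u v; rewrite !exprS expr0 /=; ring.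
Qed.

Lemma solution_classical L hbar m lambda g beta f : 0 < L -> 0 < hbar -> 0 < m ->
  is_solution L hbar m lambda g beta f ->
  let a := (beta - hbar * lambda) / (hbar ^+ 2 / (4 * m)) in
  let b := g / (hbar ^+ 2 / (4 * m)) in
  {ae mu, forall x, 0 < x < L -> wderiv2C L f x = a%:C * f x + b%:C * f x ^+ 3} /\
  exists U U', classical_solution L a b f U U'.
Proof.
move=> L0 hbar0 m0 [Xf eqf] a b.
set kap := hbar ^+ 2 / (4 * m) in eqf a b *.
have kap0 : 0 < kap by rewrite /kap divr_gt0 ?exprn_gt0 ?mulr_gt0.
have kC0 : kap%:C != 0 by rewrite eq_complex /= eqxx andbT gt_eqF.
have ae2 : {ae mu, forall x, 0 < x < L -> wderiv2C L f x = a%:C * f x + b%:C * f x ^+ 3}.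
  apply: (ae_imp eqf) => x h /h {}h.
  apply: (mulfI kC0).
  have -> : kap%:C * (a%:C * f x + b%:C * f x ^+ 3) =
      (kap * a)%:C * f x + (kap * b)%:C * f x ^+ 3 by rewrite !rmorphM; ring.
  have -> : kap * a = beta - hbar * lambda by rewrite /a mulrC divfK ?gt_eqF.
  have -> : kap * b = g by rewrite /b mulrC divfK ?gt_eqF.
  apply/eqP; rewrite -subr_eq0 -oppr_eq0; apply/eqP; rewrite -[RHS]h; ring.
split => //.
have [cr ci] := X1_cubic_continuous a b Xf.
have [[_ ur uur] [_ ui uui] cfr cfi _] := Xf.
have er : {ae mu, forall x, 0 < x < L -> wderiv L (wderiv L (re_part f)) x =
    re_part (fun x => a%:C * f x + b%:C * f x ^+ 3) x}.
  by apply: (ae_imp ae2) => x h /h /(congr1 (@complex.Re R)).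
have ei : {ae mu, forall x, 0 < x < L -> wderiv L (wderiv L (im_part f)) x =
    im_part (fun x => a%:C * f x + b%:C * f x ^+ 3) x}.
  by apply: (ae_imp ae2) => x h /h /(congr1 (@complex.Im R)).
have [U1 [U1' [d1 d1' e1]]] := weak_derivative2_classical L0 cfr ur uur cr er.
have [U2 [U2' [d2 d2' e2]]] := weak_derivative2_classical L0 cfi ui uui ci ei.
exists (fun x => U1 x +i* U2 x), (fun x => U1' x +i* U2' x); split.
- by move=> x; split; [exact: d1 | exact: d2].
- by move=> x; split; [exact: d1' | exact: d2'].
- move=> x x0; apply/eqP; rewrite eq_complex /=.
  by have := e1 x x0; have := e2 x x0; rewrite /re_part /im_part => -> ->; rewrite !eqxx.
Qed.

Lemma X1_classical_bound L f (U U' G : R -> R[i]) M : 0 < L -> 0 < M -> X1 L f ->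
  continuous (re_part G) -> continuous (im_part G) ->
  {ae mu, forall x, 0 < x < L -> wderiv2C L f x = G x} ->
  (forall x, is_derivec x U (U' x)) -> (forall x, is_derivec x U' (G x)) ->
  U 0 = 0 -> U L = 0 -> X1_norm L f <= M ->
  forall x, 0 <= x <= L ->
    normc (U' x) <= 2 * (M * (1 + L)) /\ normc (U x) <= 2 * (M * (1 + L) * L).
Proof.
move=> L0 M0 [h1 h2 _ _ _] cr ci e dU dU' U0 UL hM x xL.
have M2 : X1_norm L f ^+ 2 <= M ^+ 2 by rewrite lerXn2r ?nnegrE ?X1_norm_ge0// ltW.
rewrite X1_norm_sqr in M2.
have [n1 n2] := (H2_sqnorm_ge0 L (re_part f), H2_sqnorm_ge0 L (im_part f)).
have [||||||b1 b2] := @H2_classical_bound _ L (re_part f) (re_part U) (re_part U') (re_part G) M L0 M0 h1 _ cr _ _ _ _ _ x xL.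
- by apply: (ae_imp e) => y h /h /(congr1 (@complex.Re R)).
- by move=> y; have [] := dU y.
- by move=> y; have [] := dU' y.
- by rewrite /re_part U0.
- by rewrite /re_part UL.
- exact (le_of_addl n2 M2).
have [||||||b3 b4] := @H2_classical_bound _ L (im_part f) (im_part U) (im_part U') (im_part G) M L0 M0 h2 _ ci _ _ _ _ _ x xL.
- by apply: (ae_imp e) => y h /h /(congr1 (@complex.Im R)).
- by move=> y; have [] := dU y.
- by move=> y; have [] := dU' y.
- by rewrite /im_part U0.
- by rewrite /im_part UL.
- exact (le_of_addr n1 M2).
by split; exact: normc_le_ReIm.
Qed.

Definition regular_solution L a b f (U U' : R -> R[i]) : Prop :=
  [/\ X1 L f,
      {ae mu, forall x, 0 < x < L -> wderiv2C L f x = a%:C * f x + b%:C * f x ^+ 3} &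
      classical_solution L a b f U U'].

Lemma normc_real (k : R) : normc k%:C = `|k|.
Proof. by rewrite /ComplexField.Normc.normc /= expr0n /= addr0 sqrtr_sqr. Qed.

Lemma regular_solution_ends L a b f (U U' : R -> R[i]) : 0 < L ->
  regular_solution L a b f U U' -> [/\ U 0 = 0, U L = 0 & f L = 0].
Proof.
move=> L0 [[_ _ _ _ fe] _ [_ _ e]].
have f0 : f 0 = 0 by apply: fe; rewrite ltxx.
have fL : f L = 0 by apply: fe; rewrite ltxx andbF.
by split; rewrite // -e ?lexx ?ltW.
Qed.

Lemma regular_solution_bound L a b f (U U' : R -> R[i]) M : 0 < L -> 0 < M ->
  regular_solution L a b f U U' -> X1_norm L f <= M ->
  forall x, 0 <= x <= L ->
    normc (U' x) <= 2 * (M * (1 + L)) /\ normc (f x) <= 2 * (M * (1 + L) * L).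
Proof.
move=> L0 M0 hf hM x xL; have [U0 UL _] := regular_solution_ends L0 hf.
have [Xf ae2 [dU dU' e]] := hf; have [cr ci] := X1_cubic_continuous a b Xf.
rewrite (e x xL); exact: (X1_classical_bound L0 M0 Xf cr ci ae2 dU dU' U0 UL hM xL).
Qed.

(** Makes the slope at [0], and with it the parameter [b p ^ 2] of the profile, depend continuously
    on the solution in the [X1] norm. *)
Lemma regular_solution_close L a b f (U U' : R -> R[i]) a1 f1 (U1 U1' : R -> R[i]) M :
  0 < L -> 0 < M -> regular_solution L a b f U U' -> regular_solution L a1 b f1 U1 U1' ->
  X1_norm L (fun x => f1 x - f x) <= M ->
  normc (U1' 0 - U' 0) <= 2 * (M * (1 + L)).
Proof.
move=> L0 M0 hf hf1 hM; have [U0 UL _] := regular_solution_ends L0 hf.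
have [U10 U1L _] := regular_solution_ends L0 hf1.
have [Xf ae2 [dU dU' e]] := hf; have [cr ci] := X1_cubic_continuous a b Xf.
have [Xf1 ae21 [dU1 dU1' e1]] := hf1; have [cr1 ci1] := X1_cubic_continuous a1 b Xf1.
have [XD aeD _] := X1_sub Xf1 Xf.
pose G x := (a1%:C * f1 x + b%:C * f1 x ^+ 3) - (a%:C * f x + b%:C * f x ^+ 3).
have crG : continuous (re_part G).
  rewrite (_ : re_part G = fun x => re_part (fun x => a1%:C * f1 x + b%:C * f1 x ^+ 3) x -
    re_part (fun x => a%:C * f x + b%:C * f x ^+ 3) x); last by apply/funext => x; exact: ReB.
  by move=> x; apply: cvgB; [exact: cr1 | exact: cr].
have ciG : continuous (im_part G).
  rewrite (_ : im_part G = fun x => im_part (fun x => a1%:C * f1 x + b%:C * f1 x ^+ 3) x -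
    im_part (fun x => a%:C * f x + b%:C * f x ^+ 3) x); last by apply/funext => x; exact: ImB.
  by move=> x; apply: cvgB; [exact: ci1 | exact: ci].
have aeG : {ae mu, forall x, 0 < x < L -> wderiv2C L (fun x => f1 x - f x) x = G x}.
  have ae12 : {ae mu, forall x, 0 < x < L -> wderiv2C L f1 x - wderiv2C L f x = G x}.
    by apply: (ae_imp2 ae21 ae2) => x h1 h2 xL; rewrite h1// h2.
  by apply: (ae_imp2 aeD ae12) => x h1 h2 xL; rewrite h1// h2.
have D0 : U1 0 - U 0 = 0 by rewrite U10 U0 subrr.
have DL : U1 L - U L = 0 by rewrite U1L UL subrr.
have zero : 0 <= (0 : R) <= L by rewrite lexx ltW.
by have [] := X1_classical_bound L0 M0 XD crG ciG aeG
  (fun x => is_derivec_sub (dU1 x) (dU x)) (fun x => is_derivec_sub (dU1' x) (dU' x)) D0 DL hM zero.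
Qed.

(** With [p = U' 0], both [U] and [U / p] solve the linear equation with potential [a + b f ^ 2],
    bounded in terms of [A0] and [N]. For [p = 0] the energy estimate would give [f = 0]; otherwise
    it bounds [U / p], whose data are [0] and [1], however small [p] is. *)
Lemma regular_solution_profile L b N A0 : 0 < L -> 0 <= b -> 0 < N -> 0 <= A0 ->
  exists2 B, 1 <= B & forall a f (U U' : R -> R[i]), `|a| <= A0 ->
    regular_solution L a b f U U' -> X1_norm L f <= N ->
    (exists2 x, 0 <= x <= L & f x != 0) ->
    [/\ U' 0 != 0, normc (U' 0) <= B &
        duffing_profile L B a%:C (b%:C * U' 0 ^+ 2) (fun x => U x / U' 0) (fun x => U' x / U' 0)].
Proof.
move=> L0 b0 N0 A00.
pose P := 2 * (N * (1 + L)); pose F := 2 * (N * (1 + L) * L); pose K := A0 + b * F ^+ 2.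
have P0 : 0 <= P by rewrite /P !mulr_ge0 ?addr_ge0// ltW.
have F0 : 0 <= F by rewrite /F !mulr_ge0 ?addr_ge0// ltW.
have K0 : 0 <= K by rewrite /K addr_ge0// mulr_ge0// sqr_ge0.
pose E := expR ((2 + K) * L); have E0 : 0 <= E by exact: expR_ge0.
have bP0 : 0 <= b * P ^+ 2 by rewrite mulr_ge0 ?sqr_ge0.
pose B := 1 + E + A0 + P + b * P ^+ 2; exists B; first by rewrite /B; lra.
move=> a f U U' aA hf hN [x1 x1L fx1].
have [U0 UL _] := regular_solution_ends L0 hf.
have bd x := regular_solution_bound L0 N0 hf hN (x := x).
have [Xf ae2 [dU dU' e]] := hf.
have zero : 0 <= (0 : R) <= L by rewrite lexx ltW.
have [p1 _] := bd 0 zero; rewrite -/P in p1.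
have KV x : 0 <= x <= L -> normc (a%:C + b%:C * f x ^+ 2) <= K.
  move=> xL; have [_ fF] := bd x xL; rewrite (le_trans (normcD _ _))// lerD//.
    by rewrite normc_real.
  apply: ler_normcM; first by rewrite normc_real ger0_norm.
  by rewrite normcX lerXn2r ?nnegrE ?normc_nonneg.
have pn0 : U' 0 != 0.
  apply/eqP => p0; move: fx1; rewrite e//; apply/negP; rewrite negbK; apply/eqP/normc_eq0.
  have := linear_ode_bound (ltW L0) K0 (lexx 0) (fun x _ => dU x) (V := fun x => a%:C + b%:C * f x ^+ 2)
    (h := fun=> 0).
  rewrite U0 p0 ComplexField.Normc.normc0 expr0n/= !mulr0 !add0r mulr0.
  have dU2 x : 0 <= x <= L -> is_derivec x U' ((a%:C + b%:C * f x ^+ 2) * U x + 0).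
    by move=> xL; apply: (is_derivec_eq (dU' x)); rewrite -(e x xL); ring.
  move=> /(_ dU2 KV (fun _ _ => lexx _) x1 x1L); rewrite -[X in _ <= X -> _](expr0n R 2).
  move=> /(normc_le_of_sqr (lexx 0))[h _].
  by apply/eqP; rewrite eq_le h normc_nonneg.
set p := U' 0 in pn0 p1 *.
have dr x : is_derivec x (fun y => U y / p) (U' x / p).
  have := is_derivec_scale p^-1 (dU x); rewrite mulrC.
  by congr (is_derivec _ _ _); apply/funext => y; rewrite mulrC.
have dr' x : 0 <= x <= L -> is_derivec x (fun y => U' y / p)
   (a%:C * (U x / p) + b%:C * p ^+ 2 * (U x / p) ^+ 3).
  move=> xL; have := is_derivec_scale p^-1 (dU' x).
  have -> : (fun y => p^-1 * U' y) = (fun y => U' y / p) by apply/funext => y; rewrite mulrC.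
  by move=> h; apply: (is_derivec_eq h); rewrite (e x xL); field.
have bdr x : 0 <= x <= L -> normc (U x / p) <= B /\ normc (U' x / p) <= B.
  move=> xL; apply: normc_le_of_sqr; first by rewrite /B; lra.
  have := linear_ode_bound (ltW L0) K0 (lexx 0) (fun x _ => dr x)
    (V := fun x => a%:C + b%:C * f x ^+ 2) (h := fun=> 0).
  rewrite U0 mul0r -/p mulfV// ComplexField.Normc.normc0 ComplexField.Normc.normc1.
  rewrite !expr0n/= expr1n mulr0 addr0 add0r mulr1 => h.
  have {}h : normc (U x / p) ^+ 2 + normc (U' x / p) ^+ 2 <= E.
    apply: h => // y yL; apply: (is_derivec_eq (dr' y yL)); rewrite (e y yL); by field.
  apply: (le_trans h); rewrite /B; nra.
split => //; first by rewrite /B; lra.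
split => //.
- by rewrite normc_real /B; lra.
- apply: (@le_trans _ _ (b * P ^+ 2)); last by rewrite /B; lra.
  apply: ler_normcM; first by rewrite normc_real ger0_norm.
  by rewrite normcX lerXn2r ?nnegrE ?normc_nonneg.
- by move=> x xL; split; [exact: dr | exact: dr'].
- by rewrite U0 mul0r -/p mulfV.
Qed.

End Solutions.

(** * Propagation of the zero at [L / d] along a bifurcating family *)

Section Branches.
Context {R : realType}.
Local Open Scope complex_scope.
Variables (L hbar m lambda g : R).
Hypotheses (L0 : 0 < L) (hbar0 : 0 < hbar) (m0 : 0 < m) (g0 : 0 < g).
Implicit Types (x w beta theta eps : R) (f psi : R -> R[i]).
Local Notation normc := ComplexField.Normc.normc.

Let kap := hbar ^+ 2 / (4 * m).
Let A beta := (beta - hbar * lambda) / kap.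
Let b := g / kap.

Let kap0 : 0 < kap.
Proof. by rewrite /kap divr_gt0 ?exprn_gt0 ?mulr_gt0. Qed.

Let b0 : 0 < b.
Proof. by rewrite /b divr_gt0. Qed.

Lemma nontrivial_solution_regular beta f :
  nontrivial_solution L hbar m lambda g beta f ->
  (exists U U', regular_solution L (A beta) b f U U') /\ exists2 x, 0 <= x <= L & f x != 0.
Proof.
move=> [sf nf]; split => //; have [ae2 [U [U' cl]]] := solution_classical L0 hbar0 m0 sf.
by exists U, U'; split => //; have [] := sf.
Qed.

Lemma scaled_parameter_dist beta theta : A beta - A theta = (beta - theta) / kap.
Proof. by rewrite /A -mulrBl; congr (_ / _); ring. Qed.

Lemma scaled_parameter_bound theta c : `|c - theta| <= 1 -> `|A c| <= `|A theta| + kap^-1.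
Proof.
move=> hc; rewrite -[A c](subrK (A theta)) addrC (le_trans (ler_normD _ _))// lerD2l.
rewrite scaled_parameter_dist normrM (gtr0_norm (_ : 0 < kap^-1)) ?invr_gt0//.
by rewrite ler_piMl ?invr_ge0 ?(ltW kap0).
Qed.

Lemma scaled_parameter_close beta beta1 theta e : `|beta - theta| < e -> `|beta1 - theta| < e ->
  `|A beta1 - A beta| <= e * (2 / kap).
Proof.
move=> hb hb1; rewrite scaled_parameter_dist normrM (gtr0_norm (_ : 0 < kap^-1)) ?invr_gt0//.
rewrite [e * _](_ : _ = (2 * e) / kap); last by ring.
rewrite ler_wpM2r ?invr_ge0 ?(ltW kap0)//.
have -> : beta1 - beta = (beta1 - theta) - (beta - theta) by ring.
by rewrite (le_trans (ler_normB _ _))//; lra.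
Qed.

Lemma ler_add3_middle (p q t : R) : 0 <= p -> 0 <= t -> q <= p + q + t.
Proof. by lra. Qed.

Lemma ler_add3_last (p q t : R) : 0 <= p -> 0 <= q -> t <= p + q + t.
Proof. by lra. Qed.

Lemma div_nat_itv (d : nat) : (0 < d)%N -> 0 <= L / d%:R <= L.
Proof.
move=> d0; apply/andP; split; first by rewrite divr_ge0// ltW.
by rewrite ler_pdivrMr ?ltr0n// ler_peMr ?ler1n// ltW.
Qed.

Lemma ler_sqr_sum2 (t n : R) : 0 <= n -> t ^+ 2 <= 1 ->
  2 * t ^+ 2 + 2 * n ^+ 2 <= (2 * (1 + n)) ^+ 2.
Proof. by move=> n0 t1; have := sqr_ge0 n; nra. Qed.

Lemma ler_sqr_sum4 (s t e : R) : 0 <= s -> 0 <= t -> s < e -> t < e ->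
  2 * t ^+ 2 + 2 * s ^+ 2 <= (2 * e) ^+ 2.
Proof. by nra. Qed.

(** The centre [psi] is only assumed to lie in [X1]: it stands for the value of a family at a
    parameter, possibly [0], where it need not solve the problem. The two solutions are compared
    with each other through it. *)
Lemma solution_zero_locally_stable theta psi (d : nat) : (0 < d)%N -> X1 L psi ->
  exists2 eps, 0 < eps & forall beta f beta1 f1,
    nontrivial_solution L hbar m lambda g beta f ->
    nontrivial_solution L hbar m lambda g beta1 f1 ->
    `|beta - theta| < eps -> `|beta1 - theta| < eps ->
    X1_norm L (fun x => f x - psi x) < eps -> X1_norm L (fun x => f1 x - psi x) < eps ->
    f (L / d%:R) = 0 -> f1 (L / d%:R) = 0.
Proof.
move=> d0 Xpsi; have [XN _ _] := X1_sub (X1_zero L0) Xpsi.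
pose N0 := X1_norm L (fun x => 0 - psi x).
have N00 : 0 <= N0 by exact: X1_norm_ge0.
(* Bounds the norm of every function within distance [1] of [psi]; the factor [2] comes from the
   quadratic inequality in [X1_sub]. *)
pose N := 2 * (1 + N0); have N_gt0 : 0 < N by rewrite /N; lra.
pose A0 := `|A theta| + kap^-1.
have A00 : 0 <= A0 by rewrite /A0 addr_ge0// invr_ge0 ltW.
have [B B1 hB] := regular_solution_profile L0 (ltW b0) N_gt0 A00.
have [delta delta0 hQ] := duffing_zero_stable L0 d0 B1.
have B0 : 0 <= B by lra.
(* The second summand accounts for the variation of [a], the third for that of [b p ^ 2], factored
   as [b (p1 - p) (p1 + p)]; hence [eps D <= delta] meets both requirements of the stability
   lemma. *)
pose D := 1 + 2 / kap + b * (8 * (1 + L)) * B.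
have e1 : 0 <= 2 / kap by rewrite divr_ge0// ltW.
have e2 : 0 <= b * (8 * (1 + L)) * B.
  by rewrite mulr_ge0// mulr_ge0 ?(ltW b0)//; have := L0; lra.
have D0 : 0 < D by rewrite /D; lra.
pose eps := Num.min 1 (delta / D).
have eps0 : 0 < eps by rewrite /eps lt_min ltr01 divr_gt0.
have eps1 : eps <= 1 by rewrite /eps ge_min lexx.
have epsD : eps * D <= delta by rewrite -ler_pdivlMr// /eps ge_min lexx orbT.
exists eps => // beta f beta1 f1 nf nf1 hb hb1 hf hf1 fd.
have Xf : X1 L f by have [[]] := nf.
have Xf1 : X1 L f1 by have [[]] := nf1.
have normN h : X1 L h -> X1_norm L (fun x => h x - psi x) < eps -> X1_norm L h <= N.
  move=> Xh hh; have [Xd _ _] := X1_sub Xh Xpsi; have [_ _] := X1_sub Xd XN.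
  have -> : (fun x => h x - psi x - (0 - psi x)) = h by apply/funext => x; ring.
  rewrite -/N0; move: hh; move: (X1_norm_ge0 L (fun x => h x - psi x)).
  set t := X1_norm L (fun x => h x - psi x); move=> t0 te hn.
  rewrite -(ler_pXn2r (n := 2)) ?nnegrE ?X1_norm_ge0 ?(ltW N_gt0)//.
  apply: (le_trans hn); apply: ler_sqr_sum2 => //.
  by rewrite expr_le1// (le_trans (ltW te)).
have normA c : `|c - theta| < eps -> `|A c| <= A0.
  by move=> /ltW/le_trans/(_ eps1); exact: scaled_parameter_bound.
have [[U [U' rf]] zf] := nontrivial_solution_regular nf.
have [[U1 [U1' rf1]] zf1] := nontrivial_solution_regular nf1.
have [p0 pB pf] := hB _ _ _ _ (normA _ hb) rf (normN _ Xf hf) zf.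
have [p10 p1B pf1] := hB _ _ _ _ (normA _ hb1) rf1 (normN _ Xf1 hf1) zf1.
have [_ U1L _] := regular_solution_ends L0 rf1.
have dL := div_nat_itv d0.
have close : normc (U1' 0 - U' 0) <= 2 * (2 * eps * (1 + L)).
  apply: (regular_solution_close L0 _ rf rf1); first by rewrite mulr_gt0.
  have [Xd _ _] := X1_sub Xf Xpsi; have [Xd1 _ _] := X1_sub Xf1 Xpsi.
  have [_ _] := X1_sub Xd1 Xd.
  have -> : (fun x => f1 x - psi x - (f x - psi x)) = (fun x => f1 x - f x).
    by apply/funext => x; ring.
  move: hf hf1 (X1_norm_ge0 L (fun x => f x - psi x)) (X1_norm_ge0 L (fun x => f1 x - psi x)).
  set s := X1_norm L (fun x => f x - psi x); set t := X1_norm L (fun x => f1 x - psi x).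
  move=> hs ht s0 t0 hn.
  rewrite -(ler_pXn2r (n := 2)) ?nnegrE ?X1_norm_ge0 ?mulr_ge0 ?(ltW eps0)//.
  apply: (le_trans hn); exact: (ler_sqr_sum4 s0 t0 hs ht).
have -> : f1 (L / d%:R) = U1 (L / d%:R) by have [_ _ [_ _ ->]] := rf1.
have rd : U (L / d%:R) / U' 0 = 0.
  by have [_ _ [_ _ <-]] := rf => //; rewrite fd mul0r.
have : U1 (L / d%:R) / U1' 0 = 0; last first.
  by move/eqP; rewrite mulf_eq0 invr_eq0 (negbTE p10) orbF => /eqP.
apply: (hQ _ _ _ _ _ _ _ _ pf pf1 _ _ _ rd).
- by rewrite U1L mul0r.
- rewrite -rmorphB normc_real; apply: (le_trans (scaled_parameter_close hb hb1)); apply: le_trans epsD.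
  rewrite ler_wpM2l ?(ltW eps0)//.
  by rewrite /D; apply: ler_add3_middle => //; exact: ler01.
- rewrite -mulrBr (_ : U1' 0 ^+ 2 - U' 0 ^+ 2 = (U1' 0 - U' 0) * (U1' 0 + U' 0)); last by ring.
  apply: le_trans epsD; apply: (@le_trans _ _ (b * (2 * (2 * eps * (1 + L)) * (B + B)))).
    apply: ler_normcM; first by rewrite normc_real ger0_norm// ltW.
    by apply: ler_normcM => //; rewrite (le_trans (normcD _ _))// lerD.
  have -> : b * (2 * (2 * eps * (1 + L)) * (B + B)) = eps * (b * (8 * (1 + L)) * B) by ring.
  rewrite ler_wpM2l ?(ltW eps0)//.
  by rewrite /D; apply: ler_add3_last => //; exact: ler01.
Qed.

Lemma duffing_profile_le B B' a c (r r' : R -> R[i]) : B <= B' ->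
  duffing_profile L B a c r r' -> duffing_profile L B' a c r r'.
Proof.
move=> BB [h1 h2 h3 h4 h5]; split => //; [exact: le_trans BB|exact: le_trans BB|].
by move=> x /h3[h6 h7]; split; exact: le_trans BB.
Qed.

Lemma duffing_profile_sin w B : 0 < w -> 1 <= B -> w^-1 <= B -> w ^+ 2 <= B ->
  duffing_profile L B (- w ^+ 2)%:C 0 (fun x => (sin (w * x) / w)%:C) (fun x => (cos (w * x))%:C).
Proof.
move=> w0 B1 wB w2B.
have dw (x : R) : is_derive x 1 (fun y => w * y) (w * 1) by exact: is_derive_scale.
split.
- by rewrite normc_real normrN ger0_norm// sqr_ge0.
- by rewrite ComplexField.Normc.normc0; lra.
- move=> x _; split; rewrite normc_real.
    rewrite normrM (gtr0_norm (_ : 0 < w^-1)) ?invr_gt0//.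
    by rewrite (le_trans _ wB)// ler_piMl ?invr_ge0 ?(ltW w0)// sin_max.
  by rewrite (le_trans (cos_max _)).
- move=> x _; split.
    have h := is_derive_scale w^-1 (is_derive_compr (is_derive_sin (w * x)) (dw x)).
    have -> : (fun y => (sin (w * y) / w)%:C) = (fun y => (w^-1 * sin (w * y))%:C).
      by apply/funext => y; rewrite mulrC.
    apply: (is_derivec_eq (is_derivec_real h)); congr (_%:C).
    by field; rewrite gt_eqF.
  have h := is_derive_compr (is_derive_cos (w * x)) (dw x).
  apply: (is_derivec_eq (is_derivec_real h)).
  rewrite mul0r addr0 -rmorphM; congr (_%:C).
  by field; rewrite gt_eqF.
- by rewrite mulr0 sin0 cos0 mul0r.
Qed.

(** As [f] becomes small so does [p], and the profile parameters approach [- w ^ 2] and [0], those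
    of [sin (w x) / w]. Since this sine also vanishes at [L], stability applies in both
    directions. *)
Lemma solution_zero_near_bifurcation w theta (d : nat) : (0 < d)%N -> 0 < w ->
  sin (w * L) = 0 -> A theta = - w ^+ 2 ->
  exists2 eps, 0 < eps & forall beta f,
    nontrivial_solution L hbar m lambda g beta f ->
    `|beta - theta| < eps -> X1_norm L f < eps ->
    (f (L / d%:R) == 0) = (sin (w * (L / d%:R)) == 0).
Proof.
move=> d0 w0 sinL Aw.
pose A0 := `|A theta| + kap^-1.
have A00 : 0 <= A0 by rewrite /A0 addr_ge0// invr_ge0 ltW.
have [B B1 hB] := regular_solution_profile L0 (ltW b0) (ltr01 : 0 < (1 : R)) A00.
have wi0 : 0 < w^-1 by rewrite invr_gt0.
pose B' := B + w^-1 + w ^+ 2.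
have w20 := sqr_ge0 w.
have BB' : B <= B' by rewrite /B'; lra.
have B'1 : 1 <= B' by exact: le_trans BB'.
have psin : duffing_profile L B' (- w ^+ 2)%:C 0
    (fun x => (sin (w * x) / w)%:C) (fun x => (cos (w * x))%:C).
  by apply: duffing_profile_sin => //; rewrite /B'; lra.
have [delta delta0 hQ] := duffing_zero_stable L0 d0 B'1.
have B0 : 0 <= B by lra.
pose D := 1 + 2 / kap + b * (2 * (1 + L)) * B.
have e1 : 0 <= 2 / kap by rewrite divr_ge0// ltW.
have e2 : 0 <= b * (2 * (1 + L)) * B.
  by rewrite mulr_ge0// mulr_ge0 ?(ltW b0)//; have := L0; lra.
have D0 : 0 < D by rewrite /D; lra.
pose eps := Num.min 1 (delta / D).
have eps0 : 0 < eps by rewrite /eps lt_min ltr01 divr_gt0.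
have eps1 : eps <= 1 by rewrite /eps ge_min lexx.
have epsD : eps * D <= delta by rewrite -ler_pdivlMr// /eps ge_min lexx orbT.
exists eps => // beta f nf hb hf.
have [[U [U' rf]] zf] := nontrivial_solution_regular nf.
have [p0 pB pf] := hB _ _ _ _ (scaled_parameter_bound (le_trans (ltW hb) eps1)) rf (le_trans (ltW hf) eps1) zf.
have {}pf := duffing_profile_le BB' pf.
have [_ UL _] := regular_solution_ends L0 rf.
have dL := div_nat_itv d0.
have zero : 0 <= (0 : R) <= L by rewrite lexx ltW.
have [ple _] := regular_solution_bound L0 eps0 rf (ltW hf) zero.
have -> : f (L / d%:R) = U (L / d%:R) by have [_ _ [_ _ ->]] := rf.
have aa : normc ((A beta)%:C - (- w ^+ 2)%:C) <= delta.
  rewrite -rmorphB normc_real -Aw; apply: le_trans epsD.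
  have tt : `|theta - theta| < eps by rewrite subrr normr0.
  apply: (le_trans (scaled_parameter_close tt hb)).
  rewrite ler_wpM2l ?(ltW eps0)//.
  by rewrite /D; apply: ler_add3_middle => //; exact: ler01.
have cc : normc (b%:C * U' 0 ^+ 2 - 0) <= delta.
  rewrite subr0; apply: le_trans epsD; apply: (@le_trans _ _ (b * (2 * (eps * (1 + L)) * B))).
    apply: ler_normcM; first by rewrite normc_real ger0_norm// ltW.
    by rewrite expr2; apply: ler_normcM.
  have -> : b * (2 * (eps * (1 + L)) * B) = eps * (b * (2 * (1 + L)) * B) by ring.
  rewrite ler_wpM2l ?(ltW eps0)//.
  by rewrite /D; apply: ler_add3_last => //; exact: ler01.
apply/eqP/eqP => h.
- have h1 : U (L / d%:R) / U' 0 = 0 by rewrite h mul0r.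
  have : (sin (w * (L / d%:R)) / w)%:C = 0.
    apply: (hQ _ _ _ _ _ _ _ _ pf psin _ _ _ h1).
    + by rewrite sinL mul0r.
    + by rewrite -opprB normcN.
    + by rewrite -opprB normcN.
  by move=> [] /eqP; rewrite mulf_eq0 invr_eq0 (gt_eqF w0) orbF => /eqP.
- have h1 : (sin (w * (L / d%:R)) / w)%:C = 0 :> R[i] by rewrite h mul0r.
  have : U (L / d%:R) / U' 0 = 0.
    by apply: (hQ _ _ _ _ _ _ _ _ psin pf _ aa cc h1); rewrite UL mul0r.
  by move/eqP; rewrite mulf_eq0 invr_eq0 (negbTE p0) orbF => /eqP.
Qed.

(** Of two distinct candidates near [u], at least one avoids the excluded value [z]. *)
Lemma punctured_unit_point (z u rho : R) : 0 <= u <= 1 -> 0 < rho ->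
  exists s, [/\ 0 < s <= 1, s != z & `|s - u| < rho].
Proof.
move=> /andP[u0 u1] rho0; pose r := Num.min rho 1 / 4.
have r0 : 0 < r by rewrite /r divr_gt0// lt_min rho0 ltr01.
have r1 : r <= 1 / 4 by rewrite /r ler_pM2r ?invr_gt0// ge_min lexx orbT.
have rr : r < rho.
  have : Num.min rho 1 <= rho by rewrite ge_min lexx.
  by rewrite /r; lra.
have two (p q : R) : p != q -> p != z \/ q != z.
  by move=> pq; case: (eqVneq p z) => [pz|pz]; [right; rewrite -pz eq_sym|left].
have [uh|uh] := ltP u (1 / 2).
- have [|h|h] := two (u + r) (u + r / 2); first by apply/eqP; lra.
  + by exists (u + r); split; rewrite // ?ltr_norml; lra.
  + by exists (u + r / 2); split; rewrite // ?ltr_norml; lra.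
- have [|h|h] := two (u - r) (u - r / 2); first by apply/eqP; lra.
  + by exists (u - r); split; rewrite // ?ltr_norml; lra.
  + by exists (u - r / 2); split; rewrite // ?ltr_norml; lra.
Qed.

Lemma clip_le (c x y : R) :
  Num.min c (Num.max 0 x) - Num.min c (Num.max 0 y) <= `|x - y|.
Proof.
have h := ler_norm (x - y); have h0 := normr_ge0 (x - y).
case: (leP c (Num.max 0 x)); case: (leP c (Num.max 0 y)); case: (leP 0 x); case: (leP 0 y);
  by move=> *; lra.
Qed.

(** Connectedness of [[0, 1]] for a predicate that is uncontrolled at [0] and at [z]. The argument
    follows the local value around [t] instead of [p t]: neighbouring local values agree because
    they are read at a common admissible point. *)
Lemma locally_constant_punctured (z : R) (p : R -> bool) :
  (forall t, 0 <= t <= 1 -> exists2 eta, 0 < eta & exists v, forall s,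
     0 < s <= 1 -> s != z -> `|s - t| < eta -> p s = v) ->
  forall v eta s, 0 < eta -> (forall s, 0 < s <= 1 -> s != z -> `|s| < eta -> p s = v) ->
    0 < s <= 1 -> s != z -> p s = v.
Proof.
move=> loc v0 eta0 s0 eta00 hv0 s01 s0z.
have loc' t : exists e : R * bool, 0 <= t <= 1 -> 0 < e.1 /\
    forall s, 0 < s <= 1 -> s != z -> `|s - t| < e.1 -> p s = e.2.
  have [/loc[eta e0 [v hv]]|nt] := boolP (0 <= t <= 1); first by exists (eta, v).
  by exists (1, true).
have [E hE] := choice loc'.
pose c (t : R) := Num.min 1 (Num.max 0 t).
have c01 t : 0 <= c t <= 1 by rewrite /c le_min ge_min ler01 lexx le_max lexx.
have clip t t' : `|c t - c t'| <= `|t - t'|.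
  by rewrite ler_norml clip_le andbT lerNl opprB distrC clip_le.
(* Clipping extends the local value to the whole line; read as a real number it is locally constant,
   so it has derivative [0] and is constant. *)
pose q t : R := (E (c t)).2%:R.
have dq (t : R) : is_derive t 1 q 0.
  apply: (@near_eq_is_derive _ _ _ (cst (q t))).
  have [Et ht] := hE (c t) (c01 t).
  apply/nbhs_ballP; exists ((E (c t)).1 / 2); first by rewrite /= divr_gt0.
  move=> t' tt'; rewrite /q /=; congr (_%:R); congr (nat_of_bool _).
  have [Et' ht'] := hE (c t') (c01 t').
  have rho0 : 0 < Num.min (E (c t')).1 ((E (c t)).1 / 2) by rewrite lt_min Et' divr_gt0.
  have [s [s1 sz]] := punctured_unit_point z (c01 t') rho0; rewrite lt_min => /andP[h1 h2].
  rewrite -(ht' s s1 sz h1) -(ht s s1 sz)//.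
  have := clip t' t; rewrite /ball/= distrC in tt'; have := ler_distD (c t') s (c t); lra.
have c_id t : 0 <= t <= 1 -> c t = t.
  by move=> /andP[t0 t1]; rewrite /c max_r// min_r.
have s0' : 0 <= s0 <= 1 by case/andP: s01 => /ltW -> ->.
have qs : q s0 = q 0.
  by apply: is_derive0_eq; case/andP: s0'.
have z01 : 0 <= (0 : R) <= 1 by rewrite lexx ler01.
have [E0 h0] := hE _ z01; have [Es hs] := hE _ s0'.
have -> : p s0 = (E s0).2 by apply: hs => //; rewrite subrr normr0.
have -> : v0 = (E 0).2.
  have rho0 : 0 < Num.min eta0 (E 0).1 by rewrite lt_min eta00.
  have [s [s1 sz]] := punctured_unit_point z z01 rho0.
  by rewrite lt_min subr0 => /andP[h1 h2]; rewrite -(hv0 s)// -(h0 s)// subr0.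
by move: qs; rewrite /q !c_id//; case: (E s0).2; case: (E 0).2 => // /eqP; rewrite ?oner_eq0// eq_sym oner_eq0.
Qed.

Lemma cvg_within0 (I : set R) theta (F : R -> R) :
  F beta @[beta --> within I (nbhs theta)] --> (0 : R) ->
  forall eps, 0 < eps -> exists2 delta, 0 < delta &
    forall beta, I beta -> `|beta - theta| < delta -> F beta < eps.
Proof.
move=> /cvgrPdist_lt h eps e0; have := h eps e0; rewrite /within/= => /nbhs_ballP[delta /= d0 hd].
exists delta => // beta Ib bt; have := hd beta; rewrite /ball/= distrC => /(_ bt Ib).
by rewrite sub0r normrN; apply: le_lt_trans; exact: ler_norm.
Qed.

(* The family may pass through [beta = 0], where nothing is known of it besides
   continuity: the zero at [L / d] is propagated across that value. *)
Lemma bifurcating_family_zero w theta (I : set R) (phi : R -> R -> R[i]) (d : nat) :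
  (0 < d)%N -> 0 < w -> sin (w * L) = 0 -> A theta = - w ^+ 2 ->
  bifurcating_family L hbar m lambda g theta I phi ->
  forall beta, I beta -> beta != 0 ->
    (phi beta (L / d%:R) == 0) = (sin (w * (L / d%:R)) == 0).
Proof.
move=> d0 w0 sinL Aw [[itvI nI clI] XI solI contI cont0] beta Ib b_neq0.
have bt : beta != theta by apply/eqP => e; apply: nI; rewrite -e.
(* The segment from the bifurcation value to [beta]. As [theta] is in the closure of the interval
   [I], all of it except possibly [theta] lies in [I]. *)
pose gam t : R := theta + t * (beta - theta).
have gI t : 0 < t <= 1 -> I (gam t).
  move=> /andP[t0 t1].
  have e0 : 0 < t * `|beta - theta| by rewrite mulr_gt0// normr_gt0 subr_eq0.
  have [c [Ic]] := clI _ (nbhsx_ballx theta _ e0).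
  rewrite /ball/= ltr_norml => /andP[h1 h2].
  have [bth|bth] := ltP theta beta.
  - rewrite gtr0_norm ?subr_gt0// in h1 h2.
    apply: (itvI _ _ Ic Ib); rewrite /gam; apply/andP; split; first by lra.
    by rewrite -lerBrDl ler_piMl// subr_ge0 ltW.
  - have bth' : beta - theta <= 0 by rewrite subr_le0.
    rewrite ler0_norm// in h1 h2.
    apply: (itvI _ _ Ib Ic); rewrite /gam; apply/andP; split; last by lra.
    by rewrite -lerBlDl ler_niMl.
pose D := 1 + `|beta - theta|.
have D0 : 0 < D by rewrite /D ltr_pwDl.
have gdist s t e : `|s - t| < e / D -> `|gam s - gam t| < e.
  rewrite ltr_pdivlMr// => h; rewrite /gam.
  have -> : theta + s * (beta - theta) - (theta + t * (beta - theta)) =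
    (s - t) * (beta - theta) by ring.
  rewrite normrM; apply: le_lt_trans h; rewrite ler_wpM2l// /D; lra.
(* The only parameter with [gam z = 0]. *)
pose z := - theta / (beta - theta).
have gz s : s != z -> gam s != 0.
  apply: contra => /eqP h; rewrite /z eq_sym -subr_eq0.
  have bt' : beta - theta != 0 by rewrite subr_eq0.
  apply/eqP; apply: (mulIf bt'); rewrite mul0r mulrBl divfK//; move: h; rewrite /gam; lra.
have g1 : gam 1 = beta by rewrite /gam; ring.
have z1 : 1 != z.
  apply/eqP => z1; have bt' : beta - theta != 0 by rewrite subr_eq0.
  have : 1 * (beta - theta) = - theta by rewrite z1 /z divfK.
  by move=> h; move/eqP: b_neq0; apply; lra.
have [e1 e10 near0] := solution_zero_near_bifurcation d0 w0 sinL Aw.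
have [d1 d10 hd1] := cvg_within0 cont0 e10.
pose p s := phi (gam s) (L / d%:R) == 0.
have pE : p 1 = (phi beta (L / d%:R) == 0) by rewrite /p g1.
rewrite -pE.
pose e2 := Num.min e1 d1; have e20 : 0 < e2 by rewrite lt_min e10.
have gam0 : gam 0 = theta by rewrite /gam; ring.
have start s : 0 < s <= 1 -> s != z -> `|s| < e2 / D -> p s = (sin (w * (L / d%:R)) == 0).
  move=> s01 sz; rewrite -[s in `|s|]subr0 => /gdist; rewrite gam0 lt_min => /andP[h1 h2].
  exact: (near0 _ _ (solI _ (gI _ s01) (gz _ sz)) h1 (hd1 _ (gI _ s01) h2)).
have one01 : 0 < (1 : R) <= 1 by rewrite ltr01 lexx.
apply: (fun h => locally_constant_punctured h (divr_gt0 e20 D0) start one01 z1).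
move=> t /andP[t0 t1]; have [t00|tn0] := eqVneq t 0.
  exists (e2 / D); first by rewrite divr_gt0.
  by exists (sin (w * (L / d%:R)) == 0) => s s01 sz; rewrite t00 subr0; exact: start.
have It : I (gam t) by apply: gI; rewrite lt_neqAle eq_sym tn0 t0.
have [eta eta0 stab] := solution_zero_locally_stable (gam t) d0 (XI _ It).
have [del del0 hdel] := cvg_within0 (contI _ It) eta0.
pose e3 := Num.min eta del; have e30 : 0 < e3 by rewrite lt_min eta0.
have e3D : 0 < e3 / D by rewrite divr_gt0.
have t01 : 0 <= t <= 1 by rewrite t0.
have [s0 [s01 sz0 st0]] := punctured_unit_point z t01 e3D.
exists (e3 / D) => //; exists (p s0) => s s1 sz st.
have key u v : 0 < u <= 1 -> u != z -> `|u - t| < e3 / D ->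
    0 < v <= 1 -> v != z -> `|v - t| < e3 / D -> p u -> p v.
  move=> u1 uz /gdist; rewrite lt_min => /andP[ut1 ut2] v1 vz /gdist.
  rewrite lt_min => /andP[vt1 vt2] /eqP pu; apply/eqP.
  have Iu := gI u u1; have Iv := gI v v1.
  exact: (stab _ _ _ _ (solI _ Iu (gz u uz)) (solI _ Iv (gz v vz)) ut1 vt1
    (hdel _ Iu ut2) (hdel _ Iv vt2) pu).
by apply/idP/idP; exact: key.
Qed.

(** The meeting parameter may be [0], where nothing is known to be a solution. Each family is
    therefore sampled at a nearby nonzero parameter, and stability around the common value carries
    the zero at [L / d] from one to the other. *)
Lemma bifurcating_families_zero theta th1 th2 w1 w2 (I1 I2 : set R)
    (phi1 phi2 : R -> R -> R[i]) (d : nat) :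
  (0 < d)%N -> 0 < w1 -> sin (w1 * L) = 0 -> A th1 = - w1 ^+ 2 ->
  0 < w2 -> sin (w2 * L) = 0 -> A th2 = - w2 ^+ 2 ->
  bifurcating_family L hbar m lambda g th1 I1 phi1 ->
  bifurcating_family L hbar m lambda g th2 I2 phi2 ->
  I1 theta -> I2 theta -> phi1 theta = phi2 theta ->
  sin (w1 * (L / d%:R)) = 0 -> sin (w2 * (L / d%:R)) = 0.
Proof.
move=> d0 w10 s1 A1 w20 s2 A2 fam1 fam2 It1 It2 e12 h1.
have [[itv1 n1 cl1] X1' sol1 cont1 _] := fam1.
have [[itv2 n2 cl2] X2' sol2 cont2 _] := fam2.
have [eta eta0 stab] := solution_zero_locally_stable theta d0 (X1' _ It1).
have pick (I : set R) th (phi : R -> R -> R[i]) :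
    bifurcating_family L hbar m lambda g th I phi -> I theta -> phi theta = phi1 theta ->
    exists beta, [/\ I beta, beta != 0, `|beta - theta| < eta &
      X1_norm L (fun x => phi beta x - phi1 theta x) < eta].
  move=> [[itvI nI clI] XI solI contI _] It e.
  have [del del0 hdel] := cvg_within0 (contI _ It) eta0.
  have tth : 0 < `|theta - th|.
    by rewrite normr_gt0 subr_eq0; apply/eqP => h; apply: nI; rewrite -h.
  (* A point of [I] closer to [th] than [theta] is differs from [theta], so it provides a
     nondegenerate segment inside [I] starting at [theta]. *)
  have [c [Ic]] := clI _ (nbhsx_ballx th _ tth); rewrite /ball/= distrC => cth.
  have ct : c - theta != 0 by rewrite subr_eq0; apply: contraTneq cth => ->; rewrite ltxx.
  pose D := 1 + `|c - theta|.
  have D0 : 0 < D by rewrite /D ltr_pwDl.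
  have e0 : 0 < Num.min eta del / D by rewrite divr_gt0// lt_min eta0.
  have z01 : 0 <= (0 : R) <= 1 by rewrite lexx ler01.
  have [s [/andP[sg0 sl1] sz]] := punctured_unit_point (- theta / (c - theta)) z01 e0.
  rewrite subr0 ltr_pdivlMr// => sD.
  have sd : `|theta + s * (c - theta) - theta| < Num.min eta del.
    rewrite addrC addKr normrM; apply: le_lt_trans sD; rewrite ler_wpM2l// /D; lra.
  move: sd; rewrite lt_min => /andP[sd1 sd2].
  have Is : I (theta + s * (c - theta)).
    have [h|h] := leP theta c.
      apply: (itvI _ _ It Ic); rewrite lerDl mulr_ge0 ?subr_ge0//=; last exact: ltW.
      by rewrite -lerBrDl ler_piMl// subr_ge0.
    apply: (itvI _ _ Ic It); rewrite -lerBlDl gerDl.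
    by rewrite ler_niMl ?subr_le0 ?(ltW h)//= nmulr_lle0 ?subr_lt0// ltW.
  exists (theta + s * (c - theta)); split => //.
    apply: contra sz => /eqP h; apply/eqP; apply: (mulIf ct); rewrite divfK//; lra.
  by rewrite -e; exact: hdel.
have [b1 [Ib1 b10 bt1 bn1]] := pick _ _ _ fam1 It1 erefl.
have [b2 [Ib2 b20 bt2 bn2]] := pick _ _ _ fam2 It2 (esym e12).
have P1 := bifurcating_family_zero d0 w10 s1 A1 fam1 Ib1 b10.
have P2 := bifurcating_family_zero d0 w20 s2 A2 fam2 Ib2 b20.
apply/eqP; rewrite -P2; apply/eqP.
apply: (stab _ _ _ _ (sol1 _ Ib1 b10) (sol2 _ Ib2 b20) bt1 bt2 bn1 bn2).
by apply/eqP; rewrite P1 h1.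
Qed.

End Branches.

(** * Dirichlet eigenfunctions are sines, with simple eigenvalues *)

Section Eigenfunctions.
Context {R : realType}.
Implicit Types (L s w x y : R) (u v : R -> R).

Lemma sinD_nat_pi y (n : nat) : sin (y + n%:R * pi) = (-1) ^+ n * sin y.
Proof.
elim: n => [|n IH]; first by rewrite mul0r addr0 expr0 mul1r.
by rewrite -natr1 mulrDl mul1r addrA sinDpi IH exprS mulN1r mulNr.
Qed.

Lemma sin_eq0_nat y : 0 < y -> sin y = 0 -> exists2 n : nat, (0 < n)%N & y = n%:R * pi.
Proof.
move=> y0 sy; have pi0 := pi_gt0 R.
have /truncn_itv/andP[] : 0 <= y / pi by rewrite divr_ge0 ?ltW.
set n := Num.trunc _; rewrite ler_pdivlMr// ltr_pdivrMr// -natr1 mulrDl mul1r => h1 h2.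
have e : sin (y - n%:R * pi) = 0.
  have := sinD_nat_pi (y - n%:R * pi) n; rewrite subrK sy => /esym/eqP.
  by rewrite mulf_eq0 signr_eq0 => /eqP.
have yE : y = n%:R * pi.
  apply/eqP; rewrite -subr_eq0 eq_le subr_ge0 h1 andbT leNgt; apply/negP => h.
  have : 0 < sin (y - n%:R * pi) by apply: sin_gt0_pi; rewrite h; lra.
  by rewrite e ltxx.
exists n => //; rewrite lt0n; apply/eqP => n0; move: y0; rewrite yE n0 mul0r; lra.
Qed.

(** Rotating the vector of [w u] and [u'] by the angle [w x] gives the constants of motion [k1] and
    [k2], so [w u] is a combination of sine and cosine on the open interval. Continuity extends this
    to the endpoints, and [u 0 = 0] removes the cosine. *)
Lemma dirichlet_eigenfunction_sin L s u : 0 < L -> 0 < s ->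
  dirichlet_eigenfunction L s u ->
  sin (Num.sqrt s * L) = 0 /\
  exists2 C, C != 0 & forall x, 0 <= x <= L -> u x = C * sin (Num.sqrt s * x).
Proof.
move=> L0 s0 [cu du u0 uL [x0 x0L ux0]].
set w := Num.sqrt s; have w0 : 0 < w by rewrite sqrtr_gt0.
have w2 : w ^+ 2 = s by rewrite sqr_sqrtr// ltW.
have d1 x : 0 < x < L -> is_derive x 1 u (u^`()%classic x).
  by move=> /du[h _ _]; rewrite derive1E; exact: derivableP.
have d2 x : 0 < x < L -> is_derive x 1 u^`()%classic (- s * u x).
  move=> /du[_ h e]; have := derivableP h; rewrite -derive1E.
  by move=> /is_derive_eqr; apply; rewrite mulNr -e opprK.
have dw (x : R) : is_derive x 1 (fun y => w * y) (w * 1) by exact: is_derive_scale.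
have ds (x : R) := is_derive_compr (is_derive_sin (w * x)) (dw x).
have dc (x : R) := is_derive_compr (is_derive_cos (w * x)) (dw x).
pose k1 x := w * u x * sin (w * x) + u^`()%classic x * cos (w * x).
pose k2 x := w * u x * cos (w * x) - u^`()%classic x * sin (w * x).
have dk1 x : 0 < x < L -> is_derive x 1 k1 0.
  move=> xL; have h := is_derive_add (is_derive_mul (is_derive_scale w (d1 x xL)) (ds x))
    (is_derive_mul (d2 x xL) (dc x)).
  by apply: (is_derive_eqr h); rewrite -w2; ring.
have dk2 x : 0 < x < L -> is_derive x 1 k2 0.
  move=> xL; have h := is_derive_sub (is_derive_mul (is_derive_scale w (d1 x xL)) (dc x))
    (is_derive_mul (d2 x xL) (ds x)).
  by apply: (is_derive_eqr h); rewrite -w2; ring.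
pose mid := L / 2.
have midL : 0 < mid < L by rewrite /mid; lra.
have cst (k : R -> R) : (forall x, 0 < x < L -> is_derive x 1 k 0) ->
    forall x, 0 < x < L -> k x = k mid.
  move=> dk x /andP[xg0 xlL]; have [h|/ltW h] := leP mid x.
    by apply: is_derive0_eq => // y hy; apply: dk; case/andP: midL; lra.
  by symmetry; apply: is_derive0_eq => // y hy; apply: dk; case/andP: midL; lra.
pose c1 := k1 mid; pose c2 := k2 mid.
have uE x : 0 < x < L -> w * u x = c1 * sin (w * x) + c2 * cos (w * x).
  move=> xL; rewrite /c1 /c2 -(cst _ dk1 x xL) -(cst _ dk2 x xL) /k1 /k2.
  have e : w * u x = w * u x * (cos (w * x) ^+ 2 + sin (w * x) ^+ 2).
    by rewrite cos2Dsin2 mulr1.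
  by rewrite {1}e; ring.
pose F x := c1 * sin (w * x) + c2 * cos (w * x).
have cF : continuous F.
  move=> x; exact: is_derive_continuous
    (is_derive_add (is_derive_scale c1 (ds x)) (is_derive_scale c2 (dc x))).
have [_ cu0 cuL] := (continuous_within_itvP u L0).1 cu.
have e0 : w * u 0 = F 0.
  have h1 : (w * u x) @[x --> 0^'+] --> w * u 0 by apply: cvgM => //; exact: cvg_cst.
  have h2 : F x @[x --> 0^'+] --> F 0 by apply: cvg_at_right_filter; exact: cF.
  apply: (cvg_unique _ h1) => //; apply: (cvg_trans _ h2); apply: near_eq_cvg.
  near=> x; rewrite uE// /F; near: x; apply: filterS2 (nbhs_right_gt 0) (nbhs_right_lt L0).
  by move=> x -> ->.
have eL : w * u L = F L.
  have h1 : (w * u x) @[x --> L^'-] --> w * u L by apply: cvgM => //; exact: cvg_cst.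
  have h2 : F x @[x --> L^'-] --> F L by apply: cvg_at_left_filter; exact: cF.
  apply: (cvg_unique _ h1) => //; apply: (cvg_trans _ h2); apply: near_eq_cvg.
  near=> x; rewrite uE// /F; near: x; apply: filterS2 (nbhs_left_gt L0) (nbhs_left_lt L).
  by move=> x -> ->.
have c20 : c2 = 0 by move: e0; rewrite u0 mulr0 /F mulr0 sin0 cos0; lra.
have uE' x : 0 <= x <= L -> u x = c1 / w * sin (w * x).
  move=> /andP[xg0 xlL]; apply: (mulfI (lt0r_neq0 w0)).
  have -> : w * (c1 / w * sin (w * x)) = c1 * sin (w * x) by field; rewrite gt_eqF.
  have [->|xn0] := eqVneq x 0; first by rewrite e0 /F c20; ring.
  have [->|xnL] := eqVneq x L; first by rewrite eL /F c20; ring.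
  by rewrite uE ?c20; [ring | rewrite !lt_neqAle xg0 xlL xnL eq_sym xn0].
have c1w : c1 / w != 0 by apply: contraNneq ux0 => e; rewrite uE'// e mul0r.
split; last by exists (c1 / w).
have : u L = c1 / w * sin (w * L) by apply: uE'; rewrite lexx ltW.
by rewrite uL => /esym/eqP; rewrite mulf_eq0 (negbTE c1w) => /eqP.
Unshelve. all: by end_near.
Qed.

Lemma dirichlet_eigenvalues_gt0 L (xi : nat -> R) k : dirichlet_eigenvalues L xi ->
  (0 < k)%N -> 0 < xi k.
Proof. by move=> [h1 hm _] k0; apply: (lt_le_trans h1); apply: hm; rewrite /= k0. Qed.

(** Equal eigenvalues would make both eigenfunctions nonzero multiples of the same sine; being
    orthogonal, they would force its norm to be [0], against the normalization. *)
Lemma dirichlet_eigenvalues_neq L (xi : nat -> R) i j : 0 < L ->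
  dirichlet_eigenvalues L xi -> (0 < i)%N -> (0 < j)%N -> i != j -> xi i != xi j.
Proof.
move=> L0 hxi i0 j0 ij; apply/eqP => e.
have xi0 := dirichlet_eigenvalues_gt0 hxi i0.
have xj0 := dirichlet_eigenvalues_gt0 hxi j0.
have [_ _ [f [ef orth _]]] := hxi.
have [_ [C C0 hC]] := dirichlet_eigenfunction_sin L0 xi0 (ef i i0).
have [_ [D D0 hD]] := dirichlet_eigenfunction_sin L0 xj0 (ef j j0).
have cs : continuous (fun x : R => sin (Num.sqrt (xi i) * x)).
  move=> x; have dw : is_derive x 1 (fun y => Num.sqrt (xi i) * y) (Num.sqrt (xi i) * 1).
    exact: is_derive_scale.
  exact: is_derive_continuous (is_derive_compr (is_derive_sin _) dw).
pose S := \int[lebesgue_measure]_(x in `[0, L])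
  (sin (Num.sqrt (xi i) * x) * sin (Num.sqrt (xi i) * x)).
have ip k l a b : (forall x, 0 <= x <= L -> f k x = a * sin (Num.sqrt (xi i) * x)) ->
    (forall x, 0 <= x <= L -> f l x = b * sin (Num.sqrt (xi i) * x)) ->
    inner_product L (f k) (f l) = a * b * S.
  move=> ha hb; rewrite /inner_product /S -RintegralZl//.
    apply: eq_Rintegral => x; rewrite inE/= in_itv/= => xL.
    by rewrite ha// hb//; ring.
  apply: continuous_integrable_itv => x.
  by apply: (@continuousM _ _ (fun x : R => sin (Num.sqrt (xi i) * x)) (fun x : R => sin (Num.sqrt (xi i) * x))); exact: cs.
rewrite -e in hD.
have := orth i j i0 j0; rewrite (negbTE ij) (ip _ _ _ _ hC hD).
have := orth i i i0 i0; rewrite eqxx (ip _ _ _ _ hC hC) => h1 h2.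
have /eqP := h2; rewrite !mulf_eq0 (negbTE C0) (negbTE D0)/= => /eqP S0.
by move: h1; rewrite S0 mulr0 => /esym/eqP; rewrite oner_eq0.
Qed.

End Eigenfunctions.

(** * Branches from different eigenvalues do not meet *)

Section BranchesDisjoint.
Context {R : realType}.
Variables (L hbar m lambda g : R) (xi : nat -> R).
Hypotheses (L0 : 0 < L) (hbar0 : 0 < hbar) (m0 : 0 < m) (g0 : 0 < g).
Hypothesis (hxi : dirichlet_eigenvalues L xi).
Let beta_ := critical_beta hbar m lambda xi.

Lemma critical_beta_scaled k : (0 < k)%N ->
  (beta_ k - hbar * lambda) / (hbar ^+ 2 / (4 * m)) = - Num.sqrt (xi k) ^+ 2.
Proof.
move=> k0; have xk := dirichlet_eigenvalues_gt0 hxi k0.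
rewrite sqr_sqrtr ?ltW// /beta_ /critical_beta.
by field; rewrite ?mulf_neq0 ?gt_eqF.
Qed.

Lemma eigenvalue_sin k : (0 < k)%N -> 0 < Num.sqrt (xi k) /\ sin (Num.sqrt (xi k) * L) = 0.
Proof.
move=> k0; have xk := dirichlet_eigenvalues_gt0 hxi k0; rewrite sqrtr_gt0; split => //.
have [_ _ [f [ef _ _]]] := hxi.
by have [] := dirichlet_eigenfunction_sin L0 xk (ef k k0).
Qed.

(** The divisor [d] is the larger of the two mode numbers: [sin (k pi / l)] is nonzero for
    [0 < k < l], whereas the smaller one may divide the larger and then separates nothing. *)
Lemma bifurcating_families_disjoint i j (I1 I2 : set R) (phi1 phi2 : R -> R -> R[i]%C) theta :
  (0 < i)%N -> (0 < j)%N -> i != j ->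
  bifurcating_family L hbar m lambda g (beta_ i) I1 phi1 ->
  bifurcating_family L hbar m lambda g (beta_ j) I2 phi2 ->
  I1 theta -> I2 theta -> phi1 theta <> phi2 theta.
Proof.
move=> i0 j0 ij fam1 fam2 It1 It2 e12.
have [wi si] := eigenvalue_sin i0; have [wj sj] := eigenvalue_sin j0.
have [ni ni0 ei] := sin_eq0_nat (mulr_gt0 wi L0) si.
have [nj nj0 ej] := sin_eq0_nat (mulr_gt0 wj L0) sj.
have Ai := critical_beta_scaled i0; have Aj := critical_beta_scaled j0.
have pi0 := pi_gt0 R.
have small (k l : nat) : (0 < k)%N -> (k < l)%N -> sin (k%:R * pi / l%:R) != 0 :> R.
  move=> k0 kl; rewrite gt_eqF// sin_gt0_pi// divr_gt0 ?mulr_gt0 ?ltr0n ?(ltn_trans k0 kl)//=.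
  by rewrite ltr_pdivrMr ?ltr0n ?(ltn_trans k0 kl)// mulrC ltr_pM2l// ltr_nat.
have one (k : nat) : (0 < k)%N -> sin (k%:R * pi / k%:R) = 0 :> R.
  by move=> k0; rewrite mulrAC divff ?mul1r ?sinpi// pnatr_eq0 -lt0n.
have [h|h|h] := ltngtP ni nj.
- have := bifurcating_families_zero L0 hbar0 m0 g0 nj0 wj sj Aj wi si Ai fam2 fam1 It2 It1 (esym e12).
  rewrite !mulrA ei ej => /(_ (one _ nj0))/eqP; apply/negP; exact: small.
- have := bifurcating_families_zero L0 hbar0 m0 g0 ni0 wi si Ai wj sj Aj fam1 fam2 It1 It2 e12.
  rewrite !mulrA ei ej => /(_ (one _ ni0))/eqP; apply/negP; exact: small.
have : Num.sqrt (xi i) * L = Num.sqrt (xi j) * L by rewrite ei ej h.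
move=> /(mulIf (lt0r_neq0 L0))/(congr1 (fun t => t ^+ 2)).
have xi0 := dirichlet_eigenvalues_gt0 hxi i0.
have xj0 := dirichlet_eigenvalues_gt0 hxi j0.
rewrite !sqr_sqrtr ?ltW// => e; move: (dirichlet_eigenvalues_neq L0 hxi i0 j0 ij).
by rewrite e eqxx.
Qed.

End BranchesDisjoint.

(** * Phase description of the real oscillator [u'' = - a u - b u ^ 3] *)

Section Pendulum.
Context {R : realType}.
Implicit Types (a s t x y : R).

(** With [u = A sin t], conservation of [u' ^ 2 + a u ^ 2 + b u ^ 4 / 2] carries a factor
    [A ^ 2 cos ^ 2 t]; cancelling it leaves this speed with [s = b A ^ 2 / 2], which is regular also
    at the turning points. *)
Definition phase_speed a s t : R := Num.sqrt (a + s * (1 + sin t ^+ 2)).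

Lemma phase_speed_arg a s t : 0 < a -> 0 <= s ->
  a <= a + s * (1 + sin t ^+ 2) <= a + 2 * s.
Proof.
move=> a0 s0; have h0 := sqr_ge0 (sin t).
have h1 : sin t ^+ 2 <= 1 by have := cos2Dsin2 t; have := sqr_ge0 (cos t); lra.
nra.
Qed.

Lemma phase_speed_gt0 a s t : 0 < a -> 0 <= s -> 0 < phase_speed a s t.
Proof. by move=> a0 s0; rewrite sqrtr_gt0; have := phase_speed_arg t a0 s0; lra. Qed.

Lemma is_derive_phase_speed a s t : 0 < a -> 0 <= s ->
  is_derive t 1 (phase_speed a s) (s * (sin t * cos t) / phase_speed a s t).
Proof.
move=> a0 s0; have p0 : 0 < a + s * (1 + sin t ^+ 2) by have := phase_speed_arg t a0 s0; lra.
have ds := is_derive_sin t.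
have d1 : is_derive t 1 (fun y => a + s * (1 + sin y * sin y))
    (0 + s * (0 + (cos t * sin t + sin t * cos t))).
  have dk (k : R) : is_derive t 1 (fun=> k) 0 by exact: is_derive_cst.
  exact: (is_derive_add (dk a) (is_derive_scale s
    (is_derive_add (dk 1) (is_derive_mul ds ds)))).
have p0' : 0 < a + s * (1 + sin t * sin t) by rewrite -expr2.
have := @is_derive_compr _ Num.sqrt (fun y => a + s * (1 + sin y * sin y)) t _ _
  (is_derive1_sqrt p0') d1.
move=> h; apply: (is_derive_eqr h); rewrite /phase_speed -expr2.
have : Num.sqrt (a + s * (1 + sin t ^+ 2)) != 0 by rewrite gt_eqF// sqrtr_gt0.
move: (Num.sqrt _) => q q0; by field.
Qed.

(** The squared speeds differ by at most [2 |s - s'|], and both speeds are at least the square root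
    of [a]. *)
Lemma phase_speed_lipschitz a s s' t : 0 < a -> 0 <= s -> 0 <= s' ->
  (phase_speed a s t)^-1 - (phase_speed a s' t)^-1 <= 2 / (a * Num.sqrt a) * `|s - s'|.
Proof.
move=> a0 s0 s'0.
have p0 := phase_speed_gt0 t a0 s0; have p'0 := phase_speed_gt0 t a0 s'0.
have r0 : 0 < Num.sqrt a by rewrite sqrtr_gt0.
have r2 : Num.sqrt a ^+ 2 = a by rewrite sqr_sqrtr// ltW.
have ps : phase_speed a s t ^+ 2 = a + s * (1 + sin t ^+ 2).
  by rewrite sqr_sqrtr//; have := phase_speed_arg t a0 s0; lra.
have ps' : phase_speed a s' t ^+ 2 = a + s' * (1 + sin t ^+ 2).
  by rewrite sqr_sqrtr//; have := phase_speed_arg t a0 s'0; lra.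
have rp : Num.sqrt a <= phase_speed a s t.
  by rewrite ler_wsqrtr//; have := phase_speed_arg t a0 s0; lra.
have rp' : Num.sqrt a <= phase_speed a s' t.
  by rewrite ler_wsqrtr//; have := phase_speed_arg t a0 s'0; lra.
have c1 : sin t ^+ 2 <= 1 by have := cos2Dsin2 t; have := sqr_ge0 (cos t); lra.
have c0 := sqr_ge0 (sin t).
set p := phase_speed a s t in p0 ps rp *; set p' := phase_speed a s' t in p'0 ps' rp' *.
set r := Num.sqrt a in r0 r2 rp rp' *.
have -> : p^-1 - p'^-1 = (p' - p) / (p * p') by field; rewrite !gt_eqF.
have D0 : 0 <= `|s - s'| by [].
have num : (p' - p) * r <= 2 * `|s - s'|.
  have [pp|pp] := leP p' p.
    by apply: (@le_trans _ _ 0); [rewrite mulr_le0_ge0 ?subr_le0 ?(ltW r0) | rewrite mulr_ge0].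
  have h1 : (p' - p) * r <= (p' - p) * (p' + p) by rewrite ler_wpM2l; lra.
  have h2 : (p' - p) * (p' + p) = (s' - s) * (1 + sin t ^+ 2).
    by transitivity (p' ^+ 2 - p ^+ 2); [ring | rewrite ps ps'; ring].
  have h3 : (s' - s) * (1 + sin t ^+ 2) <= `|s - s'| * 2.
    apply: (@le_trans _ _ (`|s - s'| * (1 + sin t ^+ 2))).
      by rewrite ler_wpM2r ?addr_ge0// distrC ler_norm.
    by rewrite ler_wpM2l//; lra.
  lra.
have pp : a <= p * p' by rewrite -r2 expr2 ler_pM ?(ltW r0).
rewrite ler_pdivrMr ?mulr_gt0//.
have -> : 2 / (a * r) * `|s - s'| * (p * p') = (2 * `|s - s'|) / r * (p * p' / a).
  by field; rewrite !gt_eqF.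
have h1 : p' - p <= (2 * `|s - s'|) / r by rewrite ler_pdivlMr.
apply: (le_trans h1); rewrite ler_peMr//; first by rewrite divr_ge0 ?mulr_ge0// ltW.
by rewrite ler_pdivlMr// mul1r.
Qed.

(* [X s] is the primitive of [1 / phase_speed a s] vanishing at [0]: the position
   as a function of the phase. *)
Lemma phase_position_exists a : 0 < a -> exists X : R -> R -> R, forall s, 0 <= s ->
  X s 0 = 0 /\ forall t : R, is_derive t 1 (X s) (phase_speed a s t)^-1.
Proof.
move=> a0; suff /choice[X hX] : forall s, exists F : R -> R, 0 <= s ->
    F 0 = 0 /\ forall t : R, is_derive t 1 F (phase_speed a s t)^-1 by exists X.
move=> s; have [s0|s0] := boolP (0 <= s); last by exists id.
have c : continuous (fun t => (phase_speed a s t)^-1).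
  move=> t; apply: cvgV; first by rewrite gt_eqF// phase_speed_gt0.
  exact: is_derive_continuous (is_derive_phase_speed t a0 s0).
by have [F hF] := is_derive_primitive c; exists F.
Qed.

Section Position.
Variables (a : R) (X : R -> R -> R).
Hypothesis (a0 : 0 < a).
Hypothesis hX : forall s, 0 <= s ->
  X s 0 = 0 /\ forall t : R, is_derive t 1 (X s) (phase_speed a s t)^-1.

Lemma phase_position_lipschitz s s' T : 0 <= s -> 0 <= s' -> 0 <= T ->
  X s T - X s' T <= 2 / (a * Num.sqrt a) * `|s - s'| * T.
Proof.
move=> s0 s'0 T0; have [X0 dX] := hX s0; have [X'0 dX'] := hX s'0.
pose C := 2 / (a * Num.sqrt a) * `|s - s'|.
have := @is_derive_ge0_le _ (fun t => C * t - (X s t - X s' t))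
  (fun t => C * 1 - ((phase_speed a s t)^-1 - (phase_speed a s' t)^-1)) 0 T T0.
rewrite X0 X'0 mulr0 !subrr subr_ge0; apply => t _.
by rewrite mulr1 subr_ge0; exact: phase_speed_lipschitz.
Qed.

Lemma phase_position_bounds s T : 0 <= s -> 0 <= T ->
  T / Num.sqrt (a + 2 * s) <= X s T <= T / Num.sqrt (a + s).
Proof.
move=> s0 T0; have a1 : 0 < a := a0; have [X0 dX] := hX s0; apply/andP; split; rewrite [T / _]mulrC.
- have := @is_derive_ge0_le _ (fun t => X s t - (Num.sqrt (a + 2 * s))^-1 * t)
    (fun t => (phase_speed a s t)^-1 - (Num.sqrt (a + 2 * s))^-1 * 1) 0 T T0.
  rewrite X0 mulr0 subrr subr_ge0; apply => t _.
  rewrite mulr1 subr_ge0 lef_pV2 ?posrE ?phase_speed_gt0 ?sqrtr_gt0//; last by lra.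
  by rewrite ler_wsqrtr//; have := phase_speed_arg t a0 s0; lra.
- have := @is_derive_ge0_le _ (fun t => (Num.sqrt (a + s))^-1 * t - X s t)
    (fun t => (Num.sqrt (a + s))^-1 * 1 - (phase_speed a s t)^-1) 0 T T0.
  rewrite X0 mulr0 subrr subr_ge0; apply => t _.
  rewrite mulr1 subr_ge0 lef_pV2 ?posrE ?phase_speed_gt0 ?sqrtr_gt0//; last by lra.
  rewrite ler_wsqrtr//; have := mulr_ge0 s0 (sqr_ge0 (sin t)); lra.
Qed.

Lemma phase_position_increasing s t t' : 0 <= s -> t < t' -> X s t < X s t'.
Proof.
move=> s0 tt'; have [_ dX] := hX s0; apply: (is_derive_pos_lt tt' dX) => y _.
by rewrite invr_gt0 phase_speed_gt0.
Qed.

(** The slope of [X s] is at least [c > 0], so [X s] is a bijection of the line; its inverse is the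
    phase as a function of the position. *)
Lemma phase_position_inverse s : 0 <= s ->
  exists th : R -> R, cancel (X s) th /\ cancel th (X s) /\
    forall x, is_derive x 1 th (phase_speed a s (th x)).
Proof.
move=> s0; have a1 : 0 < a := a0; have [X0 dX] := hX s0.
pose c := (Num.sqrt (a + 2 * s))^-1.
have c0 : 0 < c by rewrite invr_gt0 sqrtr_gt0; lra.
have cX : continuous (X s) by move=> t; exact: is_derive_continuous (dX t).
have low (t t' : R) : t <= t' -> c * (t' - t) <= X s t' - X s t.
  move=> tt'; have := @is_derive_ge0_le _ (fun t => X s t - c * t)
    (fun t => (phase_speed a s t)^-1 - c * 1) t t' tt'.
  move=> h; have {}h : X s t - c * t <= X s t' - c * t'; last by lra.
  apply: h => y _; rewrite mulr1 subr_ge0 lef_pV2 ?posrE ?phase_speed_gt0 ?sqrtr_gt0//; last by lra.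
  by rewrite ler_wsqrtr//; have := phase_speed_arg y a0 s0; lra.
have surj x : exists t, X s t = x.
  pose M := `|x| / c; have M0 : 0 <= M by rewrite /M divr_ge0// ltW.
  have MM : - M <= M by lra.
  have cM : c * M = `|x| by rewrite /M mulrC divfK// gt_eqF.
  have h1 := low _ _ M0; have h2 : - M <= 0 by lra.
  have {}h2 := low _ _ h2; rewrite X0 in h1 h2.
  have [|t _ ht] := @IVT _ (X s) (- M) M x MM (continuous_subspaceT cX); last by exists t.
  rewrite ge_min le_max; have := ler_norm x; have := ler_norm (- x); rewrite normrN.
  by move=> n1 n2; apply/andP; split; apply/orP; [left|right]; lra.
have [th hth] := choice surj.
have inj : injective (X s).
  move=> t t' e; apply/eqP; case: (ltgtP t t') => // /(phase_position_increasing s0); rewrite e ltxx//.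
have K1 : cancel (X s) th by move=> t; apply: inj; rewrite hth.
exists th; split => //; split => // x.
have sp := phase_speed_gt0 (th x) a0 s0.
have := @is_derive_inverse _ (X s) th _ (th x) _ _ (dX (th x)) _.
rewrite hth invrK; apply.
- by apply/nbhs_ballP; exists 1 => //= t _; exact: K1.
- by apply/nbhs_ballP; exists 1 => //= t _; exact: cX.
- by rewrite invr_eq0 gt_eqF.
Qed.

End Position.
End Pendulum.

(** * Solutions of the real oscillator with a prescribed final phase *)

Section ImaginarySolutions.
Context {R : realType}.
Implicit Types (a b L s x y : R).

Lemma lipschitz_continuous (f : R -> R) (C : R) :
  (forall x y, f x - f y <= C * `|x - y|) -> continuous f.
Proof.
move=> hf x; apply/cvgrPdist_lt => e e0.
have C0 : 0 < `|C| + 1 by rewrite ltr_wpDl.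
apply/nbhs_ballP; exists (e / (`|C| + 1)); first by rewrite /= divr_gt0.
move=> y; rewrite /ball/= ltr_pdivlMr// => xy.
have le (u v : R) : f u - f v <= `|u - v| * (`|C| + 1).
  apply: (le_trans (hf u v)); rewrite mulrC ler_wpM2l// (le_trans (ler_norm C))//.
  by rewrite lerDl.
apply: le_lt_trans xy; rewrite ler_norml; apply/andP; split; last exact: le.
by rewrite lerNl opprB distrC; exact: le.
Qed.

Lemma clip0_dist (x y : R) : `|Num.max x 0 - Num.max y 0| <= `|x - y|.
Proof.
have h := ler_norm (x - y); have h' := ler_norm (y - x); rewrite distrC in h'.
have h0 := normr_ge0 (x - y); rewrite ler_norml.
by case: (leP x 0); case: (leP y 0) => *; apply/andP; split; lra.
Qed.

(** For [s = 0] the phase [T] is reached beyond [L], for [s = (T / L) ^+ 2] at [L] or before; the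
    intermediate value theorem applies in between. The parameter is clipped at [0] because [X] is
    specified only for [0 <= s]. *)
Lemma phase_length a (X : R -> R -> R) L T : 0 < a ->
  (forall s, 0 <= s ->
    X s 0 = 0 /\ forall t : R, is_derive t 1 (X s) (phase_speed a s t)^-1) ->
  0 < L -> L * Num.sqrt a < T -> exists2 s, 0 < s & X s T = L.
Proof.
move=> a0 hX L0 LT.
have r0 : 0 < Num.sqrt a by rewrite sqrtr_gt0.
have T0 : 0 < T by apply: lt_trans LT; rewrite mulr_gt0.
pose S := (T / L) ^+ 2; have S0 : 0 < S by rewrite exprn_gt0// divr_gt0.
pose f s := X (Num.max s 0) T.
have m0 s : 0 <= Num.max s 0 by rewrite le_max lexx orbT.
pose C := 2 / (a * Num.sqrt a).
have C0 : 0 <= C by rewrite /C divr_ge0 ?mulr_ge0 ?(ltW r0) ?(ltW a0).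
have cf : continuous f.
  apply: (@lipschitz_continuous _ (C * T)) => x y.
  apply: (le_trans (phase_position_lipschitz a0 hX (m0 x) (m0 y) (ltW T0))).
  rewrite -/C -[C * T * _]mulrAC ler_wpM2r ?(ltW T0)// ler_wpM2l//; exact: clip0_dist.
have f0 : L < f 0.
  have /andP[h _] := phase_position_bounds a0 hX (m0 0) (ltW T0).
  apply: lt_le_trans h; rewrite maxxx mulr0 addr0 ltr_pdivlMr//.
have fS : f S <= L.
  have /andP[_ h] := phase_position_bounds a0 hX (m0 S) (ltW T0).
  apply: (le_trans h); rewrite max_l ?(ltW S0)//.
  rewrite ler_pdivrMr ?sqrtr_gt0; last by lra.
  rewrite -ler_pdivrMl// mulrC.
  have -> : T / L = Num.sqrt S by rewrite /S sqrtr_sqr ger0_norm// divr_ge0 ?ltW.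
  by rewrite ler_wsqrtr//; lra.
have [|s] := @IVT _ f 0 S L (ltW S0) (continuous_subspaceT cf).
  by rewrite ge_min le_max fS (ltW f0) orbT.
rewrite in_itv/= => /andP[s0 _] fs.
have sn0 : s != 0 by apply: contraTneq f0 => e; rewrite -e fs ltxx.
have s_gt0 : 0 < s by rewrite lt_neqAle eq_sym sn0.
by exists s => //; rewrite -fs /f max_l.
Qed.

(* With [w = A sin th] and [th' = phase_speed a s th], the energy identity forces
   [s = b A^2 / 2]. *)
Lemma phase_amplitude a b L (X : R -> R -> R) T : 0 < a -> 0 < b -> 0 < L ->
  (forall s, 0 <= s ->
    X s 0 = 0 /\ forall t : R, is_derive t 1 (X s) (phase_speed a s t)^-1) ->
  L * Num.sqrt a < T -> pi / 2 <= T -> sin T = 0 ->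
  exists A (f f' : R -> R), [/\ 0 < A,
    forall x, is_derive x 1 f (f' x),
    forall x, is_derive x 1 f' (- a * f x - b * f x ^+ 3),
    f 0 = 0 /\ f L = 0 &
    [/\ forall x, f x <= A, exists2 x, 0 <= x <= L & f x = A & X (b * A ^+ 2 / 2) T = L]].
Proof.
move=> a0 b0 L0 hX LT piT sT.
have [s s0 Xs] := phase_length a0 hX L0 LT.
have [th [K1 [K2 dth]]] := phase_position_inverse a0 hX (ltW s0).
have [X0 _] := hX s (ltW s0).
pose A := Num.sqrt (2 * s / b).
have A2 : A ^+ 2 = 2 * s / b by rewrite sqr_sqrtr// divr_ge0 ?mulr_ge0 ?ltW.
have A0 : 0 < A by rewrite sqrtr_gt0 divr_gt0 ?mulr_gt0.
have th0 : th 0 = 0 by rewrite -X0 K1.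
have thL : th L = T by rewrite -Xs K1.
pose G := phase_speed a s.
have dsin x : is_derive x 1 (fun y => sin (th y)) (cos (th x) * G (th x)).
  exact: is_derive_compr (is_derive_sin _) (dth x).
have dcos x : is_derive x 1 (fun y => cos (th y)) (- sin (th x) * G (th x)).
  exact: is_derive_compr (is_derive_cos _) (dth x).
have dG x : is_derive x 1 (fun y => G (th y))
    (s * (sin (th x) * cos (th x)) / G (th x) * G (th x)).
  exact: is_derive_compr (is_derive_phase_speed _ a0 (ltW s0)) (dth x).
exists A, (fun x => A * sin (th x)), (fun x => A * (cos (th x) * G (th x))); split => //.
- by move=> x; exact: is_derive_scale.
- move=> x; apply: (is_derive_eqr (is_derive_scale A (is_derive_mul (dcos x) (dG x)))).
  have G0 : G (th x) != 0 by rewrite gt_eqF// phase_speed_gt0// ltW.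
  have G2 : G (th x) ^+ 2 = a + s * (1 + sin (th x) ^+ 2).
    by rewrite sqr_sqrtr//; have := phase_speed_arg (th x) a0 (ltW s0); lra.
  have c2 : cos (th x) ^+ 2 = 1 - sin (th x) ^+ 2 by have := cos2Dsin2 (th x); lra.
  have bA : b * A ^+ 2 = 2 * s by rewrite A2; field; rewrite gt_eqF.
  transitivity (A * (- sin (th x) * G (th x) ^+ 2 + s * sin (th x) * cos (th x) ^+ 2)).
    by field.
  rewrite G2 c2.
  transitivity (- a * (A * sin (th x)) - A * (2 * s) * sin (th x) ^+ 3); first by ring.
  by rewrite -bA; ring.
- by rewrite th0 thL sin0 sT mulr0.
- split.
  + by move=> x; rewrite ler_piMr ?sin_le1// ltW.
  (* The amplitude is attained at phase [pi / 2], reached inside [[0, L]] because [pi / 2 <= T]. *)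
  + exists (X s (pi / 2)); last by rewrite K1 sin_pihalf mulr1.
    have pi0 := pi_gt0 R; have p2 : 0 < pi / 2 :> R by lra.
    apply/andP; split; first by rewrite -X0 ltW// (phase_position_increasing a0 hX (ltW s0)).
    have [e|h] := eqVneq (pi / 2) T; first by rewrite e Xs.
    by rewrite -Xs ltW// (phase_position_increasing a0 hX (ltW s0))// lt_neqAle h.
  + by rewrite A2 (_ : b * (2 * s / b) / 2 = s)//; field; rewrite gt_eqF.
Qed.

End ImaginarySolutions.

(** * Imaginary solutions of the boundary value problem *)

Section ManySolutions.
Context {R : realType}.
Local Open Scope complex_scope.
Variables (L hbar m lambda g : R) (beta : R).
Hypotheses (L_gt0 : 0 < L) (hbar_gt0 : 0 < hbar) (m_gt0 : 0 < m) (g_gt0 : 0 < g).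
Local Notation mu := (@lebesgue_measure R).

Let kap := hbar ^+ 2 / (4 * m).
Let a := - ((beta - hbar * lambda) / kap).
Let b := g / kap.

Let kap_gt0 : 0 < kap.
Proof. by rewrite /kap divr_gt0 ?exprn_gt0 ?mulr_gt0. Qed.

Definition imaginary_extension (f : R -> R) : R -> R[i] :=
  fun x => if 0 < x < L then 0 +i* f x else 0.

Lemma imaginary_extension_solution (f f' : R -> R) :
  (forall x : R, is_derive x 1 f (f' x)) ->
  (forall x : R, is_derive x 1 f' (- a * f x - b * f x ^+ 3)) ->
  f 0 = 0 -> f L = 0 -> (exists2 x, 0 <= x <= L & f x != 0) ->
  nontrivial_solution L hbar m lambda g beta (imaginary_extension f).
Proof.
move=> df df' f0 fL [x0 x0L fx0].
have cf : continuous f by move=> x; exact: is_derive_continuous (df x).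
have cf' : continuous f' by move=> x; exact: is_derive_continuous (df' x).
pose f2 x := - a * f x - b * f x ^+ 3.
have cf2 : continuous f2.
  move=> x; apply: cvgB; first by apply: cvgM; [exact: cvg_cst | exact: cf].
  apply: cvgM; first exact: cvg_cst.
  rewrite (_ : (fun y => f y ^+ 3) = fun y => f y * (f y * f y)).
    by rewrite exprS expr2; apply: cvgM; [exact: cf | apply: cvgM; exact: cf].
  by apply/funext => y; rewrite exprS expr2.
set phi := imaginary_extension f.
have rE : re_part phi = fun=> 0.
  by apply/funext => x; rewrite /re_part /phi /imaginary_extension; case: ifP.
have iE x : 0 < x < L -> im_part phi x = f x.
  by move=> h; rewrite /im_part /phi /imaginary_extension h.
(* Because [f] vanishes at both ends, cutting it off outside [(0, L)] amounts to composing it with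
   the clamp onto [[0, L]], which gives continuity on the line. *)
have iC : im_part phi = fun x => f (Num.min L (Num.max 0 x)).
  apply/funext => x; have [/andP[xg xl]|] := boolP (0 < x < L).
    by rewrite iE ?xg// max_r ?(ltW xg)// min_r// ltW.
  move=> h; rewrite /im_part /phi /imaginary_extension (negbTE h)/=.
  move: h; rewrite negb_and -!leNgt => /orP[h|h]; first by rewrite max_l// min_r ?f0 ?ltW.
  by rewrite max_r ?(le_trans (ltW L_gt0) h)// min_l// fL.
have clamp_cont : continuous (fun y : R => Num.min L (Num.max 0 y)).
  by apply: (@lipschitz_continuous _ _ 1) => x y; rewrite mul1r clip_le.
have [w1 w2] := (weak_derivative_smooth L_gt0 df cf', weak_derivative_smooth L_gt0 df' cf2).
have Lf := L2_continuous L cf.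
have Li : L2 L (im_part phi) by apply: (L2_eq Lf) => x h; rewrite iE.
have aeT (h k : R -> R) : (forall x, 0 < x < L -> h x = k x) ->
    {ae mu, forall x, 0 < x < L -> h x = k x}.
  by move=> hk; apply: (@ae_imp _ (fun=> True)); [exact: aeW | move=> x _; exact: hk].
have w1' : is_weak_derivative L (im_part phi) f'.
  apply: (weak_derivative_ae_eq Lf Li (weak_derivative_L2 w1) _ _ w1); last exact: aeT.
  by apply: aeT => x h; rewrite iE.
have [Hi ei1 ei2] := H2I Li w1' w2.
have c0 : continuous (fun _ : R => 0 : R) by move=> x; exact: cvg_cst.
have wd0 : is_weak_derivative L (fun _ : R => 0 : R) (fun=> 0).
  by apply: weak_derivative_smooth => // x; exact: is_derive_cst.
have [Hr er1 er2] := H2I (L2_continuous L c0) wd0 wd0.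
split.
  split.
    split.
    - by rewrite rE.
    - exact: Hi.
    - by rewrite rE.
    - rewrite iC => x; exact: (continuous_comp (clamp_cont x) (cf _)).
    - by move=> x h; rewrite /phi /imaginary_extension (negbTE h).
  apply: (ae_imp2 er2 ei2) => x hr hi xL; rewrite /wderiv2C rE hr// hi//.
  rewrite /phi /imaginary_extension xL.
  have kn0 : kap != 0 by rewrite gt_eqF.
  have e : kap * f2 x = (beta - hbar * lambda) * f x - g * f x ^+ 3.
    by rewrite /f2 /a /b; field.
  have -> : - kap%:C * (0 +i* f2 x) = 0 +i* (- (kap * f2 x)) by apply/eqP; rewrite eq_complex /=; apply/andP; split; apply/eqP; ring.
  rewrite e; apply/eqP; rewrite eq_complex !exprS expr0 /=.
  by apply/andP; split; apply/eqP; ring.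
have x0g : 0 < x0 < L.
  case/andP: x0L => h1 h2; rewrite !lt_neqAle h1 h2 !andbT eq_sym.
  by apply/andP; split; apply: contraNneq fx0 => ->; rewrite ?f0 ?fL.
exists x0 => //; rewrite /phi /imaginary_extension x0g eq_complex /=.
by rewrite negb_and fx0 orbT.
Qed.

(** The final phases [(K + n) pi] are distinct multiples of [pi] above the threshold [L] times the
    square root of [a]. A solution determines its amplitude as its maximum, the amplitude determines
    [s], and the strictly increasing [X s] takes the value [L] at one phase only; so different [n]
    give different solutions. *)
Lemma many_imaginary_solutions (N : nat) : 0 < a ->
  exists phi : 'I_N -> R -> R[i],
    injective phi /\ forall n, nontrivial_solution L hbar m lambda g beta (phi n).
Proof.
move=> a0; have pi0 := pi_gt0 R.
have b0 : 0 < b by rewrite /b divr_gt0.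
have [X hX] := phase_position_exists a0.
pose K := (Num.trunc (L * Num.sqrt a / pi)).+1.
pose T n : R := (K + n)%:R * pi.
have K1 : L * Num.sqrt a < K%:R * pi by rewrite -ltr_pdivrMr//; exact: truncnS_gt.
have LT n : L * Num.sqrt a < T n.
  by apply: (lt_le_trans K1); rewrite ler_wpM2r ?(ltW pi0)// ler_nat leq_addr.
have piT n : pi / 2 <= T n.
  apply: (@le_trans _ _ (1 * pi)); first by lra.
  by rewrite ler_wpM2r ?(ltW pi0)// ler1n addSn.
have sT n : sin (T n) = 0 by have := sinD_nat_pi (0 : R) (K + n); rewrite add0r sin0 mulr0.
pose Q n (t : R * (R -> R) * (R -> R)) := [/\ 0 < t.1.1,
    forall x : R, is_derive x 1 t.1.2 (t.2 x),
    forall x : R, is_derive x 1 t.2 (- a * t.1.2 x - b * t.1.2 x ^+ 3),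
    t.1.2 0 = 0 /\ t.1.2 L = 0 &
    [/\ forall x, t.1.2 x <= t.1.1, exists2 x, 0 <= x <= L & t.1.2 x = t.1.1 &
        X (b * t.1.1 ^+ 2 / 2) (T n) = L]].
have /choice[S hS] : forall n, exists t, Q n t.
  move=> n; have [A [f [f' h]]] := phase_amplitude a0 b0 L_gt0 hX (LT n) (piT n) (sT n).
  by exists (A, f, f').
pose F n := (S n).1.2; pose A n := (S n).1.1.
have P n : [/\ 0 < A n, F n 0 = 0, F n L = 0, forall x, F n x <= A n &
    (exists2 x, 0 <= x <= L & F n x = A n) /\ X (b * A n ^+ 2 / 2) (T n) = L].
  by have [? _ _ [? ?] [? ? ?]] := hS n.
exists (fun n => imaginary_extension (F n)); split; last first.
  move=> n; have [An0 df df' [f0 fL] [_ [x xL fx] _]] := hS n.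
  apply: (imaginary_extension_solution df df' f0 fL); exists x => //.
  by rewrite fx gt_eqF.
have Ale n n' : imaginary_extension (F n) = imaginary_extension (F n') -> A n <= A n'.
  move=> e; have [_ f0 fL _ [[x /andP[xg xl] <-] _]] := P n; have [_ f0' fL' le' _] := P n'.
  suff -> : F n x = F n' x by exact: le'.
  (* The extensions retain only the values inside [(0, L)]; at the ends both functions are [0]. *)
  have [->|xn0] := eqVneq x 0; first by rewrite f0 f0'.
  have [->|xnL] := eqVneq x L; first by rewrite fL fL'.
  have := congr1 (fun h : R -> R[i] => complex.Im (h x)) e; rewrite /imaginary_extension.
  by rewrite !lt_neqAle xg xl xnL eq_sym xn0.
move=> n n' e; have eA : A n = A n' by apply/eqP; rewrite eq_le !Ale.
have [An0 _ _ _ [_ h1]] := P n; have [_ _ _ _ [_ h2]] := P n'.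
have s0 : 0 <= b * A n ^+ 2 / 2 by rewrite divr_ge0// mulr_ge0 ?sqr_ge0// ltW.
rewrite -eA in h2.
have eT : T n = T n'.
  apply/eqP; case: (ltgtP (T n) (T n')) => // /(phase_position_increasing a0 hX s0).
    by rewrite h1 h2 ltxx.
  by rewrite h1 h2 ltxx.
apply/val_inj/eqP; move: eT => /(mulIf (lt0r_neq0 pi0))/eqP.
by rewrite eqr_nat eqn_add2l.
Qed.

End ManySolutions.

Unset Implicit Arguments.

Theorem theorem4p4 (R : realType) (L hbar m lambda g : R) (xi : nat -> R)
    (L_gt0 : 0 < L) (hbar_gt0 : 0 < hbar) (m_gt0 : 0 < m) (g_gt0 : 0 < g)
    (xiP : dirichlet_eigenvalues L xi) :
  let beta_ := critical_beta hbar m lambda xi in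
  (forall (i j : nat) (I_i I_j : set R) (phi_i phi_j : R -> R -> complex R),
     (0 < i)%N -> (0 < j)%N -> i != j ->
     bifurcation_point L hbar m lambda g (beta_ i) ->
     bifurcation_point L hbar m lambda g (beta_ j) ->
     bifurcating_family L hbar m lambda g (beta_ i) I_i phi_i ->
     bifurcating_family L hbar m lambda g (beta_ j) I_j phi_j ->
     ~ (exists theta, [/\ I_i theta, I_j theta & phi_i theta = phi_j theta]) /\
     branch I_i phi_i `&` branch I_j phi_j = set0) /\
  (forall (j : nat) (beta : R), (0 < j)%N -> beta != 0 ->
     beta_ j.+1 < beta < beta_ j ->
     exists phi : 'I_(2 * j) -> R -> complex R,
       injective phi /\
       forall n, nontrivial_solution L hbar m lambda g beta (phi n)).
Proof.
move=> beta_; split.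
  move=> i j I1 I2 phi1 phi2 i0 j0 ij _ _ fam1 fam2.
  have disj theta : I1 theta -> I2 theta -> phi1 theta <> phi2 theta.
    exact: (bifurcating_families_disjoint L_gt0 hbar_gt0 m_gt0 g_gt0 xiP i0 j0 ij fam1 fam2).
  split; first by move=> [theta [h1 h2]]; exact: disj.
  apply/seteqP; split => // -[f theta] [[b1 Ib1 [e1 eb1]] [b2 Ib2 [e2 eb2]]].
  move: Ib1 Ib2 e1 e2; rewrite eb1 eb2 => h1 h2 e1 e2.
  by apply: (disj theta h1 h2); rewrite e1 e2.
move=> j beta j0 _ /andP[_ hb]; apply: many_imaginary_solutions => //.
(* Positivity of the coefficient [a] means [beta < hbar * lambda], and [beta_ j] lies below
   [hbar * lambda] because [xi j] is positive. *)
have xj := dirichlet_eigenvalues_gt0 xiP j0.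
have kap0 : 0 < hbar ^+ 2 / (4 * m) by rewrite divr_gt0 ?exprn_gt0 ?mulr_gt0.
rewrite oppr_gt0 pmulr_llt0 ?invr_gt0// subr_lt0; apply: (lt_trans hb).
rewrite /beta_ /critical_beta opprB gtrDl oppr_lt0.
by rewrite mulrAC mulr_gt0.
Qed.
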